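(* Let $\Lambda$ be the set of triples $(\lambda,m,n)\in\mathbb{R}^3$ satisfying $$0<m\le 1,\qquad n>0,\qquad n<m,\qquad 0<\lambda<\frac{(2-n)(m-n)}{1-m+n}.$$ Let $(\lambda,m)$ be such that $0<m\le 1$ and $0<\lambda<\frac{2m}{1-m}$ (the last condition being read as $0<\lambda<\infty$ when $m=1$). Then there is $n_0=n_0(\lambda,m)>0$ such that for every $n\in(0,n_0)$ one has $(\lambda,m,n)\in\Lambda$ and the system $$\begin{aligned} \dot p&=p\Big(\tfrac1\lambda\big(r-\tfrac{2-n}{1+m-n}\big)-\tfrac{1-m+n}{1+m-n}+1-q-\lambda pr\Big), \\ \dot q&=q\big(1-q-\lambda pr\big)+b\,pr, \\ n\dot r&=r\Big(\tfrac{m-n}{\lambda}\big(r-\tfrac{2-n}{1+m-n}\big)+\tfrac{1-m+n}{1+m-n}-1+q+\lambda pr\Big) \end{aligned}$$ (where $\dot{(\cdot)}=\frac{d}{d\eta}$) admits a heteroclinic orbit $\eta\mapsto(p(\eta),q(\eta),r(\eta))$, $\eta\in\mathbb{R}$, joining the equilibrium $M_0$ (as $\eta\to-\infty$) to the equilibrium $M_1$ (as $\eta\to+\infty$), with the property that $$e^{-2\eta}\left[\begin{pmatrix} p(\eta) \\ q(\eta) \\ r(\eta) \end{pmatrix}-M_0\right]\to\kappa\,\vec X_{02}\quad\text{as }\eta\to-\infty,\qquad\text{for some }\kappa>0.$$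
   Context: For parameters $\lambda,m,n$ put $$a=\frac{2-n}{1+m-n}+\frac{2}{1+m-n}\lambda,\qquad b=\frac{1-m}{1+m-n}+\frac{1-m+n}{1+m-n}\lambda,$$ $$c=\frac{2-n}{1+m-n}-\frac{1-m+n}{(1+m-n)(m-n)}\lambda,\qquad d=\frac{1-m}{1+m-n}+\frac{2}{1+m-n}\lambda,\qquad A=\Big(\frac{m-n}{n}\Big)\frac{a}{\lambda}.$$ The equilibria of the system are denoted $M_0=(0,0,a)$ and $M_1=(0,1,c)$. The vector $$\vec X_{02}=\Big(1,\ ab,\ -\frac{\lambda a d}{m-n}\cdot\frac{1}{1-2A^{-1}}\Big)$$ is the eigenvector of the linearization of the system at $M_0$ with eigenvalue $2$; $n$ is always taken small enough that $1-A^{-1}>0$ and $1-2A^{-1}>0$. A heteroclinic orbit joining $M_0$ to $M_1$ is a solution defined for all $\eta\in\mathbb{R}$ converging to $M_0$ as $\eta\to-\infty$ and to $M_1$ as $\eta\to+\infty$. *)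

(* Defs.v *)
From Stdlib Require Import Reals.
From Coquelicot Require Import Coquelicot.
Open Scope R_scope.

Definition coef_a (lambda m n : R) : R :=
  (2 - n) / (1 + m - n) + 2 / (1 + m - n) * lambda.

Definition coef_b (lambda m n : R) : R :=
  (1 - m) / (1 + m - n) + (1 - m + n) / (1 + m - n) * lambda.

Definition coef_c (lambda m n : R) : R :=
  (2 - n) / (1 + m - n) - (1 - m + n) / ((1 + m - n) * (m - n)) * lambda.

Definition coef_d (lambda m n : R) : R :=
  (1 - m) / (1 + m - n) + 2 / (1 + m - n) * lambda.

Definition coef_A (lambda m n : R) : R := (m - n) / n * (coef_a lambda m n / lambda).

Definition M0 (lambda m n : R) : R * R * R := (0, 0, coef_a lambda m n).

Definition M1 (lambda m n : R) : R * R * R := (0, 1, coef_c lambda m n).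

Definition X02 (lambda m n : R) : R * R * R :=
  (1, coef_a lambda m n * coef_b lambda m n,
   - (lambda * coef_a lambda m n * coef_d lambda m n / (m - n))
     * (1 / (1 - 2 * / coef_A lambda m n))).

Definition Lambda (lambda m n : R) : Prop :=
  0 < m <= 1 /\ 0 < n /\ n < m /\
  0 < lambda < (2 - n) * (m - n) / (1 - m + n).

(* [Derive] is total, so differentiability is required separately. *)
Definition is_solution (lambda m n : R) (p q r : R -> R) : Prop :=
  forall eta : R,
    (ex_derive p eta /\ ex_derive q eta /\ ex_derive r eta) /\
    Derive p eta =
      p eta * (1 / lambda * (r eta - (2 - n) / (1 + m - n))
               - (1 - m + n) / (1 + m - n)
               + 1 - q eta - lambda * p eta * r eta) /\
    Derive q eta =
      q eta * (1 - q eta - lambda * p eta * r eta)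
      + coef_b lambda m n * p eta * r eta /\
    n * Derive r eta =
      r eta * ((m - n) / lambda * (r eta - (2 - n) / (1 + m - n))
               + (1 - m + n) / (1 + m - n)
               - 1 + q eta + lambda * p eta * r eta).

Definition heteroclinic_orbit (lambda m n : R) (p q r : R -> R) : Prop :=
  is_solution lambda m n p q r /\
  filterlim (fun eta => (p eta, q eta, r eta))
    (Rbar_locally m_infty) (locally (M0 lambda m n)) /\
  filterlim (fun eta => (p eta, q eta, r eta))
    (Rbar_locally p_infty) (locally (M1 lambda m n)).

(* Main.v *)
(** Put [mu = m - n], [K = mu a / lambda] and [w = 1/r].  Then [n w' = (K - q) w - (mu/lambda + lambda p)]
    is linear in [w] and repelling as long as [q < K], so a bounded [w] is determined by the future of
    [(p, q)] within a time of order [n].  After clamping [(p, q)] to a box, the map sending [(p, q)] to this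
    [w] and then integrating the two remaining equations from [-oo] with [p ~ e^(2 eta)],
    [q ~ a b e^(2 eta)] is a contraction in a norm weighted by [e^(3 eta) (1 + e^(2 eta))^G], with [G]
    independent of [n] and [n G] small; the first factor selects the eigendirection [X02] at [M0].  The
    slaving error [K - q - (mu/lambda + lambda p) r = n w'/w] is [O(n)], so the fixed point never reaches
    the boundary of the box and the clamps are inactive.

    Cone arguments bound [w'] by the speed [|(p', q')|], and then [w'] minus its value on the slow manifold
    by [n |(p', q')|].  Hence where [p' = 0] one has [q' > 0] and [p'/p] is decreasing, so [p'] changes sign
    at most once; a positive limit of [p] would force [q] to grow without bound, so [p -> 0], [q -> 1] and
    [w -> 1/c].  All perturbation terms are measured against [|(p', q')|] because for [m = 1] the
    reduced flow at [n = 0] has a whole line of equilibria. *)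

Require Import Defs.
From Stdlib Require Import Reals Lra Lia Psatz Classical ClassicalEpsilon.
From Coquelicot Require Import Coquelicot.
Open Scope R_scope.

(** * Repelling scalar equations and differential inequalities *)

(** Repulsion is used through one principle: a quantity that is bounded above and grows at a
    definite rate wherever it is positive is nonpositive at the start. Applied to [y - B u] it
    yields the bounds, the Lipschitz dependence and the asymptotics of [w]; applied to a quadratic
    form it yields the cones.

    The parameter condition enters through one inequality. At [n = 0] both [1 < K] and [b < 1] are
    equivalent to [lambda (1 - m) < 2 m], hence [max 1 (K b) < K]. A level [Q] strictly between
    keeps [w] repelling, because [Q < K], and stops [q], because [Q] exceeds both [1] and [K b]. All
    constants come from this [Q] and from bounds uniform in [n], so [n] is chosen last.

    For [m = 1] the coefficient [b] is itself of order [n], so on the set [p' = 0] the positive part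
    of [q'] is only of order [n]. A slaving error bounded by [n C] could cancel it; an error bounded
    by [n C |(p', q')|] can be absorbed into [q']. *)

Lemma derive_nonneg_le (f df : R -> R) (a b : R) :
  a <= b ->
  (forall s, a <= s <= b -> is_derive f s (df s)) ->
  (forall s, a <= s <= b -> 0 <= df s) -> f a <= f b.
Proof.
intros Hab Hd Hp.
destruct (MVT_gen f a b df) as [c [Hc E]].
- intros x Hx; rewrite Rmin_left, Rmax_right in Hx by lra; apply Hd; lra.
- intros x Hx; rewrite Rmin_left, Rmax_right in Hx by lra.
  apply continuity_pt_filterlim, (ex_derive_continuous f x).
  exists (df x); apply Hd; lra.
- rewrite Rmin_left, Rmax_right in Hc by lra.
  specialize (Hp c Hc); nra.
Qed.

Lemma is_derive_continuous (f : R -> R) (s l : R) :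
  is_derive f s l -> continuous f s.
Proof. intros H; apply (ex_derive_continuous f s); exists l; exact H. Qed.

Lemma continuous_locally_pos (f : R -> R) (s : R) :
  continuous f s -> 0 < f s ->
  exists d, 0 < d /\ forall t, Rabs (t - s) < d -> 0 < f t.
Proof.
intros Hc Hs.
destruct (proj1 (filterlim_locally f (f s)) Hc (mkposreal _ Hs)) as [d Hd].
exists d; split; [apply cond_pos|].
intros t Ht; specialize (Hd t Ht).
unfold ball in Hd; simpl in Hd; unfold AbsRing_ball, abs, minus, plus, opp in Hd; simpl in Hd.
apply Rabs_def2 in Hd; lra.
Qed.

Lemma first_zero (f : R -> R) (a b : R) :
  a <= b -> (forall s, a <= s -> continuous f s) -> 0 < f a -> f b <= 0 ->
  exists s, a < s <= b /\ f s = 0 /\ forall t, a <= t < s -> 0 < f t.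
Proof.
intros Hab Hc Ha Hb.
set (E := fun t => a <= t <= b /\ forall u, a <= u <= t -> 0 < f u).
destruct (completeness E) as [s [Hub Hlub]].
- exists b; intros t [Ht _]; lra.
- exists a; split; [lra|]. intros u Hu; replace u with a by lra; exact Ha.
- assert (Has : a <= s).
  { apply Hub; split; [lra|]. intros u Hu; replace u with a by lra; exact Ha. }
  assert (Hsb : s <= b) by (apply Hlub; intros t [Ht _]; lra).
  assert (Hpos : forall t, a <= t < s -> 0 < f t).
  { intros t Ht. destruct (classic (0 < f t)) as [|Hn]; [assumption|exfalso].
    assert (s <= t); [|lra].
    apply Hlub; intros u [Hu1 Hu2].
    destruct (Rle_dec u t) as [|Hut]; [assumption|].
    exfalso; apply Hn, Hu2; lra. }
  assert (Hs0 : f s = 0).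
  { destruct (Rtotal_order (f s) 0) as [Hlt|[Heq|Hgt]]; [exfalso|assumption|exfalso].
    - destruct (continuous_locally_pos (fun t => - f t) s) as [d [Hd Hd']].
      + apply (continuous_opp f), Hc; lra.
      + lra.
      + assert (a < s) by (destruct (Req_dec a s) as [->|]; lra).
        pose (t := Rmax a (s - d / 2)).
        assert (a <= t < s) by (unfold t; split; [apply Rmax_l|apply Rmax_lub_lt; lra]).
        assert (s - d / 2 <= t) by apply Rmax_r.
        specialize (Hpos t H0). specialize (Hd' t).
        assert (Rabs (t - s) < d) by (apply Rabs_def1; lra).
        specialize (Hd' H2); lra.
    - destruct (continuous_locally_pos f s) as [d [Hd Hd']]; [apply Hc; lra|lra|].
      assert (s < b) by (destruct (Req_dec s b) as [->|]; lra).
      assert (Rmin b (s + d / 2) <= s).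
      { apply Hub; split.
        - split; [apply Rmin_glb; lra | apply Rmin_l].
        - intros u Hu. destruct (Rlt_dec u s); [apply Hpos; lra|].
          apply Hd'. assert (u <= s + d / 2) by (eapply Rle_trans; [apply Hu|apply Rmin_r]).
          apply Rabs_def1; lra. }
      assert (s < Rmin b (s + d / 2)) by (apply Rmin_glb_lt; lra). lra. }
  exists s; repeat split; try assumption.
  destruct Has as [|Has]; [assumption|]. subst s; lra.
Qed.

Lemma derive_at_first_zero (f : R -> R) (a s l : R) :
  a < s -> is_derive f s l -> f s = 0 -> (forall t, a <= t < s -> 0 < f t) -> l <= 0.
Proof.
intros Has Hd Hs Hpos.
destruct (Rle_lt_dec l 0) as [|Hl]; [assumption|exfalso].
apply is_derive_Reals in Hd.
destruct (Hd (l / 2)) as [d Hd']; [lra|].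
pose (h := - Rmin (s - a) (d / 2)).
assert (0 < Rmin (s - a) (d / 2)) by (apply Rmin_glb_lt; [lra|]; pose proof (cond_pos d); lra).
assert (Rmin (s - a) (d / 2) <= d / 2) by apply Rmin_r.
assert (Rmin (s - a) (d / 2) <= s - a) by apply Rmin_l.
pose proof (cond_pos d).
assert (h < 0) by (unfold h; lra).
specialize (Hd' h).
assert (Rabs h < d) by (unfold h; rewrite Rabs_Ropp, Rabs_pos_eq; lra).
specialize (Hd' ltac:(lra) H4).
rewrite Hs in Hd'.
assert (0 < f (s + h)) by (apply Hpos; unfold h; lra).
assert ((f (s + h) - 0) / h < 0).
{ unfold Rdiv; rewrite Rminus_0_r. apply Ropp_lt_cancel; rewrite Ropp_0, Ropp_mult_distr_r.
  apply Rmult_lt_0_compat; [assumption|].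
  apply Rinv_lt_0_compat in H3; lra. }
apply Rabs_def2 in Hd'; lra.
Qed.

(** At a first zero the left difference quotients are nonpositive, so a strictly positive [df] at
    zeros excludes it. This is the barrier principle behind the trapping arguments. *)
Lemma stay_pos (f df : R -> R) (a : R) :
  (forall s, a <= s -> is_derive f s (df s)) -> 0 < f a ->
  (forall s, a <= s -> f s = 0 -> 0 < df s) ->
  forall s, a <= s -> 0 < f s.
Proof.
intros Hd Ha Hz s Hs.
destruct (Rlt_le_dec 0 (f s)) as [|Hn]; [assumption|exfalso].
destruct (first_zero f a s) as [t [Ht [Hft Hpos]]]; trivial.
{ intros u Hu; eapply is_derive_continuous, Hd, Hu. }
assert (df t <= 0) by (apply (derive_at_first_zero f a t); trivial; [lra|apply Hd; lra]).
specialize (Hz t ltac:(lra) Hft); lra.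
Qed.

(** While [y] exceeds half its initial value its slope is at least [c * (y s0 / 2) > 0], which keeps
    it there; linear growth already contradicts the bound [M]. *)
Lemma bounded_repelled_nonpos (y dy : R -> R) (c M s0 : R) :
  0 < c -> (forall s, s0 <= s -> is_derive y s (dy s)) ->
  (forall s, s0 <= s -> 0 < y s -> c * y s <= dy s) ->
  (forall s, s0 <= s -> y s <= M) -> y s0 <= 0.
Proof.
intros Hc Hd Hg HM.
destruct (Rle_lt_dec (y s0) 0) as [|H0]; [assumption|exfalso].
assert (Hpos : forall s, s0 <= s -> 0 < y s - y s0 / 2).
{ apply (stay_pos _ dy).
  - intros s Hs. replace (dy s) with (minus (dy s) 0) by (unfold minus, plus, opp; simpl; ring).
    apply (is_derive_minus y (fun _ => y s0 / 2)); [apply Hd, Hs|apply @is_derive_const].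
  - lra.
  - intros s Hs Hz. assert (y s = y s0 / 2) by lra.
    specialize (Hg s Hs ltac:(lra)). nra. }
pose (T := (Rabs M + 1) * / (c * (y s0 / 2))).
assert (Hc2 : 0 < c * (y s0 / 2)) by nra.
assert (HT : 0 < T).
{ unfold T; apply Rmult_lt_0_compat; [pose proof (Rabs_pos M); lra|].
  now apply Rinv_0_lt_compat. }
assert (Hm : y s0 - c * (y s0 / 2) * s0 <= y (s0 + T) - c * (y s0 / 2) * (s0 + T)).
{ apply (derive_nonneg_le (fun s => y s - c * (y s0 / 2) * s) (fun s => dy s - c * (y s0 / 2))).
  - lra.
  - intros s Hs. apply (is_derive_minus y (fun s => c * (y s0 / 2) * s)); [apply Hd; lra|].
    auto_derive; [trivial|ring].
  - intros s Hs. specialize (Hpos s ltac:(lra)). specialize (Hg s ltac:(lra) ltac:(lra)). nra. }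
assert (c * (y s0 / 2) * T = Rabs M + 1) by (unfold T; field; lra).
specialize (HM (s0 + T) ltac:(lra)).
pose proof (Rle_abs M). lra.
Qed.

(* The equation [n y' = k y - F] is repelling, so a bounded solution is slaved to the future of [F]. *)
Lemma bounded_solution_le (y k F u du : R -> R) (n kap L C M s0 : R) :
  0 < n -> 0 < kap -> n * L <= kap / 2 ->
  (forall s, s0 <= s -> is_derive y s ((k s * y s - F s) / n)) ->
  (forall s, s0 <= s -> is_derive u s (du s)) ->
  (forall s, s0 <= s -> 0 < u s /\ du s <= L * u s) ->
  (forall s, s0 <= s -> kap <= k s) ->
  (forall s, s0 <= s -> Rabs (F s) <= C * u s) ->
  (forall s, s0 <= s -> Rabs (y s) <= M) ->
  Rabs (y s0) <= 2 * C / kap * u s0.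
Proof.
intros Hn Hkap HnL Hy Hu Hu0 Hk HF HM.
(* With this [B], half of [kap * B * u] pays for [F] and the other half for [n * B * du], which
   [n * L <= kap / 2] bounds by [C * u]. The bound [M] does not enter the conclusion. *)
set (B := 2 * C / kap).
assert (HB : kap * B = 2 * C) by (unfold B; field; lra).
assert (HC : 0 <= C).
{ specialize (HF s0 ltac:(lra)). destruct (Hu0 s0 ltac:(lra)).
  pose proof (Rabs_pos (F s0)). nra. }
assert (HB0 : 0 <= B) by nra.
assert (Hkey : forall sg, sg = 1 \/ sg = -1 -> sg * y s0 - B * u s0 <= 0).
{ intros sg Hsg.
  apply (bounded_repelled_nonpos (fun s => sg * y s - B * u s)
    (fun s => sg * ((k s * y s - F s) / n) - B * du s) (kap / n) M s0).
  - apply Rdiv_lt_0_compat; assumption.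
  - intros s Hs.
    apply (is_derive_minus (fun s => sg * y s) (fun s => B * u s)).
    + apply (is_derive_scal y); auto.
    + apply (is_derive_scal u); auto.
  - intros s Hs Hpos.
    destruct (Hu0 s Hs) as [Hus Hdu]. specialize (Hk s Hs).
    specialize (HF s Hs).
    assert (HF' : sg * F s <= C * u s).
    { destruct (Rabs_def2 (F s) (C * u s + 1)) as [_ _]; [lra|].
      pose proof (Rle_abs (F s)). pose proof (Rle_abs (- F s)). rewrite Rabs_Ropp in *.
      destruct Hsg as [->| ->]; lra. }
    apply Rmult_le_reg_l with n; [assumption|].
    replace (n * (kap / n * (sg * y s - B * u s))) with (kap * (sg * y s - B * u s)) by (field; lra).
    replace (n * (sg * ((k s * y s - F s) / n) - B * du s))
      with (k s * (sg * y s) - sg * F s - n * (B * du s)) by (field; lra).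
    assert (n * (B * du s) <= C * u s).
    { apply Rle_trans with (n * (B * (L * u s))).
      - apply Rmult_le_compat_l; [lra|]. apply Rmult_le_compat_l; lra.
      - replace (n * (B * (L * u s))) with ((n * L) * (B * u s)) by ring.
        apply Rle_trans with (kap / 2 * (B * u s)); [|nra].
        apply Rmult_le_compat_r; nra. }
    assert (kap * (sg * y s) <= k s * (sg * y s)).
    { apply Rmult_le_compat_r; [|assumption]. nra. }
    nra.
  - intros s Hs. specialize (HM s Hs). destruct (Hu0 s Hs).
    pose proof (Rle_abs (y s)). pose proof (Rle_abs (- y s)). rewrite Rabs_Ropp in *.
    assert (0 <= B * u s) by nra.
    destruct Hsg as [->| ->]; lra. }
pose proof (Hkey 1 ltac:(lra)). pose proof (Hkey (-1) ltac:(lra)).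
apply Rabs_le; lra.
Qed.

(** * Comparison of functions vanishing at minus infinity *)

Definition vanishes_minf (f : R -> R) : Prop :=
  forall eps, 0 < eps -> exists T, forall s, s < T -> Rabs (f s) < eps.

Lemma exp_vanishes (C c : R) : 0 < c -> 0 <= C -> vanishes_minf (fun s => C * exp (c * s)).
Proof.
intros Hc HC eps He.
exists (ln (eps / (C + 1)) / c). intros s Hs.
assert (He' : 0 < eps / (C + 1)) by (apply Rdiv_lt_0_compat; lra).
assert (exp (c * s) < eps / (C + 1)).
{ rewrite <- (exp_ln (eps / (C + 1))) by assumption. apply exp_increasing.
  apply Rmult_lt_reg_l with (/ c); [now apply Rinv_0_lt_compat|].
  replace (/ c * (c * s)) with s by (field; lra). unfold Rdiv in Hs; lra. }
pose proof (exp_pos (c * s)).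
rewrite Rabs_pos_eq by nra.
assert (eps / (C + 1) * (C + 1) = eps) by (field; lra).
nra.
Qed.

Lemma vanishes_le (f g : R -> R) :
  (forall s, Rabs (f s) <= g s) -> vanishes_minf g -> vanishes_minf f.
Proof.
intros H Hg eps He. destruct (Hg eps He) as [T HT]. exists T; intros s Hs.
specialize (HT s Hs). specialize (H s). pose proof (Rle_abs (g s)). lra.
Qed.

Lemma vanishes_plus (f g : R -> R) :
  vanishes_minf f -> vanishes_minf g -> vanishes_minf (fun s => f s + g s).
Proof.
intros Hf Hg eps He. destruct (Hf (eps / 2)) as [T1 H1]; [lra|]. destruct (Hg (eps / 2)) as [T2 H2]; [lra|].
exists (Rmin T1 T2); intros s Hs.
pose proof (Rmin_l T1 T2). pose proof (Rmin_r T1 T2).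
specialize (H1 s ltac:(lra)). specialize (H2 s ltac:(lra)).
pose proof (Rabs_triang (f s) (g s)). lra.
Qed.

Lemma vanishes_scal (f : R -> R) (c : R) :
  vanishes_minf f -> vanishes_minf (fun s => c * f s).
Proof.
intros Hf eps He.
pose proof (Rabs_pos c).
destruct (Hf (eps / (Rabs c + 1))) as [T HT]; [apply Rdiv_lt_0_compat; lra|].
exists T; intros s Hs. specialize (HT s Hs). rewrite Rabs_mult.
assert (eps / (Rabs c + 1) * (Rabs c + 1) = eps) by (field; lra).
pose proof (Rabs_pos (f s)). nra.
Qed.

Lemma nonneg_of_derive_minf (h dh : R -> R) :
  (forall s, is_derive h s (dh s)) -> (forall s, 0 <= dh s) -> vanishes_minf h ->
  forall s, 0 <= h s.
Proof.
intros Hd Hp Hv s.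
destruct (Rle_lt_dec 0 (h s)) as [|Hn]; [assumption|exfalso].
destruct (Hv (- h s)) as [T HT]; [lra|].
pose (t := Rmin s (T - 1)).
assert (t <= s) by apply Rmin_l. assert (t <= T - 1) by apply Rmin_r.
specialize (HT t ltac:(lra)). apply Rabs_def2 in HT.
assert (h t <= h s) by (apply (derive_nonneg_le h dh); auto). lra.
Qed.

Lemma le_of_derive_le (f df u du : R -> R) :
  (forall s, is_derive f s (df s)) -> (forall s, is_derive u s (du s)) ->
  (forall s, df s <= du s) -> vanishes_minf f -> vanishes_minf u ->
  forall s, f s <= u s.
Proof.
intros Hf Hu Hle Hvf Hvu s.
assert (0 <= u s + -1 * f s); [|lra].
apply (nonneg_of_derive_minf (fun s => u s + -1 * f s) (fun s => du s + -1 * df s)).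
- intros t. apply (is_derive_plus u (fun s => -1 * f s)); [auto|]. apply (is_derive_scal f); auto.
- intros t; specialize (Hle t); lra.
- apply vanishes_plus; [assumption|]. now apply vanishes_scal.
Qed.

Lemma abs_le_of_derive_abs_le (f df u du : R -> R) :
  (forall s, is_derive f s (df s)) -> (forall s, is_derive u s (du s)) ->
  (forall s, Rabs (df s) <= du s) -> vanishes_minf f -> vanishes_minf u ->
  forall s, Rabs (f s) <= u s.
Proof.
intros Hf Hu Hle Hvf Hvu s.
assert (H1 : f s <= u s).
{ apply (le_of_derive_le f df u du); trivial.
  intros t; specialize (Hle t); pose proof (Rle_abs (df t)); lra. }
assert (H2 : -1 * f s <= u s).
{ apply (le_of_derive_le (fun s => -1 * f s) (fun s => -1 * df s) u du); trivial.
  - intros t; apply (is_derive_scal f); auto.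
  - intros t; specialize (Hle t); pose proof (Rle_abs (- df t)). rewrite Rabs_Ropp in *; lra.
  - now apply vanishes_scal. }
apply Rabs_le; lra.
Qed.

(** * Bounded solutions and antiderivatives on the line *)

Lemma is_derive_RInt0 (f : R -> R) :
  (forall s, continuous f s) -> forall s, is_derive (fun t => RInt f 0 t) s (f s).
Proof.
intros Hf s. apply (is_derive_RInt f (fun t => RInt f 0 t) 0 s); [|apply Hf].
apply filter_forall; intros t. apply (RInt_correct f).
apply (ex_RInt_continuous f); intros; apply Hf.
Qed.

(* The constant of integration is squeezed between [G - u], nonincreasing, and [G + u], nondecreasing. *)
Lemma antiderivative_dominated (f u du : R -> R) :
  (forall s, continuous f s) -> (forall s, is_derive u s (du s)) ->
  (forall s, Rabs (f s) <= du s) -> (forall s, 0 <= u s) ->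
  exists F : R -> R, (forall s, is_derive F s (f s)) /\ forall s, Rabs (F s) <= u s.
Proof.
intros Hf Hu Hfu Hu0.
set (G := fun t => RInt f 0 t).
assert (HG : forall s, is_derive G s (f s)) by apply (is_derive_RInt0 f Hf).
assert (Hup : forall s t, s <= t -> G s + u s <= G t + u t).
{ intros s t Hst. apply (derive_nonneg_le (fun s => G s + u s) (fun s => f s + du s)); trivial.
  - intros x _. apply (is_derive_plus G u); auto.
  - intros x _. specialize (Hfu x). pose proof (Rle_abs (- f x)). rewrite Rabs_Ropp in *. lra. }
assert (Hdn : forall s t, s <= t -> G t - u t <= G s - u s).
{ intros s t Hst.
  assert (u s - G s <= u t - G t); [|lra].
  apply (derive_nonneg_le (fun s => u s - G s) (fun s => du s - f s)); trivial.
  - intros x _. apply (is_derive_minus u G); auto.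
  - intros x _. specialize (Hfu x). pose proof (Rle_abs (f x)). lra. }
assert (Hcross : forall s t, G s - u s <= G t + u t).
{ intros s t. pose proof (Hu0 s). pose proof (Hu0 t). destruct (Rle_dec s t) as [H1|H1].
  - specialize (Hup s t H1). lra.
  - specialize (Hdn t s ltac:(lra)). lra. }
destruct (completeness (fun x => exists s, x = G s - u s)) as [L [HL1 HL2]].
- exists (G 0 + u 0). intros x [s ->]. apply Hcross.
- exists (G 0 - u 0). now exists 0.
- exists (fun s => G s - L). split.
  + intros s. replace (f s) with (minus (f s) 0) by (unfold minus, plus, opp; simpl; ring).
    apply (is_derive_minus G (fun _ => L)); [apply HG|apply @is_derive_const].
  + intros s. assert (G s - u s <= L) by (apply HL1; now exists s).
    assert (L <= G s + u s) by (apply HL2; intros x [t ->]; apply Hcross).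
    apply Rabs_le; lra.
Qed.

(** The bounded solution is [exp E] times the integral of [exp (- E) * phi / n] over the future. In
    reversed time this integral is an antiderivative dominated by [f1 / k0 * exp (- E)], so no
    improper integral is formed. The lower bound is the repelling principle applied to
    [f0 / k1 - w]. *)
Lemma bounded_solution_exists (k phi : R -> R) (n k0 k1 f0 f1 : R) :
  0 < n -> 0 < k0 -> 0 <= f0 ->
  (forall s, continuous k s) -> (forall s, continuous phi s) ->
  (forall s, k0 <= k s <= k1) -> (forall s, f0 <= phi s <= f1) ->
  exists w : R -> R, (forall s, is_derive w s ((k s * w s - phi s) / n)) /\
    forall s, f0 / k1 <= w s <= f1 / k0.
Proof.
intros Hn Hk0 Hf0 Hck Hcp Hk Hp.
assert (Hck' : forall s, continuous (fun s => k s / n) s).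
{ intros s. apply (continuous_mult k (fun _ => / n)); [apply Hck|apply continuous_const]. }
set (E := fun t => RInt (fun s => k s / n) 0 t).
assert (HE : forall s, is_derive E s (k s / n)) by apply (is_derive_RInt0 _ Hck').
assert (HE' : forall s, is_derive (fun s => exp (- E (- s))) s (k (- s) / n * exp (- E (- s)))).
{ intros s. evar_last.
  - apply (is_derive_comp exp (fun s => - E (- s))).
    + apply is_derive_exp.
    + apply (is_derive_opp (fun s => E (- s))). apply (is_derive_comp E (fun s => - s)).
      * apply HE.
      * apply (is_derive_opp (fun s : R => s)), @is_derive_id.
  - unfold scal, opp, one; simpl; unfold mult; simpl; ring. }
destruct (antiderivative_dominated (fun s => exp (- E (- s)) * (phi (- s) / n))
   (fun s => f1 / k0 * exp (- E (- s))) (fun s => f1 / k0 * (k (- s) / n * exp (- E (- s)))))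
  as [F [HF HFu]].
- intros s. apply (continuous_mult (fun s => exp (- E (- s))) (fun s => phi (- s) / n)).
  + eapply is_derive_continuous, HE'.
  + apply (continuous_mult (fun s => phi (- s)) (fun _ => / n)); [|apply continuous_const].
    apply (continuous_comp (fun s => - s) phi); [|apply Hcp].
    apply (continuous_opp (fun s : R => s)), continuous_id.
- intros s. apply (is_derive_scal (fun s => exp (- E (- s)))), HE'.
- intros s. pose proof (exp_pos (- E (- s))). specialize (Hk (- s)). specialize (Hp (- s)).
  rewrite Rabs_pos_eq.
  + replace (f1 / k0 * (k (- s) / n * exp (- E (- s))))
      with (exp (- E (- s)) * (f1 * (k (- s) / k0) / n)) by (field; lra).
    apply Rmult_le_compat_l; [lra|]. apply Rmult_le_compat_r; [left; now apply Rinv_0_lt_compat|].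
    assert (1 <= k (- s) / k0).
    { apply Rmult_le_reg_r with k0; [assumption|]. unfold Rdiv; rewrite Rmult_assoc, Rinv_l; lra. }
    nra.
  + apply Rmult_le_pos; [lra|]. apply Rmult_le_pos; [lra|]. left; now apply Rinv_0_lt_compat.
- intros s. pose proof (exp_pos (- E (- s))). specialize (Hp (- s)).
  apply Rmult_le_pos; [|lra]. apply Rmult_le_pos; [lra|]. left; now apply Rinv_0_lt_compat.
- set (w := fun s => exp (E s) * F (- s)).
  assert (Hw : forall s, is_derive w s ((k s * w s - phi s) / n)).
  { intros s. unfold w. evar_last.
    - apply (is_derive_mult (fun s => exp (E s)) (fun s => F (- s))).
      + apply (is_derive_comp exp E); [apply is_derive_exp|apply HE].
      + apply (is_derive_comp F (fun s => - s)); [apply HF|].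
        apply (is_derive_opp (fun s : R => s)), @is_derive_id.
      + intros; apply Rmult_comm.
    - unfold plus, mult, scal, opp, one; simpl; unfold mult; simpl.
      rewrite Ropp_involutive.
      assert (exp (E s) * exp (- E s) = 1) by (rewrite <- exp_plus, Rplus_opp_r; apply exp_0).
      replace (k s / n * exp (E s) * F (- s) + exp (E s) * (- (1) * (exp (- E s) * (phi s / n))))
        with (k s / n * exp (E s) * F (- s) - (exp (E s) * exp (- E s)) * (phi s / n)) by ring.
      rewrite H. field. lra. }
  assert (Hwb : forall s, Rabs (w s) <= f1 / k0).
  { intros s. unfold w. rewrite Rabs_mult, Rabs_pos_eq by (left; apply exp_pos).
    specialize (HFu (- s)). rewrite Ropp_involutive in HFu.
    pose proof (exp_pos (E s)).
    assert (He : exp (E s) * exp (- E s) = 1) by (rewrite <- exp_plus, Rplus_opp_r; apply exp_0).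
    apply Rle_trans with (exp (E s) * (f1 / k0 * exp (- E s))).
    - apply Rmult_le_compat_l; lra.
    - replace (exp (E s) * (f1 / k0 * exp (- E s))) with (f1 / k0 * (exp (E s) * exp (- E s))) by ring.
      rewrite He; lra. }
  exists w; split; [exact Hw|].
  intros s; split; [|specialize (Hwb s); pose proof (Rle_abs (w s)); lra].
  assert (f0 / k1 - w s <= 0); [|lra].
  assert (Hk1 : 0 < k1) by (specialize (Hk 0); lra).
  apply (bounded_repelled_nonpos (fun s => f0 / k1 - w s) (fun s => 0 - (k s * w s - phi s) / n)
    (k0 / n) (f0 / k1 + f1 / k0)).
  + now apply Rdiv_lt_0_compat.
  + intros t _. apply (is_derive_minus (fun _ => f0 / k1) w); [apply @is_derive_const|apply Hw].
  + intros t _ Hpos. specialize (Hk t). specialize (Hp t).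
    apply Rmult_le_reg_l with n; [assumption|].
    replace (n * (k0 / n * (f0 / k1 - w t))) with (k0 * (f0 / k1 - w t)) by (field; lra).
    replace (n * (0 - (k t * w t - phi t) / n)) with (k t * (f0 / k1 - w t) + (phi t - f0 * (k t / k1)))
      by (field; lra).
    assert (k t / k1 <= 1).
    { apply Rmult_le_reg_r with k1; [assumption|]. unfold Rdiv; rewrite Rmult_assoc, Rinv_l; lra. }
    nra.
  + intros t _. specialize (Hwb t). pose proof (Rle_abs (- w t)). rewrite Rabs_Ropp in *. lra.
Qed.

(** * Clamping to an interval *)

Definition clamp (M x : R) : R := Rmax 0 (Rmin x M).

Lemma clamp_range (M x : R) : 0 <= M -> 0 <= clamp M x <= M.
Proof.
intros HM; unfold clamp; split; [apply Rmax_l|].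
apply Rmax_lub; [assumption|apply Rmin_r].
Qed.

Lemma clamp_id (M x : R) : 0 <= x <= M -> clamp M x = x.
Proof. intros H; unfold clamp; rewrite Rmin_left, Rmax_right; lra. Qed.

Lemma clamp_above (M x : R) : 0 <= M -> M <= x -> clamp M x = M.
Proof. intros H H'; unfold clamp; rewrite Rmin_right, Rmax_right; lra. Qed.

Lemma clamp_below (M x : R) : x <= 0 -> clamp M x = 0.
Proof.
intros H; unfold clamp; rewrite Rmax_left; [reflexivity|].
eapply Rle_trans; [apply Rmin_l|assumption].
Qed.

Lemma clamp_le (M x y : R) : 0 <= y -> x <= y -> clamp M x <= y.
Proof.
intros H H'; unfold clamp; apply Rmax_lub; [assumption|].
eapply Rle_trans; [apply Rmin_l|assumption].
Qed.

Lemma clamp_lipschitz (M x y : R) : 0 <= M -> Rabs (clamp M x - clamp M y) <= Rabs (x - y).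
Proof.
intros HM.
assert (H : forall x, clamp M x = 0 /\ x <= 0 \/ clamp M x = x /\ 0 <= x <= M \/ clamp M x = M /\ M <= x).
{ intros z. destruct (Rle_dec z 0); [left; split; [now apply clamp_below|assumption]|].
  destruct (Rle_dec z M); [right; left; split; [apply clamp_id; lra|lra]|].
  right; right; split; [apply clamp_above|]; lra. }
apply Rabs_le.
destruct (Rcase_abs (x - y)) as [Hs|Hs];
  [rewrite Rabs_left by assumption|rewrite Rabs_right by assumption];
destruct (H x) as [[-> ?]|[[-> ?]|[-> ?]]]; destruct (H y) as [[-> ?]|[[-> ?]|[-> ?]]]; lra.
Qed.

Lemma clamp_continuous (M : R) (f : R -> R) (s : R) :
  0 <= M -> continuous f s -> continuous (fun t => clamp M (f t)) s.
Proof.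
intros HM Hf. apply filterlim_locally. intros eps.
generalize (proj1 (filterlim_locally f (f s)) Hf eps). apply filter_imp.
intros t Ht. unfold ball in *; simpl in *; unfold AbsRing_ball, abs, minus, plus, opp in *; simpl in *.
eapply Rle_lt_trans; [apply (clamp_lipschitz M (f t) (f s) HM)|exact Ht].
Qed.

(** * Pointwise estimates for the vector field *)

Lemma Rabs_mult_le (x y X Y : R) : Rabs x <= X -> Rabs y <= Y -> Rabs (x * y) <= X * Y.
Proof.
intros; rewrite Rabs_mult; apply Rmult_le_compat; trivial; apply Rabs_pos.
Qed.

Lemma Rabs_plus_le (x y X Y : R) : Rabs x <= X -> Rabs y <= Y -> Rabs (x + y) <= X + Y.
Proof. intros; pose proof (Rabs_triang x y); lra. Qed.

Lemma Rabs_minus_le (x y X Y : R) : Rabs x <= X -> Rabs y <= Y -> Rabs (x - y) <= X + Y.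
Proof. intros; apply Rabs_plus_le; [assumption|now rewrite Rabs_Ropp]. Qed.

Lemma Rabs_div_le (x y X : R) : 0 < y -> Rabs x <= X -> Rabs (x / y) <= X / y.
Proof.
intros Hy Hx; unfold Rdiv; rewrite Rabs_mult, (Rabs_pos_eq (/ y)) by (left; now apply Rinv_0_lt_compat).
apply Rmult_le_compat_r; [left; now apply Rinv_0_lt_compat|assumption].
Qed.

Lemma inv_le (a w : R) : 0 < a -> / a <= w -> 0 < / w <= a.
Proof.
intros Ha Hw. assert (0 < / a) by now apply Rinv_0_lt_compat.
split; [apply Rinv_0_lt_compat; lra|].
rewrite <- (Rinv_inv a). now apply Rinv_le_contravar.
Qed.

(* [p'/p] and [q'] in terms of [w = 1/r]; the constants of the paper's [p]-equation combine to [2] at [r = a]. *)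
Definition growth_p (lam a p q w : R) : R := 2 + (/ w - a) / lam - q - lam * p * / w.

Definition rate_q (lam b p q w : R) : R := q * (1 - q - lam * p * / w) + b * p * / w.

Section PointwiseEstimates.

Variables lam a b A B P Q cp cq cw : R.
Hypotheses (Hlam : 0 < lam) (Ha : 0 < a <= A) (Hb : 0 <= b <= B).
Hypotheses (HP : 0 < P) (HQ : 0 < Q) (Hcp : 0 <= cp) (Hcq : 0 <= cq) (Hcw : 0 <= cw).

Lemma inv_range (w : R) : / a <= w -> 0 < / w <= A.
Proof.
intros H. pose proof (inv_le a w (proj1 Ha) H). lra.
Qed.

Lemma inv_lipschitz (w1 w2 : R) :
  / a <= w1 -> / a <= w2 -> Rabs (/ w1 - / w2) <= A * A * Rabs (w1 - w2).
Proof.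
intros H1 H2. pose proof (inv_range _ H1). pose proof (inv_range _ H2).
assert (0 < / a) by (apply Rinv_0_lt_compat; lra).
replace (/ w1 - / w2) with (/ w1 * / w2 * - (w1 - w2)) by (field; lra).
rewrite Rabs_mult, Rabs_Ropp. apply Rmult_le_compat_r; [apply Rabs_pos|].
apply Rabs_mult_le; rewrite Rabs_pos_eq; lra.
Qed.

(** The form is dictated by the weight, whose logarithmic derivative is [3 + 2 * G * theta]: the
    eigenvalue [2] at [M0] must stay apart from the part carrying a factor [th], and only that part
    may have a large coefficient. Each nonlinear term has a factor [p], [q] or [/ w - a], which is
    at most a multiple of [th]. *)
Lemma rate_p_lipschitz (p1 p2 q1 q2 w1 w2 th x y z : R) :
  0 <= p1 <= cp * th -> 0 <= p2 <= cp * th -> p2 <= P -> 0 <= q1 <= cq * th ->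
  / a <= w1 -> / a <= w2 -> Rabs (w1 - / a) <= cw * th ->
  Rabs (p1 - p2) <= x -> Rabs (q1 - q2) <= y -> Rabs (w1 - w2) <= z ->
  Rabs (p1 * growth_p lam a p1 q1 w1 - p2 * growth_p lam a p2 q2 w2) <=
  2 * x + ((A * A * cw / lam + cq + lam * A * cp) * x
     + cp * (A * A * z / lam + y + lam * (A * x + P * (A * A * z)))) * th.
Proof.
intros Hp1 Hp2 Hp2' Hq1 Hw1 Hw2 Hw Hx Hy Hz.
unfold growth_p.
pose proof (inv_range _ Hw1) as Hr1. pose proof (inv_range _ Hw2) as Hr2.
pose proof (inv_lipschitz _ _ Hw1 Hw2) as Hr.
assert (Hra : Rabs (/ w1 - a) <= A * A * (cw * th)).
{ pose proof (inv_lipschitz w1 (/ a) Hw1 (Rle_refl _)) as H. rewrite Rinv_inv in H.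
  eapply Rle_trans; [exact H|]. apply Rmult_le_compat_l; [nra|assumption]. }
assert (Hr' : Rabs (/ w1 - / w2) <= A * A * z).
{ eapply Rle_trans; [exact Hr|]. apply Rmult_le_compat_l; [nra|assumption]. }
set (r1 := / w1) in *. set (r2 := / w2) in *.
replace (p1 * (2 + (r1 - a) / lam - q1 - lam * p1 * r1) - p2 * (2 + (r2 - a) / lam - q2 - lam * p2 * r2))
  with (2 * (p1 - p2) + ((p1 - p2) * ((r1 - a) / lam - q1 - lam * r1 * p1)
     + p2 * ((r1 - r2) / lam - (q1 - q2) - lam * (r1 * (p1 - p2) + p2 * (r1 - r2)))))
  by (field; lra).
apply Rle_trans with (2 * x + (x * (A * A * (cw * th) / lam + cq * th + lam * A * (cp * th))
  + cp * th * (A * A * z / lam + y + lam * (A * x + P * (A * A * z))))).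
- apply Rabs_plus_le.
  + apply Rabs_mult_le; [rewrite Rabs_pos_eq; lra|assumption].
  + apply Rabs_plus_le; apply Rabs_mult_le; trivial.
    * apply Rabs_minus_le; [apply Rabs_minus_le|].
      -- now apply Rabs_div_le.
      -- rewrite Rabs_pos_eq; lra.
      -- apply Rabs_mult_le; [|rewrite Rabs_pos_eq; lra].
         apply Rabs_mult_le; rewrite Rabs_pos_eq; lra.
    * rewrite Rabs_pos_eq; lra.
    * apply Rabs_minus_le; [apply Rabs_minus_le|]; trivial.
      -- now apply Rabs_div_le.
      -- apply Rabs_mult_le; [rewrite Rabs_pos_eq; lra|].
         apply Rabs_plus_le; apply Rabs_mult_le; trivial; rewrite Rabs_pos_eq; lra.
- right; field; lra.
Qed.

(** Here the linear part is [y + A * B * x]: the coupling bounds the off-diagonal entry [a * b] of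
    the linearization and is not small. The scaling [q_scale] of the norm will compensate for it. *)
Lemma rate_q_lipschitz (p1 p2 q1 q2 w1 w2 th x y z : R) :
  0 <= p1 <= cp * th -> 0 <= p2 <= cp * th -> p2 <= P -> 0 <= q1 <= cq * th -> 0 <= q2 <= cq * th ->
  / a <= w1 -> / a <= w2 ->
  Rabs (p1 - p2) <= x -> Rabs (q1 - q2) <= y -> Rabs (w1 - w2) <= z ->
  Rabs (rate_q lam b p1 q1 w1 - rate_q lam b p2 q2 w2) <=
  y + A * B * x + (2 * cq * y + lam * A * cp * y + lam * cq * (A * x + P * (A * A * z))
     + B * cp * (A * A * z)) * th.
Proof.
intros Hp1 Hp2 Hp2' Hq1 Hq2 Hw1 Hw2 Hx Hy Hz.
unfold rate_q.
pose proof (inv_range _ Hw1) as Hr1. pose proof (inv_range _ Hw2) as Hr2.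
pose proof (inv_lipschitz _ _ Hw1 Hw2) as Hr.
assert (Hr' : Rabs (/ w1 - / w2) <= A * A * z).
{ eapply Rle_trans; [exact Hr|]. apply Rmult_le_compat_l; [nra|assumption]. }
set (r1 := / w1) in *. set (r2 := / w2) in *.
replace (q1 * (1 - q1 - lam * p1 * r1) + b * p1 * r1 - (q2 * (1 - q2 - lam * p2 * r2) + b * p2 * r2))
  with ((q1 - q2) + b * r1 * (p1 - p2)
    + (- ((q1 + q2) * (q1 - q2)) - lam * r1 * p1 * (q1 - q2)
       - lam * q2 * (r1 * (p1 - p2) + p2 * (r1 - r2)) + b * p2 * (r1 - r2))) by ring.
assert (0 <= A * A * z) by (pose proof (Rabs_pos (r1 - r2)); lra).
assert (0 <= x) by (pose proof (Rabs_pos (p1 - p2)); lra).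
assert (0 <= y) by (pose proof (Rabs_pos (q1 - q2)); lra).
apply Rle_trans with (y + B * A * x
  + ((cq * th + cq * th) * y + lam * A * (cp * th) * y
     + lam * (cq * th) * (A * x + P * (A * A * z)) + B * (cp * th) * (A * A * z))).
- apply Rabs_plus_le; [apply Rabs_plus_le|]; trivial.
  + apply Rabs_mult_le; trivial. apply Rabs_mult_le; rewrite Rabs_pos_eq; lra.
  + apply Rabs_plus_le; [apply Rabs_minus_le; [apply Rabs_minus_le|]|].
    * rewrite Rabs_Ropp. apply Rabs_mult_le; trivial. rewrite Rabs_pos_eq; lra.
    * apply Rabs_mult_le; trivial. apply Rabs_mult_le; [|rewrite Rabs_pos_eq; lra].
      apply Rabs_mult_le; rewrite Rabs_pos_eq; lra.
    * apply Rabs_mult_le.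
      -- apply Rabs_mult_le; rewrite Rabs_pos_eq; lra.
      -- apply Rabs_plus_le; apply Rabs_mult_le; trivial; rewrite Rabs_pos_eq; lra.
    * apply Rabs_mult_le; trivial. apply Rabs_mult_le; rewrite Rabs_pos_eq; lra.
- right; ring.
Qed.

Lemma growth_p_near (p q w th : R) :
  0 <= p <= cp * th -> 0 <= q <= cq * th -> / a <= w -> Rabs (w - / a) <= cw * th ->
  Rabs (growth_p lam a p q w - 2) <= (A * A * cw / lam + cq + lam * A * cp) * th.
Proof.
intros Hp Hq Hw1 Hw. unfold growth_p.
pose proof (inv_range _ Hw1) as Hr1.
assert (Hra : Rabs (/ w - a) <= A * A * (cw * th)).
{ pose proof (inv_lipschitz w (/ a) Hw1 (Rle_refl _)) as H. rewrite Rinv_inv in H.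
  eapply Rle_trans; [exact H|]. apply Rmult_le_compat_l; [nra|assumption]. }
set (r := / w) in *.
replace (2 + (r - a) / lam - q - lam * p * r - 2) with ((r - a) / lam - q - lam * r * p) by ring.
apply Rle_trans with (A * A * (cw * th) / lam + cq * th + lam * A * (cp * th)); [|right; field; lra].
apply Rabs_minus_le; [apply Rabs_minus_le|].
- now apply Rabs_div_le.
- rewrite Rabs_pos_eq; lra.
- apply Rabs_mult_le; [|rewrite Rabs_pos_eq; lra].
  apply Rabs_mult_le; rewrite Rabs_pos_eq; lra.
Qed.

(** A remainder quadratic in [th] is of order [exp (4 s)] at minus infinity, hence within the
    weight. *)
Lemma rate_q_near (p q w th : R) :
  0 <= p <= cp * th -> 0 <= q <= cq * th -> / a <= w -> Rabs (w - / a) <= cw * th ->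
  Rabs (rate_q lam b p q w - (q + a * b * p)) <=
  (cq * (cq + lam * A * cp) + B * cp * (A * A * cw)) * (th * th).
Proof.
intros Hp Hq Hw1 Hw. unfold rate_q.
pose proof (inv_range _ Hw1) as Hr1.
assert (Hra : Rabs (/ w - a) <= A * A * (cw * th)).
{ pose proof (inv_lipschitz w (/ a) Hw1 (Rle_refl _)) as H. rewrite Rinv_inv in H.
  eapply Rle_trans; [exact H|]. apply Rmult_le_compat_l; [nra|assumption]. }
set (r := / w) in *.
replace (q * (1 - q - lam * p * r) + b * p * r - (q + a * b * p))
  with (- (q * (q + lam * r * p)) + b * p * (r - a)) by ring.
apply Rle_trans with (cq * th * (cq * th + lam * A * (cp * th)) + B * (cp * th) * (A * A * (cw * th)));
  [|right; ring].
apply Rabs_plus_le.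
- rewrite Rabs_Ropp. apply Rabs_mult_le; [rewrite Rabs_pos_eq; lra|].
  apply Rabs_plus_le; [rewrite Rabs_pos_eq; lra|].
  apply Rabs_mult_le; [|rewrite Rabs_pos_eq; lra].
  apply Rabs_mult_le; rewrite Rabs_pos_eq; lra.
- apply Rabs_mult_le; trivial. apply Rabs_mult_le; rewrite Rabs_pos_eq; lra.
Qed.

(** The condition on [w] means [r <= a], so everything added to [2] is nonpositive. The sharp
    constant [2] is what lets the bound [exp (2 s)] pass from one iterate to the next. *)
Lemma growth_p_le (p q w : R) : 0 <= p -> 0 <= q -> / a <= w -> growth_p lam a p q w <= 2.
Proof.
intros Hp Hq Hw. unfold growth_p.
pose proof (inv_le a w (proj1 Ha) Hw) as Hr.
assert ((/ w - a) / lam <= 0).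
{ unfold Rdiv. pose proof (Rinv_0_lt_compat lam Hlam). nra. }
assert (0 <= lam * p * / w) by (apply Rmult_le_pos; [apply Rmult_le_pos|]; lra).
lra.
Qed.

Lemma rate_q_le (p q w : R) : 0 <= p -> 0 <= q -> / a <= w -> rate_q lam b p q w <= q + a * b * p.
Proof.
intros Hp Hq Hw. unfold rate_q.
pose proof (inv_le a w (proj1 Ha) Hw) as Hr.
assert (0 <= lam * p * / w) by (apply Rmult_le_pos; [apply Rmult_le_pos|]; lra).
assert (0 <= b * p) by (apply Rmult_le_pos; lra).
nra.
Qed.

End PointwiseEstimates.

(** * The weight and weighted limits *)

(** [4 * c * (3 / 4) ^ k] is the sum of the tail; subtracting it makes the sequence nondecreasing
    and adding it nonincreasing, so the limit is a supremum. *)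
Lemma geometric_cauchy_limit (u : nat -> R) (c : R) :
  (forall k, Rabs (u (S k) - u k) <= c * (3 / 4) ^ k) ->
  exists l, forall k, Rabs (u k - l) <= 4 * c * (3 / 4) ^ k.
Proof.
intros Hu.
assert (Hc : 0 <= c).
{ specialize (Hu O). simpl in Hu. pose proof (Rabs_pos (u 1%nat - u O)). lra. }
set (e := fun k => 4 * c * (3 / 4) ^ k).
assert (He : forall k, 0 <= e k).
{ intros k; unfold e; apply Rmult_le_pos; [lra|apply pow_le; lra]. }
assert (Hstep : forall k, e (S k) + Rabs (u (S k) - u k) <= e k).
{ intros k; specialize (Hu k); unfold e; simpl. lra. }
assert (Hmono : forall k j, u k - e k <= u (j + k)%nat - e (j + k)%nat /\
                            u (j + k)%nat + e (j + k)%nat <= u k + e k).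
{ intros k j; induction j as [|j IH]; simpl; [lra|].
  specialize (Hstep (j + k)%nat).
  pose proof (Rle_abs (u (S (j + k)) - u (j + k)%nat)).
  pose proof (Rle_abs (- (u (S (j + k)) - u (j + k)%nat))). rewrite Rabs_Ropp in *. lra. }
assert (Hcross : forall j k, u k - e k <= u j + e j).
{ intros j k. pose proof (He j). pose proof (He k).
  destruct (Nat.le_ge_cases j k) as [H1|H1].
  - destruct (Hmono j (k - j)%nat) as [_ H2].
    replace (k - j + j)%nat with k in H2 by lia. lra.
  - destruct (Hmono k (j - k)%nat) as [H2 _].
    replace (j - k + k)%nat with j in H2 by lia. lra. }
destruct (completeness (fun x => exists k, x = u k - e k)) as [l [Hl1 Hl2]].
- exists (u O + e O). intros x [k ->]. apply Hcross.
- exists (u O - e O). now exists O.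
- exists l; intros k. fold (e k).
  assert (u k - e k <= l) by (apply Hl1; now exists k).
  assert (l <= u k + e k) by (apply Hl2; intros x [j ->]; apply Hcross).
  apply Rabs_le; lra.
Qed.

Lemma pow_eventually_small (x : R) :
  0 < x -> exists k, (3 / 4) ^ k < x.
Proof.
intros Hx. destruct (pow_lt_1_zero (3 / 4) ltac:(rewrite Rabs_pos_eq; lra) x Hx) as [N HN].
exists N. specialize (HN N (le_n N)). rewrite Rabs_pos_eq in HN; [assumption|apply pow_le; lra].
Qed.

Lemma zero_of_geometric_bound (x c : R) :
  (forall k, Rabs x <= c * (3 / 4) ^ k) -> x = 0.
Proof.
intros H. destruct (Req_dec x 0) as [|Hx]; [assumption|exfalso].
pose proof (Rabs_pos_lt x Hx) as Hx0.
assert (Hc : 0 < c) by (specialize (H O); simpl in H; lra).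
destruct (pow_eventually_small (Rabs x / c)) as [k Hk]; [now apply Rdiv_lt_0_compat|].
specialize (H k).
assert (Rabs x / c * c = Rabs x) by (field; lra). nra.
Qed.

Lemma continuousP (f : R -> R) (s : R) :
  continuous f s <->
  forall eps, 0 < eps -> exists d, 0 < d /\ forall t, Rabs (t - s) < d -> Rabs (f t - f s) < eps.
Proof.
split.
- intros Hf eps He.
  destruct (proj1 (filterlim_locally f (f s)) Hf (mkposreal _ He)) as [d Hd].
  exists d; split; [apply cond_pos|]. exact Hd.
- intros H. apply filterlim_locally. intros eps.
  destruct (H eps (cond_pos eps)) as [d [Hd Hd']].
  exists (mkposreal _ Hd). exact Hd'.
Qed.

Lemma weighted_uniform_limit (u : nat -> R -> R) (om : R -> R) (c : R) :
  (forall k s, continuous (u k) s) -> (forall s, continuous om s) -> (forall s, 0 < om s) ->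
  (forall k s, Rabs (u (S k) s - u k s) <= c * (3 / 4) ^ k * om s) ->
  exists l : R -> R, (forall k s, Rabs (u k s - l s) <= 4 * c * (3 / 4) ^ k * om s) /\
    forall s, continuous l s.
Proof.
intros Hu Hom Hom0 Hc.
assert (Hl : forall s, exists l, forall k, Rabs (u k s - l) <= 4 * (c * om s) * (3 / 4) ^ k).
{ intros s. apply (geometric_cauchy_limit (fun k => u k s)). intros k.
  specialize (Hc k s). simpl. lra. }
set (l := fun s => proj1_sig (constructive_indefinite_description _ (Hl s))).
assert (Hl' : forall k s, Rabs (u k s - l s) <= 4 * c * (3 / 4) ^ k * om s).
{ intros k s. unfold l. destruct (constructive_indefinite_description _ (Hl s)) as [x Hx]. simpl.
  specialize (Hx k). lra. }
exists l; split; [exact Hl'|].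
intros s. apply continuousP. intros eps He.
assert (Hc0 : 0 <= c).
{ specialize (Hc O s). pose proof (Rabs_pos (u 1%nat s - u O s)). specialize (Hom0 s). simpl in Hc. nra. }
specialize (Hom0 s) as Hs.
(* [om s + 1] bounds the weight near [s], so one index [k] serves a whole neighbourhood. *)
destruct (pow_eventually_small (eps / (3 * (4 * c + 1) * (om s + 1)))) as [k Hk].
{ apply Rdiv_lt_0_compat; [assumption|]. repeat apply Rmult_lt_0_compat; lra. }
assert (Hsm : 4 * c * (3 / 4) ^ k * (om s + 1) <= eps / 3).
{ assert (0 <= (3 / 4) ^ k) by (apply pow_le; lra).
  assert (eps / (3 * (4 * c + 1) * (om s + 1)) * ((4 * c + 1) * (om s + 1)) = eps / 3) by (field; lra).
  assert (0 <= (4 * c + 1) * (om s + 1)) by nra.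
  assert ((3 / 4) ^ k * ((4 * c + 1) * (om s + 1)) <= eps / 3).
  { rewrite <- H0. apply Rmult_le_compat_r; lra. }
  assert (0 <= (3 / 4) ^ k * (om s + 1)) by nra.
  lra. }
destruct (proj1 (continuousP (u k) s) (Hu k s) (eps / 3)) as [d1 [Hd1 H1]]; [lra|].
destruct (proj1 (continuousP om s) (Hom s) 1) as [d2 [Hd2 H2]]; [lra|].
exists (Rmin d1 d2); split; [now apply Rmin_glb_lt|].
intros t Ht. pose proof (Rmin_l d1 d2). pose proof (Rmin_r d1 d2).
specialize (H1 t ltac:(lra)). specialize (H2 t ltac:(lra)). apply Rabs_def2 in H2.
assert (0 <= 4 * c * (3 / 4) ^ k) by (apply Rmult_le_pos; [lra|apply pow_le; lra]).
assert (Rabs (u k t - l t) <= eps / 3).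
{ eapply Rle_trans; [apply Hl'|]. eapply Rle_trans; [|exact Hsm]. apply Rmult_le_compat_l; lra. }
assert (Rabs (u k s - l s) <= eps / 3).
{ eapply Rle_trans; [apply Hl'|]. eapply Rle_trans; [|exact Hsm]. apply Rmult_le_compat_l; lra. }
replace (l t - l s) with (- (u k t - l t) + (u k t - u k s) + (u k s - l s)) by ring.
pose proof (Rabs_triang (- (u k t - l t) + (u k t - u k s)) (u k s - l s)).
pose proof (Rabs_triang (- (u k t - l t)) (u k t - u k s)). rewrite Rabs_Ropp in *. lra.
Qed.

(** * The logistic function and the exponential weight *)

Lemma exp_monotone (x y : R) : x <= y -> exp x <= exp y.
Proof. intros [H| ->]; [left; now apply exp_increasing|right; reflexivity]. Qed.

(** Logistic function: comparable to [exp (2 s)] at minus infinity yet bounded by [1], so it can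
    measure the distance from [M0] along the whole line. *)
Definition theta (s : R) : R := exp (2 * s) / (1 + exp (2 * s)).

Definition weight (G s : R) : R := exp (3 * s + G * ln (1 + exp (2 * s))).

Lemma theta_range (s : R) : 0 < theta s < 1.
Proof.
pose proof (exp_pos (2 * s)). unfold theta. split.
- apply Rdiv_lt_0_compat; lra.
- apply Rmult_lt_reg_r with (1 + exp (2 * s)); [lra|].
  unfold Rdiv; rewrite Rmult_assoc, Rinv_l; lra.
Qed.

Lemma theta_derive (s : R) : is_derive theta s (2 * theta s * (1 - theta s)).
Proof.
pose proof (exp_pos (2 * s)). unfold theta. auto_derive; [lra|]. field. lra.
Qed.

Lemma weight_pos (G s : R) : 0 < weight G s.
Proof. apply exp_pos. Qed.

Lemma weight_derive (G s : R) : is_derive (weight G) s ((3 + 2 * G * theta s) * weight G s).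
Proof.
pose proof (exp_pos (2 * s)). unfold weight, theta. auto_derive; [lra|].
unfold Rdiv; ring.
Qed.

Lemma weight_ge (G s : R) : 0 <= G -> exp (3 * s) <= weight G s.
Proof.
intros HG. unfold weight. pose proof (exp_pos (2 * s)).
assert (0 <= ln (1 + exp (2 * s))).
{ rewrite <- ln_1. apply ln_le; lra. }
apply exp_monotone. nra.
Qed.

Lemma weight_le_negative (G s : R) : 0 <= G -> s <= 0 -> weight G s <= exp (G * ln 2) * exp (3 * s).
Proof.
intros HG Hs. unfold weight. rewrite <- exp_plus. apply exp_monotone.
assert (exp (2 * s) <= 1) by (rewrite <- exp_0; apply exp_monotone; lra).
pose proof (exp_pos (2 * s)).
assert (ln (1 + exp (2 * s)) <= ln 2) by (apply ln_le; lra).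
nra.
Qed.

Lemma weight_vanishes (G c : R) : 0 <= G -> 0 <= c -> vanishes_minf (fun s => c * weight G s).
Proof.
intros HG Hc eps He.
destruct (exp_vanishes (c * exp (G * ln 2)) 3 ltac:(lra)) with (eps := eps) as [T HT]; trivial.
{ apply Rmult_le_pos; [assumption|left; apply exp_pos]. }
exists (Rmin T 0). intros s Hs. pose proof (Rmin_l T 0). pose proof (Rmin_r T 0).
specialize (HT s ltac:(lra)).
pose proof (weight_le_negative G s HG ltac:(lra)). pose proof (weight_pos G s).
rewrite Rabs_pos_eq in * by (repeat apply Rmult_le_pos; try lra; left; apply exp_pos).
nra.
Qed.

(** With [t = exp (2 s)] the clamped value is at most [c * t] and at most [M]; the first bound plus
    [t] times the second gives the claim after division by [1 + t]. *)
Lemma clamp_exp_theta (M c x s : R) :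
  0 <= M -> 0 <= c -> x <= c * exp (2 * s) -> 0 <= clamp M x <= (M + c) * theta s.
Proof.
intros HM Hc Hx. split; [apply clamp_range; assumption|].
unfold theta. pose proof (exp_pos (2 * s)). set (t := exp (2 * s)) in *.
assert (clamp M x <= M) by (apply clamp_range; assumption).
assert (clamp M x <= c * t) by (apply clamp_le; [nra|assumption]).
apply Rmult_le_reg_r with (1 + t); [lra|].
replace ((M + c) * (t / (1 + t)) * (1 + t)) with ((M + c) * t) by (field; lra).
nra.
Qed.

(* Powers of [exp s] beyond 3 only matter for [s <= 0], lower ones only for [s >= 0]. *)
Lemma clamp_exp_defect (M c s : R) :
  0 < M -> 0 <= c ->
  Rabs (clamp M (c * exp (2 * s)) - c * exp (2 * s)) <= (c + c * c / M) * exp (3 * s).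
Proof.
intros HM Hc.
replace (exp (2 * s)) with (exp s ^ 2) by (simpl; rewrite Rmult_1_r, <- exp_plus; f_equal; ring).
replace (exp (3 * s)) with (exp s ^ 3) by (simpl; rewrite Rmult_1_r, <- !exp_plus; f_equal; ring).
pose proof (exp_pos s) as Hu. set (u := exp s) in *.
assert (Hx : 0 <= c * u ^ 2) by nra.
assert (0 < / M) by now apply Rinv_0_lt_compat.
assert (Hcc : 0 <= c * c / M) by (unfold Rdiv; nra).
pose proof (pow_lt u 3 Hu) as Hu3. pose proof (pow_lt u 2 Hu) as Hu2.
assert (E3 : u ^ 3 = u * u ^ 2) by ring. assert (E4 : u ^ 4 = u * u ^ 3) by ring.
destruct (Rle_dec (c * u ^ 2) M) as [H1|H1].
- rewrite clamp_id by lra. rewrite Rminus_diag, Rabs_R0. apply Rmult_le_pos; lra.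
- rewrite clamp_above by lra. rewrite Rabs_left by lra.
  destruct (Rle_dec 1 u) as [H2|H2].
  + assert (u ^ 2 <= u ^ 3) by nra.
    assert (c * u ^ 2 <= c * u ^ 3) by (apply Rmult_le_compat_l; assumption). nra.
  + assert (H3 : c * u ^ 2 <= c * c / M * u ^ 4).
    { apply Rmult_le_reg_l with M; [assumption|].
      replace (M * (c * c / M * u ^ 4)) with ((c * u ^ 2) * (c * u ^ 2)) by (field; lra). nra. }
    assert (H4 : u ^ 4 <= u ^ 3) by nra.
    assert (c * c / M * u ^ 4 <= c * c / M * u ^ 3) by (apply Rmult_le_compat_l; assumption).
    nra.
Qed.

Lemma theta_sqr_le (s : R) : theta s * theta s <= exp (3 * s).
Proof.
pose proof (theta_range s).
assert (Ht : theta s <= exp (2 * s)).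
{ unfold theta. pose proof (exp_pos (2 * s)). apply Rmult_le_reg_r with (1 + exp (2 * s)); [lra|].
  unfold Rdiv; rewrite Rmult_assoc, Rinv_l; nra. }
destruct (Rle_dec 0 s) as [Hs|Hs].
- assert (1 <= exp (3 * s)) by (rewrite <- exp_0; apply exp_monotone; lra). nra.
- apply Rle_trans with (exp (2 * s) * exp (2 * s)).
  + apply Rmult_le_compat; lra.
  + rewrite <- exp_plus. apply exp_monotone. lra.
Qed.

(** * The clamped problem *)

Ltac solve_continuous :=
  match goal with
  | |- continuous (fun s => @?f s + @?g s) _ => apply (continuous_plus f g); solve_continuous
  | |- continuous (fun s => @?f s - @?g s) _ => apply (continuous_minus f g); solve_continuous
  | |- continuous (fun s => @?f s * @?g s) _ => apply (continuous_mult f g); solve_continuous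
  | |- continuous (fun s => @?f s / ?c) _ => apply (continuous_mult f (fun _ => / c)); solve_continuous
  | |- continuous (fun _ => ?c) _ => apply continuous_const
  | _ => auto
  end.

Section Picard.

Variables lam mu a b n A B P Q kap : R.
Hypotheses (Hlam : 0 < lam) (Hmu : 0 < mu <= 1) (Ha : 0 < a <= A) (Hb : 0 <= b <= B).
Hypotheses (Hn : 0 < n) (HP : 0 < P) (HQ : 0 < Q) (Hkap : 0 < kap).
Hypothesis HK : kap <= mu * a / lam - Q.

(** Largest forcing divided by smallest repulsion rate, as in [bounded_solution_exists], using
    [mu <= 1]. *)
Definition w_max : R := (/ lam + lam * P) / kap.
(** The norm is the larger of [|p|] and [|q| / q_scale]. This value gives
    [q_scale + A * B <= 2 * q_scale], so [q] contracts by the same factor as [p]. *)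
Definition q_scale : R := A * B + 1.
Definition p_slope : R := P + 1.
Definition q_slope : R := Q + A * B.
Definition w_slope : R := 2 * (w_max * q_slope + lam * p_slope) / kap.
Definition w_lip : R := 2 * (w_max * q_scale + lam) / kap.
Definition g_slope : R := A * A * w_slope / lam + q_slope + lam * A * p_slope.
(** Sum of the coefficients of [th] in the two Lipschitz estimates when [x], [y], [z] are in the
    ratio [1 : q_scale : w_lip]. Only [lam] and the bounds [A], [B], [P], [Q], [kap] occur, so
    [Hnsmall] can be met by shrinking [n]. *)
Definition weight_exponent : R :=
  (g_slope + p_slope * (A * A * w_lip / lam + q_scale + lam * (A + P * (A * A * w_lip))))
  + (2 * q_slope * q_scale + lam * A * p_slope * q_scale
     + lam * q_slope * (A + P * (A * A * w_lip)) + B * p_slope * (A * A * w_lip)).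

Hypothesis Hnsmall : n * (3 + 2 * weight_exponent) <= kap / 2.

(** The range selects, among all solutions of the linear equation, the one that does not escape
    along the repelling direction. *)
Definition slaved (p q w : R -> R) : Prop :=
  (forall s, is_derive w s
     (((mu * a / lam - clamp Q (q s)) * w s - (mu / lam + lam * clamp P (p s))) / n)) /\
  forall s, / a <= w s <= w_max.

(** Upper bounds suffice: [clamp] removes negative values, and positivity is recovered later for the
    fixed point alone. *)
Definition admissible (p q : R -> R) : Prop :=
  (forall s, continuous p s) /\ (forall s, continuous q s) /\
  (forall s, p s <= exp (2 * s)) /\ (forall s, q s <= a * b * exp (2 * s)).

Definition driven (p q w p1 q1 : R -> R) : Prop :=
  (forall s, is_derive p1 s
     (clamp P (p s) * growth_p lam a (clamp P (p s)) (clamp Q (q s)) (w s))) /\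
  (forall s, is_derive q1 s (rate_q lam b (clamp P (p s)) (clamp Q (q s)) (w s))).

(** A relation, since the new pair comes from existence statements; vanishing at minus infinity
    fixes the constants of integration. *)
Definition picard_step (p q p1 q1 : R -> R) : Prop :=
  (exists w, slaved p q w /\ driven p q w p1 q1) /\ vanishes_minf p1 /\ vanishes_minf q1.

Lemma constants_pos :
  0 < w_max /\ 0 < q_scale /\ 0 < p_slope /\ 0 < q_slope /\ 0 < w_slope /\ 0 < w_lip /\
  0 < g_slope /\ 0 < weight_exponent.
Proof.
assert (0 < / lam) by now apply Rinv_0_lt_compat.
assert (0 <= A * B) by (apply Rmult_le_pos; lra).
assert (0 < A * A) by nra.
assert (G2 : 0 < w_max) by (apply Rdiv_lt_0_compat; [nra|assumption]).
assert (G3 : 0 < q_scale) by (unfold q_scale; lra).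
assert (G4 : 0 < p_slope) by (unfold p_slope; lra).
assert (G5 : 0 < q_slope) by (unfold q_slope; lra).
assert (G6 : 0 < w_slope) by (unfold w_slope; apply Rdiv_lt_0_compat; [nra|assumption]).
assert (G7 : 0 < w_lip) by (unfold w_lip; apply Rdiv_lt_0_compat; [nra|assumption]).
assert (0 < A * A * w_slope) by (apply Rmult_lt_0_compat; lra).
assert (0 < A * A * w_slope / lam) by now apply Rdiv_lt_0_compat.
assert (0 < lam * A) by (apply Rmult_lt_0_compat; lra).
assert (0 < lam * A * p_slope) by (apply Rmult_lt_0_compat; lra).
assert (G8 : 0 < g_slope) by (unfold g_slope; lra).
assert (0 < A * A * w_lip) by (apply Rmult_lt_0_compat; lra).
assert (0 < A * A * w_lip / lam) by now apply Rdiv_lt_0_compat.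
assert (0 < A + P * (A * A * w_lip)) by (assert (0 < P * (A * A * w_lip)) by (apply Rmult_lt_0_compat; lra); lra).
assert (0 < lam * (A + P * (A * A * w_lip))) by (apply Rmult_lt_0_compat; lra).
repeat split; trivial.
unfold weight_exponent.
assert (0 < p_slope * (A * A * w_lip / lam + q_scale + lam * (A + P * (A * A * w_lip))))
  by (apply Rmult_lt_0_compat; lra).
assert (0 < 2 * q_slope * q_scale) by (apply Rmult_lt_0_compat; lra).
assert (0 < lam * A * p_slope * q_scale) by (apply Rmult_lt_0_compat; lra).
assert (0 < lam * q_slope) by (apply Rmult_lt_0_compat; lra).
assert (0 < lam * q_slope * (A + P * (A * A * w_lip))) by (apply Rmult_lt_0_compat; lra).
assert (0 <= B * p_slope) by (apply Rmult_le_pos; lra).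
assert (0 <= B * p_slope * (A * A * w_lip)) by (apply Rmult_le_pos; lra).
lra.
Qed.

Lemma slaved_exists (p q : R -> R) :
  (forall s, continuous p s) -> (forall s, continuous q s) -> exists w, slaved p q w.
Proof.
intros Hp Hq.
assert (Hi : 0 < / lam) by now apply Rinv_0_lt_compat.
destruct (bounded_solution_exists (fun s => mu * a / lam - clamp Q (q s))
  (fun s => mu / lam + lam * clamp P (p s)) n kap (mu * a / lam) (mu / lam) (/ lam + lam * P))
  as [w [Hw1 Hw2]]; trivial.
- apply Rmult_le_pos; lra.
- intros s. apply (continuous_minus (fun _ => mu * a / lam) (fun s => clamp Q (q s))).
  + apply continuous_const.
  + apply clamp_continuous; [lra|apply Hq].
- intros s. apply (continuous_plus (fun _ => mu / lam) (fun s => lam * clamp P (p s))).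
  + apply continuous_const.
  + apply (continuous_mult (fun _ => lam) (fun s => clamp P (p s))); [apply continuous_const|].
    apply clamp_continuous; [lra|apply Hp].
- intros s. pose proof (clamp_range Q (q s) ltac:(lra)). lra.
- intros s. pose proof (clamp_range P (p s) ltac:(lra)).
  split; [assert (0 <= lam * clamp P (p s)) by (apply Rmult_le_pos; lra); lra|].
  apply Rplus_le_compat; [unfold Rdiv; nra|apply Rmult_le_compat_l; lra].
- exists w; split; [exact Hw1|]. intros s. specialize (Hw2 s).
  replace (mu / lam / (mu * a / lam)) with (/ a) in Hw2 by (field; lra). exact Hw2.
Qed.

Lemma w_max_ge (p q w : R -> R) : slaved p q w -> / a <= w_max.
Proof. intros [_ H]. specialize (H 0). lra. Qed.

(** Since [K / a = mu / lam], the constant [/ a] is the rest value for [p = q = 0]. Hence [w - / a]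
    solves the same repelling equation with forcing [q / a + lam p] (clamped), which is of order
    [theta]. *)
Lemma slaved_near (p q w : R -> R) :
  admissible p q -> slaved p q w -> forall s, Rabs (w s - / a) <= w_slope * theta s.
Proof.
intros [_ [_ [Hp Hq]]] Hsl s0.
pose proof (w_max_ge _ _ _ Hsl) as Hwm. destruct Hsl as [Hw1 Hw2].
destruct constants_pos as [H1 [H2 [H3 [H4 [H5 [H6 [H7 H8]]]]]]].
assert (Hia : 0 < / a) by (apply Rinv_0_lt_compat; lra).
unfold w_slope.
apply (bounded_solution_le (fun s => w s - / a) (fun s => mu * a / lam - clamp Q (q s))
  (fun s => / a * clamp Q (q s) + lam * clamp P (p s)) theta
  (fun s => 2 * theta s * (1 - theta s)) n kap 2 _ w_max); trivial.
- nra.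
- intros s _. evar_last.
  + apply (is_derive_minus w (fun _ => / a)); [apply Hw1|apply @is_derive_const].
  + unfold minus, plus, opp, zero; simpl. field. lra.
- intros; apply theta_derive.
- intros s _. pose proof (theta_range s). split; [lra|nra].
- intros s _. pose proof (clamp_range Q (q s) ltac:(lra)). lra.
- intros s _. pose proof (theta_range s).
  assert (0 <= a * b <= A * B) by (split; [apply Rmult_le_pos; lra|apply Rmult_le_compat; lra]).
  pose proof (clamp_exp_theta Q (a * b) (q s) s ltac:(lra) ltac:(lra) (Hq s)).
  pose proof (clamp_exp_theta P 1 (p s) s ltac:(lra) ltac:(lra) ltac:(rewrite Rmult_1_l; apply Hp)).
  rewrite Rabs_pos_eq by (apply Rplus_le_le_0_compat; apply Rmult_le_pos; lra).
  apply Rle_trans with (w_max * (q_slope * theta s) + lam * (p_slope * theta s)); [|right; ring].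
  unfold q_slope, p_slope. apply Rplus_le_compat.
  + apply Rmult_le_compat; try lra. nra.
  + apply Rmult_le_compat_l; lra.
- intros s _. specialize (Hw2 s). apply Rabs_le; lra.
Qed.

(** The difference is repelled at rate [K - q1] and forced by [w2 * (q1 - q2) + lam * (p1 - p2)],
    clamped. [Hnsmall] says that the weight grows at most half as fast as the repulsion, so it may
    serve as comparison function. *)
Lemma slaved_lipschitz (p1 q1 w1 p2 q2 w2 : R -> R) (N : R) :
  slaved p1 q1 w1 -> slaved p2 q2 w2 ->
  (forall s, Rabs (p1 s - p2 s) <= N * weight weight_exponent s) ->
  (forall s, Rabs (q1 s - q2 s) <= q_scale * N * weight weight_exponent s) ->
  forall s, Rabs (w1 s - w2 s) <= w_lip * N * weight weight_exponent s.
Proof.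
intros [Hw1 Hb1] [Hw2 Hb2] Hp Hq s0.
destruct constants_pos as [H1 [H2 [H3 [H4 [H5 [H6 [H7 H8]]]]]]].
replace (w_lip * N) with (2 * ((w_max * q_scale + lam) * N) / kap) by (unfold w_lip; field; lra).
assert (Hia : 0 < / a) by (apply Rinv_0_lt_compat; lra).
apply (bounded_solution_le (fun s => w1 s - w2 s) (fun s => mu * a / lam - clamp Q (q1 s))
  (fun s => w2 s * (clamp Q (q1 s) - clamp Q (q2 s)) + lam * (clamp P (p1 s) - clamp P (p2 s)))
  (weight weight_exponent) (fun s => (3 + 2 * weight_exponent * theta s) * weight weight_exponent s)
  n kap (3 + 2 * weight_exponent) _ w_max); trivial.
- intros s _. evar_last.
  + apply (is_derive_minus w1 w2); [apply Hw1|apply Hw2].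
  + unfold minus, plus, opp; simpl. field. lra.
- intros; apply weight_derive.
- intros s _. pose proof (weight_pos weight_exponent s). pose proof (theta_range s).
  split; [assumption|]. apply Rmult_le_compat_r; [lra|]. nra.
- intros s _. pose proof (clamp_range Q (q1 s) ltac:(lra)). lra.
- intros s _. specialize (Hp s). specialize (Hq s).
  pose proof (clamp_lipschitz Q (q1 s) (q2 s) ltac:(lra)).
  pose proof (clamp_lipschitz P (p1 s) (p2 s) ltac:(lra)).
  apply Rle_trans with (w_max * (q_scale * N * weight weight_exponent s)
    + lam * (N * weight weight_exponent s)); [|right; ring].
  specialize (Hb2 s).
  apply Rabs_plus_le; apply Rabs_mult_le; try lra; rewrite Rabs_pos_eq; lra.
- intros s _. specialize (Hb1 s). specialize (Hb2 s). apply Rabs_le; lra.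
Qed.

(** The difference of the right-hand sides is integrated from minus infinity. In units of the weight
    it is at most [2 + G * theta] (for [q] after division by [q_scale]), while the weight grows at
    rate [3 + 2 * G * theta]; three quarters of the latter exceed the former, which is the
    contraction factor. *)
Lemma picard_contracts (p1 q1 p1' q1' p2 q2 p2' q2' : R -> R) (N : R) :
  admissible p1 q1 -> admissible p2 q2 ->
  picard_step p1 q1 p1' q1' -> picard_step p2 q2 p2' q2' ->
  (forall s, Rabs (p1 s - p2 s) <= N * weight weight_exponent s) ->
  (forall s, Rabs (q1 s - q2 s) <= q_scale * N * weight weight_exponent s) ->
  (forall s, Rabs (p1' s - p2' s) <= 3 / 4 * N * weight weight_exponent s) /\
  (forall s, Rabs (q1' s - q2' s) <= q_scale * (3 / 4 * N) * weight weight_exponent s).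
Proof.
intros Had1 Had2 [[w1 [Hs1 [Hd1 Hd1']]] [Hv1 Hv1']] [[w2 [Hs2 [Hd2 Hd2']]] [Hv2 Hv2']] Hp Hq.
destruct constants_pos as [H1 [H2 [H3 [H4 [H5 [H6 [H7 H8]]]]]]].
pose proof (slaved_lipschitz _ _ _ _ _ _ N Hs1 Hs2 Hp Hq) as Hw.
pose proof (slaved_near _ _ _ Had1 Hs1) as Hn1.
destruct Had1 as [_ [_ [Hp1 Hq1]]]. destruct Had2 as [_ [_ [Hp2 Hq2]]].
destruct Hs1 as [_ Hb1]. destruct Hs2 as [_ Hb2].
assert (HN : 0 <= N).
{ specialize (Hp 0). pose proof (Rabs_pos (p1 0 - p2 0)). pose proof (weight_pos weight_exponent 0). nra. }
assert (HAB : 0 <= A * B) by (apply Rmult_le_pos; lra).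
assert (Hab : 0 <= a * b <= A * B) by (split; [apply Rmult_le_pos; lra|apply Rmult_le_compat; lra]).
assert (Hcl : forall s, (0 <= clamp P (p1 s) <= p_slope * theta s) /\ (0 <= clamp P (p2 s) <= p_slope * theta s) /\
  clamp P (p2 s) <= P /\ (0 <= clamp Q (q1 s) <= q_slope * theta s) /\ (0 <= clamp Q (q2 s) <= q_slope * theta s)).
{ intros s. pose proof (theta_range s). unfold p_slope, q_slope.
  pose proof (clamp_exp_theta Q (a * b) (q1 s) s ltac:(lra) ltac:(lra) (Hq1 s)).
  pose proof (clamp_exp_theta Q (a * b) (q2 s) s ltac:(lra) ltac:(lra) (Hq2 s)).
  assert ((Q + a * b) * theta s <= (Q + A * B) * theta s) by (apply Rmult_le_compat_r; lra).
  repeat split; try (apply clamp_range; lra); try lra;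
  (apply clamp_exp_theta; [lra|lra|rewrite Rmult_1_l; trivial]). }
assert (Hdp : forall s, Rabs (clamp P (p1 s) - clamp P (p2 s)) <= N * weight weight_exponent s).
{ intros s. eapply Rle_trans; [apply clamp_lipschitz; lra|apply Hp]. }
assert (Hdq : forall s, Rabs (clamp Q (q1 s) - clamp Q (q2 s)) <= q_scale * N * weight weight_exponent s).
{ intros s. eapply Rle_trans; [apply clamp_lipschitz; lra|apply Hq]. }
assert (Hder : forall c s, is_derive (fun s => c * weight weight_exponent s) s
   (c * ((3 + 2 * weight_exponent * theta s) * weight weight_exponent s))).
{ intros c s. apply (is_derive_scal (weight weight_exponent)), weight_derive. }
assert (Hdiff : forall f g, vanishes_minf f -> vanishes_minf g -> vanishes_minf (fun s => f s - g s)).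
{ intros f g Hf Hg. apply vanishes_le with (g := fun s => Rabs (f s) + Rabs (g s)).
  - intros s. apply Rabs_minus_le; apply Rle_refl.
  - apply vanishes_plus; [intros e He; destruct (Hf e He) as [T HT]|intros e He; destruct (Hg e He) as [T HT]];
    exists T; intros s Hs; rewrite Rabs_Rabsolu; auto. }
set (X1 := p_slope * (A * A * w_lip / lam + q_scale + lam * (A + P * (A * A * w_lip)))).
set (X2 := 2 * q_slope * q_scale + lam * A * p_slope * q_scale
     + lam * q_slope * (A + P * (A * A * w_lip)) + B * p_slope * (A * A * w_lip)).
assert (Hal : 0 < A * A * w_lip) by (apply Rmult_lt_0_compat; [nra|assumption]).
assert (0 < A * A * w_lip / lam) by now apply Rdiv_lt_0_compat.
assert (0 <= P * (A * A * w_lip)) by (apply Rmult_le_pos; lra).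
assert (HX1 : 0 <= X1).
{ unfold X1. apply Rmult_le_pos; [lra|]. assert (0 <= lam * (A + P * (A * A * w_lip))) by (apply Rmult_le_pos; lra). lra. }
assert (HX2 : 0 <= X2).
{ unfold X2. generalize dependent w_lip; intros wl; intros.
  repeat apply Rplus_le_le_0_compat; repeat apply Rmult_le_pos; lra. }
assert (Hexp : weight_exponent = g_slope + X1 + X2) by (unfold weight_exponent, X1, X2; ring).
split.
- apply (abs_le_of_derive_abs_le (fun s => p1' s - p2' s)
    (fun s => clamp P (p1 s) * growth_p lam a (clamp P (p1 s)) (clamp Q (q1 s)) (w1 s)
       - clamp P (p2 s) * growth_p lam a (clamp P (p2 s)) (clamp Q (q2 s)) (w2 s))
    (fun s => 3 / 4 * N * weight weight_exponent s)
    (fun s => 3 / 4 * N * ((3 + 2 * weight_exponent * theta s) * weight weight_exponent s))).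
  + intros s. apply (is_derive_minus p1' p2'); [apply Hd1|apply Hd2].
  + apply Hder.
  + intros s. destruct (Hcl s) as [C1 [C2 [C3 [C4 C5]]]].
    pose proof (theta_range s). pose proof (weight_pos weight_exponent s).
    specialize (Hdp s); specialize (Hdq s); specialize (Hw s).
    specialize (Hn1 s); specialize (Hb1 s); specialize (Hb2 s).
    set (om := weight weight_exponent s) in *.
    eapply Rle_trans; [apply (rate_p_lipschitz lam a A P p_slope q_slope w_slope Hlam Ha)
      with (th := theta s) (x := N * om) (y := q_scale * N * om) (z := w_lip * N * om); trivial; try lra|].
    * fold g_slope.
      replace (2 * (N * om) + (g_slope * (N * om) + p_slope * (A * A * (w_lip * N * om) / lam + q_scale * N * om
         + lam * (A * (N * om) + P * (A * A * (w_lip * N * om))))) * theta s)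
      with ((2 + (g_slope + X1) * theta s) * (N * om)) by (unfold X1; field; lra).
      replace (3 / 4 * N * ((3 + 2 * weight_exponent * theta s) * om))
      with ((9 / 4 + 3 / 2 * (weight_exponent * theta s)) * (N * om)) by field.
      apply Rmult_le_compat_r; [nra|].
      assert ((g_slope + X1) * theta s <= weight_exponent * theta s) by (apply Rmult_le_compat_r; lra).
      assert (0 <= weight_exponent * theta s) by (apply Rmult_le_pos; lra). lra.
  + apply Hdiff; assumption.
  + apply weight_vanishes; lra.
- apply (abs_le_of_derive_abs_le (fun s => q1' s - q2' s)
    (fun s => rate_q lam b (clamp P (p1 s)) (clamp Q (q1 s)) (w1 s)
       - rate_q lam b (clamp P (p2 s)) (clamp Q (q2 s)) (w2 s))
    (fun s => q_scale * (3 / 4 * N) * weight weight_exponent s)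
    (fun s => q_scale * (3 / 4 * N) * ((3 + 2 * weight_exponent * theta s) * weight weight_exponent s))).
  + intros s. apply (is_derive_minus q1' q2'); [apply Hd1'|apply Hd2'].
  + apply Hder.
  + intros s. destruct (Hcl s) as [C1 [C2 [C3 [C4 C5]]]].
    pose proof (theta_range s). pose proof (weight_pos weight_exponent s).
    specialize (Hdp s); specialize (Hdq s); specialize (Hw s).
    specialize (Hn1 s); specialize (Hb1 s); specialize (Hb2 s).
    set (om := weight weight_exponent s) in *.
    eapply Rle_trans; [apply (rate_q_lipschitz lam a b A B P p_slope q_slope Hlam Ha Hb)
      with (th := theta s) (x := N * om) (y := q_scale * N * om) (z := w_lip * N * om); trivial; try lra|].
    * replace (q_scale * N * om + A * B * (N * om) + (2 * q_slope * (q_scale * N * om)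
         + lam * A * p_slope * (q_scale * N * om)
         + lam * q_slope * (A * (N * om) + P * (A * A * (w_lip * N * om)))
         + B * p_slope * (A * A * (w_lip * N * om))) * theta s)
      with ((q_scale + A * B + X2 * theta s) * (N * om)) by (unfold X2; ring).
      replace (q_scale * (3 / 4 * N) * ((3 + 2 * weight_exponent * theta s) * om))
      with ((9 / 4 * q_scale + 3 / 2 * (q_scale * (weight_exponent * theta s))) * (N * om)) by field.
      apply Rmult_le_compat_r; [nra|].
      assert (X2 * theta s <= weight_exponent * theta s) by (apply Rmult_le_compat_r; lra).
      assert (0 <= weight_exponent * theta s) by (apply Rmult_le_pos; lra).
      assert (1 <= q_scale) by (unfold q_scale; lra).
      assert (A * B <= q_scale) by (unfold q_scale; lra).
      assert (weight_exponent * theta s <= q_scale * (weight_exponent * theta s)) by nra.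
      lra.
  + apply Hdiff; assumption.
  + apply weight_vanishes; [lra|]. apply Rmult_le_pos; lra.
Qed.

(** The upper bounds reproduce themselves: [p1' <= 2 exp (2 s)], and
    [q1' <= q + a b p <= 2 a b exp (2 s)] with clamped arguments, so integration from minus infinity
    returns the same exponentials. *)
Lemma picard_step_exists (p q : R -> R) :
  admissible p q -> exists p1 q1, picard_step p q p1 q1 /\ admissible p1 q1.
Proof.
intros Had.
assert (Hcp : forall s, continuous p s) by apply Had.
assert (Hcq : forall s, continuous q s) by apply Had.
destruct (slaved_exists p q) as [w Hs]; trivial.
pose proof (slaved_near _ _ _ Had Hs) as Hn1.
destruct constants_pos as [H1 [H2 [H3 [H4 [H5 [H6 [H7 H8]]]]]]].
destruct Had as [_ [_ [Hp Hq]]]. pose proof Hs as [Hw Hwb].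
assert (Hia : 0 < / a) by (apply Rinv_0_lt_compat; lra).
assert (HAB : 0 <= A * B) by (apply Rmult_le_pos; lra).
assert (Hab : 0 <= a * b <= A * B) by (split; [apply Rmult_le_pos; lra|apply Rmult_le_compat; lra]).
assert (Hcl : forall s, (0 <= clamp P (p s) <= p_slope * theta s) /\
  (0 <= clamp Q (q s) <= q_slope * theta s)).
{ intros s. pose proof (theta_range s). unfold p_slope, q_slope.
  pose proof (clamp_exp_theta Q (a * b) (q s) s ltac:(lra) ltac:(lra) (Hq s)).
  assert ((Q + a * b) * theta s <= (Q + A * B) * theta s) by (apply Rmult_le_compat_r; lra).
  split; [apply clamp_exp_theta; [lra|lra|rewrite Rmult_1_l; trivial]|lra]. }
assert (Hpe : forall s, 0 <= clamp P (p s) <= exp (2 * s)).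
{ intros s. split; [apply clamp_range; lra|]. apply clamp_le; [left; apply exp_pos|apply Hp]. }
assert (Hqe : forall s, 0 <= clamp Q (q s) <= a * b * exp (2 * s)).
{ intros s. split; [apply clamp_range; lra|].
  apply clamp_le; [apply Rmult_le_pos; [lra|left; apply exp_pos]|apply Hq]. }
assert (Hcr : forall s, continuous (fun s => / w s) s).
{ intros s. apply (continuous_Rinv_comp w); [eapply is_derive_continuous, Hw|].
  specialize (Hwb s). lra. }
assert (Hcp' : forall s, continuous (fun s => clamp P (p s)) s)
  by (intros s; apply clamp_continuous; [lra|auto]).
assert (Hcq' : forall s, continuous (fun s => clamp Q (q s)) s)
  by (intros s; apply clamp_continuous; [lra|auto]).
assert (He : forall c s, is_derive (fun s => c / 2 * exp (2 * s)) s (c * exp (2 * s))).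
{ intros c s. auto_derive; [trivial|field]. }
assert (Ht2 : forall s, theta s * theta s <= exp (2 * s)).
{ intros s. pose proof (theta_range s). pose proof (exp_pos (2 * s)).
  assert (theta s <= exp (2 * s)); [|nra].
  unfold theta. apply Rmult_le_reg_r with (1 + exp (2 * s)); [lra|].
  unfold Rdiv; rewrite Rmult_assoc, Rinv_l; nra. }
destruct (antiderivative_dominated
  (fun s => clamp P (p s) * growth_p lam a (clamp P (p s)) (clamp Q (q s)) (w s))
  (fun s => (2 + g_slope) / 2 * exp (2 * s)) (fun s => (2 + g_slope) * exp (2 * s))) as [p1 [Hp1 Hp1b]].
{ intros s. unfold growth_p. solve_continuous. }
{ intros s; apply He. }
{ intros s. rewrite (Rmult_comm (2 + g_slope)). destruct (Hcl s). pose proof (theta_range s).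
  pose proof (growth_p_near lam a A p_slope q_slope w_slope Hlam Ha _ _ _ (theta s)
    (proj1 (Hcl s)) (proj2 (Hcl s)) (proj1 (Hwb s)) (Hn1 s)) as Hg. fold g_slope in Hg.
  apply Rabs_mult_le; [rewrite Rabs_pos_eq; apply Hpe|].
  replace (growth_p lam a (clamp P (p s)) (clamp Q (q s)) (w s))
    with (2 + (growth_p lam a (clamp P (p s)) (clamp Q (q s)) (w s) - 2)) by ring.
  apply Rabs_plus_le; [rewrite Rabs_pos_eq; lra|]. nra. }
{ intros s. apply Rmult_le_pos; [lra|left; apply exp_pos]. }
(* [2 * (a * b)] accounts for the linear part [q + a * b * p], the rest for the quadratic
   remainder. *)
set (c := 2 * (a * b) + (q_slope * (q_slope + lam * A * p_slope) + B * p_slope * (A * A * w_slope))).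
assert (0 < lam * A) by (apply Rmult_lt_0_compat; lra).
assert (0 < lam * A * p_slope) by (apply Rmult_lt_0_compat; lra).
assert (0 < A * A * w_slope) by (apply Rmult_lt_0_compat; [nra|lra]).
assert (0 <= B * p_slope) by (apply Rmult_le_pos; lra).
assert (Hc0 : 0 <= q_slope * (q_slope + lam * A * p_slope) + B * p_slope * (A * A * w_slope))
  by (apply Rplus_le_le_0_compat; apply Rmult_le_pos; lra).
destruct (antiderivative_dominated
  (fun s => rate_q lam b (clamp P (p s)) (clamp Q (q s)) (w s))
  (fun s => c / 2 * exp (2 * s)) (fun s => c * exp (2 * s))) as [q1 [Hq1 Hq1b]].
{ intros s. unfold rate_q. solve_continuous. }
{ intros s; apply He. }
{ intros s.
  pose proof (rate_q_near lam a b A B p_slope q_slope w_slope Hlam Ha Hb _ _ _ (theta s)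
    (proj1 (Hcl s)) (proj2 (Hcl s)) (proj1 (Hwb s)) (Hn1 s)) as Hr.
  replace (rate_q lam b (clamp P (p s)) (clamp Q (q s)) (w s)) with
    (clamp Q (q s) + a * b * clamp P (p s) + (rate_q lam b (clamp P (p s)) (clamp Q (q s)) (w s)
      - (clamp Q (q s) + a * b * clamp P (p s)))) by ring.
  unfold c. rewrite Rmult_plus_distr_r. apply Rabs_plus_le.
  - specialize (Hpe s). specialize (Hqe s).
    assert (0 <= a * b * clamp P (p s)) by (apply Rmult_le_pos; lra).
    assert (a * b * clamp P (p s) <= a * b * exp (2 * s)) by (apply Rmult_le_compat_l; lra).
    rewrite Rabs_pos_eq; lra.
  - eapply Rle_trans; [exact Hr|]. apply Rmult_le_compat_l; [lra|apply Ht2]. }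
{ intros s. apply Rmult_le_pos; [unfold c; lra|left; apply exp_pos]. }
assert (Hv : forall f C, 0 <= C -> (forall s, Rabs (f s) <= C * exp (2 * s)) -> vanishes_minf f).
{ intros f C HC Hf. apply (vanishes_le f _ Hf). apply exp_vanishes; lra. }
assert (Hv1 : vanishes_minf p1) by (apply (Hv _ ((2 + g_slope) / 2)); [lra|assumption]).
assert (Hv2 : vanishes_minf q1) by (apply (Hv _ (c / 2)); [unfold c; lra|assumption]).
exists p1, q1. split; [split; [exists w; split; [assumption|split; assumption]|split; assumption]|].
split; [intros s; eapply is_derive_continuous, Hp1|].
split; [intros s; eapply is_derive_continuous, Hq1|].
split.
- apply (le_of_derive_le p1 _ (fun s => exp (2 * s)) (fun s => 2 * exp (2 * s)) Hp1); trivial.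
  + intros s. auto_derive; [trivial|ring].
  + intros s.
    pose proof (growth_p_le lam a A Hlam Ha _ _ _ (proj1 (Hpe s)) (proj1 (Hqe s)) (proj1 (Hwb s))).
    specialize (Hpe s). pose proof (exp_pos (2 * s)). nra.
  + apply (Hv _ 1); [lra|]. intros s. rewrite Rabs_pos_eq by (left; apply exp_pos). lra.
- apply (le_of_derive_le q1 _ (fun s => a * b * exp (2 * s)) (fun s => 2 * (a * b) * exp (2 * s)) Hq1); trivial.
  + intros s. auto_derive; [trivial|ring].
  + intros s.
    pose proof (rate_q_le lam a b A B Hlam Ha Hb _ _ _ (proj1 (Hpe s)) (proj1 (Hqe s)) (proj1 (Hwb s))).
    specialize (Hpe s). specialize (Hqe s).
    assert (a * b * clamp P (p s) <= a * b * exp (2 * s)) by (apply Rmult_le_compat_l; lra). lra.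
  + apply (Hv _ (a * b)); [lra|]. intros s. rewrite Rabs_pos_eq; [lra|].
    apply Rmult_le_pos; [lra|left; apply exp_pos].
Qed.

Lemma exponential_admissible : admissible (fun s => exp (2 * s)) (fun s => a * b * exp (2 * s)).
Proof.
assert (He : forall s, continuous (fun s => exp (2 * s)) s).
{ intros s. apply (is_derive_continuous _ _ (2 * exp (2 * s))). auto_derive; [trivial|ring]. }
repeat split; intros s; try apply Rle_refl; solve_continuous.
Qed.

(** The starting pair solves the linearization [p' = 2 p], [q' = q + a b p] exactly, so the first
    step errs only by clamping and by quadratic terms, both [O(exp (3 s))]. The exponentials have
    infinite weighted norm, but this first increment is finite and starts the geometric series. *)
Lemma picard_first_defect (p1 q1 : R -> R) :
  picard_step (fun s => exp (2 * s)) (fun s => a * b * exp (2 * s)) p1 q1 ->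
  exists C, 0 <= C /\ forall s,
    Rabs (p1 s - exp (2 * s)) <= C * weight weight_exponent s /\
    Rabs (q1 s - a * b * exp (2 * s)) <= q_scale * C * weight weight_exponent s.
Proof.
intros [[w [Hs [Hd1 Hd2]]] [Hv1 Hv2]].
pose proof (slaved_near _ _ _ exponential_admissible Hs) as Hn1.
destruct constants_pos as [H1 [H2 [H3 [H4 [H5 [H6 [H7 H8]]]]]]].
destruct Hs as [Hw Hwb].
assert (HAB : 0 <= A * B) by (apply Rmult_le_pos; lra).
assert (Hab : 0 <= a * b <= A * B) by (split; [apply Rmult_le_pos; lra|apply Rmult_le_compat; lra]).
set (p := fun s => clamp P (exp (2 * s))). set (q := fun s => clamp Q (a * b * exp (2 * s))).
assert (Hcl : forall s, (0 <= p s <= p_slope * theta s) /\ (0 <= q s <= q_slope * theta s)).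
{ intros s. pose proof (theta_range s). unfold p, q, p_slope, q_slope.
  pose proof (clamp_exp_theta Q (a * b) (a * b * exp (2 * s)) s ltac:(lra) ltac:(lra) (Rle_refl _)).
  assert ((Q + a * b) * theta s <= (Q + A * B) * theta s) by (apply Rmult_le_compat_r; lra).
  split; [apply clamp_exp_theta; [lra|lra|lra]|lra]. }
set (cp := 1 + 1 * 1 / P). set (cq := a * b + (a * b) * (a * b) / Q).
set (cr := q_slope * (q_slope + lam * A * p_slope) + B * p_slope * (A * A * w_slope)).
assert (Hdp : forall s, Rabs (p s - exp (2 * s)) <= cp * exp (3 * s)).
{ intros s. unfold p, cp. pose proof (clamp_exp_defect P 1 s HP ltac:(lra)) as H.
  rewrite Rmult_1_l in H. exact H. }
assert (Hdq : forall s, Rabs (q s - a * b * exp (2 * s)) <= cq * exp (3 * s)).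
{ intros s. apply clamp_exp_defect; lra. }
set (C1 := 2 * cp + p_slope * g_slope). set (C2 := cr + cq + a * b * cp).
assert (Hcp : 0 < cp).
{ unfold cp. assert (0 < 1 * 1 / P) by (apply Rdiv_lt_0_compat; lra). lra. }
assert (HC1 : 0 <= C1).
{ unfold C1. assert (0 <= p_slope * g_slope) by (apply Rmult_le_pos; lra). lra. }
assert (Hcr : 0 <= cr).
{ assert (0 < lam * A) by (apply Rmult_lt_0_compat; lra).
  assert (0 < lam * A * p_slope) by (apply Rmult_lt_0_compat; lra).
  assert (0 < A * A * w_slope) by (apply Rmult_lt_0_compat; [nra|lra]).
  assert (0 <= B * p_slope) by (apply Rmult_le_pos; lra).
  unfold cr; apply Rplus_le_le_0_compat; apply Rmult_le_pos; lra. }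
assert (Hcq : 0 <= cq).
{ unfold cq. assert (0 <= a * b * (a * b)) by nra. pose proof (Rinv_0_lt_compat Q HQ).
  apply Rplus_le_le_0_compat; [lra|]. apply Rmult_le_pos; lra. }
assert (HC2 : 0 <= C2).
{ unfold C2. assert (0 <= a * b * cp) by (apply Rmult_le_pos; lra). lra. }
assert (He3 : forall c s, is_derive (fun s => c / 3 * exp (3 * s)) s (c * exp (3 * s))).
{ intros c s. auto_derive; [trivial|field]. }
assert (Hv3 : forall f c, vanishes_minf f -> 0 <= c -> vanishes_minf (fun s => f s - c * exp (2 * s))).
{ intros f c Hf Hc.
  intros e He. destruct (Hf (e / 2) ltac:(lra)) as [T1 HT1].
  destruct (exp_vanishes c 2 ltac:(lra) Hc (e / 2) ltac:(lra)) as [T2 HT2].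
  exists (Rmin T1 T2). intros s Hs. pose proof (Rmin_l T1 T2). pose proof (Rmin_r T1 T2).
  specialize (HT1 s ltac:(lra)). specialize (HT2 s ltac:(lra)).
  pose proof (Rabs_minus_le _ _ _ _ (Rlt_le _ _ HT1) (Rlt_le _ _ HT2)) as HH.
  apply Rabs_def2 in HT1. apply Rabs_def2 in HT2. apply Rabs_def1; lra. }
assert (B1 : forall s, Rabs (p1 s - exp (2 * s)) <= C1 / 3 * exp (3 * s)).
{ apply (abs_le_of_derive_abs_le _ (fun s => p s * growth_p lam a (p s) (q s) (w s) - 2 * exp (2 * s))
    _ (fun s => C1 * exp (3 * s))).
  - intros s. apply (is_derive_minus p1 (fun s => exp (2 * s))); [apply Hd1|].
    auto_derive; [trivial|ring].
  - apply He3.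
  - intros s. destruct (Hcl s) as [Hps Hqs]. pose proof (theta_range s).
    pose proof (growth_p_near lam a A p_slope q_slope w_slope Hlam Ha _ _ _ (theta s)
      Hps Hqs (proj1 (Hwb s)) (Hn1 s)) as Hg. fold g_slope in Hg.
    replace (p s * growth_p lam a (p s) (q s) (w s) - 2 * exp (2 * s))
      with (2 * (p s - exp (2 * s)) + p s * (growth_p lam a (p s) (q s) (w s) - 2)) by ring.
    apply Rle_trans with (2 * (cp * exp (3 * s)) + p_slope * theta s * (g_slope * theta s)).
    + apply Rabs_plus_le; apply Rabs_mult_le; trivial; rewrite Rabs_pos_eq; lra.
    + pose proof (theta_sqr_le s). unfold C1.
      assert (p_slope * g_slope * (theta s * theta s) <= p_slope * g_slope * exp (3 * s))
        by (apply Rmult_le_compat_l; [apply Rmult_le_pos|]; lra). lra.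
  - intros e He. destruct (Hv3 p1 1 Hv1 ltac:(lra) e He) as [T HT]. exists T. intros s Hs'.
    specialize (HT s Hs'). rewrite Rmult_1_l in HT. exact HT.
  - apply exp_vanishes; lra. }
assert (B2 : forall s, Rabs (q1 s - a * b * exp (2 * s)) <= C2 / 3 * exp (3 * s)).
{ apply (abs_le_of_derive_abs_le _ (fun s => rate_q lam b (p s) (q s) (w s) - a * b * (2 * exp (2 * s)))
    _ (fun s => C2 * exp (3 * s))).
  - intros s. apply (is_derive_minus q1 (fun s => a * b * exp (2 * s))); [apply Hd2|].
    auto_derive; [trivial|ring].
  - apply He3.
  - intros s. destruct (Hcl s) as [Hps Hqs]. pose proof (theta_range s).
    pose proof (rate_q_near lam a b A B p_slope q_slope w_slope Hlam Ha Hb _ _ _ (theta s)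
      Hps Hqs (proj1 (Hwb s)) (Hn1 s)) as Hr. fold cr in Hr.
    replace (rate_q lam b (p s) (q s) (w s) - a * b * (2 * exp (2 * s)))
      with ((rate_q lam b (p s) (q s) (w s) - (q s + a * b * p s))
         + (q s - a * b * exp (2 * s)) + a * b * (p s - exp (2 * s))) by ring.
    apply Rle_trans with (cr * (theta s * theta s) + cq * exp (3 * s) + a * b * (cp * exp (3 * s))).
    + apply Rabs_plus_le; [apply Rabs_plus_le; trivial|].
      apply Rabs_mult_le; trivial. rewrite Rabs_pos_eq; lra.
    + pose proof (theta_sqr_le s). unfold C2.
      assert (cr * (theta s * theta s) <= cr * exp (3 * s)) by (apply Rmult_le_compat_l; lra). lra.
  - apply Hv3; [assumption|lra].
  - apply exp_vanishes; lra. }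
exists (C1 / 3 + C2 / 3). split; [lra|]. intros s.
pose proof (weight_ge weight_exponent s ltac:(lra)). pose proof (exp_pos (3 * s)).
specialize (B1 s). specialize (B2 s).
assert (1 <= q_scale) by (unfold q_scale; lra).
split.
- apply Rle_trans with ((C1 / 3 + C2 / 3) * exp (3 * s)); [nra|apply Rmult_le_compat_l; lra].
- apply Rle_trans with (q_scale * (C1 / 3 + C2 / 3) * exp (3 * s)).
  + eapply Rle_trans; [exact B2|]. apply Rmult_le_compat_r; [lra|]. nra.
  + apply Rmult_le_compat_l; [nra|lra].
Qed.

Lemma clamped_solution :
  exists (p q w : R -> R) C,
    slaved p q w /\ driven p q w p q /\
    forall s, p s <= exp (2 * s) /\ q s <= a * b * exp (2 * s) /\
      Rabs (p s - exp (2 * s)) <= C * weight weight_exponent s /\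
      Rabs (q s - a * b * exp (2 * s)) <= C * weight weight_exponent s.
Proof.
destruct constants_pos as [H1 [H2 [H3 [H4 [H5 [H6 [H7 H8]]]]]]].
set (S := {pq : (R -> R) * (R -> R) | admissible (fst pq) (snd pq)}).
assert (Hstep : forall x : S, exists y : S, picard_step (fst (proj1_sig x)) (snd (proj1_sig x))
    (fst (proj1_sig y)) (snd (proj1_sig y))).
{ intros [[p q] Had]. destruct (picard_step_exists p q Had) as [p1 [q1 [Hs Had1]]].
  exists (exist _ (p1, q1) Had1). exact Hs. }
set (next := fun x : S => proj1_sig (constructive_indefinite_description _ (Hstep x))).
assert (Hnext : forall x : S, picard_step (fst (proj1_sig x)) (snd (proj1_sig x))
    (fst (proj1_sig (next x))) (snd (proj1_sig (next x)))).
{ intros x. unfold next. now destruct (constructive_indefinite_description _ (Hstep x)). }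
set (x0 := exist _ (fun s => exp (2 * s), fun s => a * b * exp (2 * s)) exponential_admissible : S).
set (x := fun k => Nat.iter k next x0).
set (pk := fun k => fst (proj1_sig (x k))). set (qk := fun k => snd (proj1_sig (x k))).
assert (Had : forall k, admissible (pk k) (qk k)) by (intros k; exact (proj2_sig (x k))).
assert (Hk : forall k, picard_step (pk k) (qk k) (pk (Datatypes.S k)) (qk (Datatypes.S k)))
  by (intros k; apply Hnext).
destruct (picard_first_defect (pk 1%nat) (qk 1%nat) (Hk O)) as [C [HC HC1]].
assert (Hgeo : forall k,
  (forall s, Rabs (pk (Datatypes.S k) s - pk k s) <= C * (3 / 4) ^ k * weight weight_exponent s) /\
  (forall s, Rabs (qk (Datatypes.S k) s - qk k s) <= q_scale * (C * (3 / 4) ^ k) * weight weight_exponent s)).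
{ induction k as [|k [IH1 IH2]].
  - rewrite pow_O, Rmult_1_r. split; intros s; apply (HC1 s).
  - destruct (picard_contracts _ _ _ _ _ _ _ _ (C * (3 / 4) ^ k)
      (Had (Datatypes.S k)) (Had k) (Hk (Datatypes.S k)) (Hk k) IH1 IH2) as [J1 J2].
    replace (C * (3 / 4) ^ Datatypes.S k) with (3 / 4 * (C * (3 / 4) ^ k)) by (simpl; ring).
    split; [exact J1|exact J2]. }
assert (Hcw : forall s, continuous (weight weight_exponent) s)
  by (intros s; eapply is_derive_continuous, weight_derive).
destruct (weighted_uniform_limit pk (weight weight_exponent) C) as [p [Hp Hpc]]; trivial.
{ intros k s; apply (Had k). }
{ apply weight_pos. }
{ intros k; apply Hgeo. }
destruct (weighted_uniform_limit qk (weight weight_exponent) (q_scale * C)) as [q [Hq Hqc]]; trivial.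
{ intros k s; apply (Had k). }
{ apply weight_pos. }
{ intros k s. destruct (Hgeo k) as [_ J]. specialize (J s). lra. }
assert (Hlim : forall u l c M s, (forall k, Rabs (u k - l) <= c * (3 / 4) ^ k * weight weight_exponent s) ->
   (forall k : nat, u k <= M) -> l <= M).
{ intros u l c M s Hu HM. destruct (Rle_lt_dec l M) as [|Hl]; [assumption|exfalso].
  assert (l - M = 0); [|lra].
  apply (zero_of_geometric_bound _ (c * weight weight_exponent s)). intros k.
  specialize (Hu k). specialize (HM k). rewrite Rabs_pos_eq by lra.
  pose proof (Rle_abs (- (u k - l))). rewrite Rabs_Ropp in *. lra. }
assert (Hpq : admissible p q).
{ split; [assumption|]. split; [assumption|]. split; intros s.
  - apply (Hlim (fun k => pk k s) _ (4 * C) _ s); [intros k; apply Hp|intros k; apply (Had k)].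
  - apply (Hlim (fun k => qk k s) _ (4 * (q_scale * C)) _ s); [intros k; apply Hq|intros k; apply (Had k)]. }
(* A further step taken from the limit stays within a contracted distance of each [pk (S k)], so it
   has the same limit. This gives the fixed-point equation pointwise. *)
destruct (picard_step_exists p q Hpq) as [p1 [q1 [Hs Had1]]].
assert (Hfix : forall k,
  (forall s, Rabs (p1 s - pk (Datatypes.S k) s) <= 3 / 4 * (4 * C * (3 / 4) ^ k) * weight weight_exponent s) /\
  (forall s, Rabs (q1 s - qk (Datatypes.S k) s) <= q_scale * (3 / 4 * (4 * C * (3 / 4) ^ k)) * weight weight_exponent s)).
{ intros k. apply (picard_contracts p q p1 q1 (pk k) (qk k)); trivial.
  - intros s. rewrite Rabs_minus_sym. apply Hp.
  - intros s. rewrite Rabs_minus_sym. specialize (Hq k s). lra. }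
assert (Ep : forall s, p1 s = p s).
{ intros s. apply Rminus_diag_uniq. apply (zero_of_geometric_bound _ (6 * C * weight weight_exponent s)).
  intros k. destruct (Hfix k) as [J _]. specialize (J s). specialize (Hp (Datatypes.S k) s). simpl in Hp.
  replace (p1 s - p s) with ((p1 s - pk (Datatypes.S k) s) + (pk (Datatypes.S k) s - p s)) by ring.
  eapply Rle_trans; [apply (Rabs_plus_le _ _ _ _ J Hp)|]. right; field. }
assert (Eq : forall s, q1 s = q s).
{ intros s. apply Rminus_diag_uniq. apply (zero_of_geometric_bound _ (6 * q_scale * C * weight weight_exponent s)).
  intros k. destruct (Hfix k) as [_ J]. specialize (J s). specialize (Hq (Datatypes.S k) s). simpl in Hq.
  replace (q1 s - q s) with ((q1 s - qk (Datatypes.S k) s) + (qk (Datatypes.S k) s - q s)) by ring.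
  eapply Rle_trans; [apply (Rabs_plus_le _ _ _ _ J Hq)|]. right; field. }
destruct Hs as [[w [Hsl [Hd1 Hd2]]] _].
exists p, q, w, (4 * C + 4 * (q_scale * C)).
split; [exact Hsl|]. split; [split|].
- intros s. apply (is_derive_ext p1); [exact Ep|apply Hd1].
- intros s. apply (is_derive_ext q1); [exact Eq|apply Hd2].
(* The bound for index [0] compares the fixed point with the initial exponentials, which gives its
   behaviour at minus infinity. *)
- intros s. destruct Hpq as [_ [_ [B1 B2]]].
  specialize (Hp O s). specialize (Hq O s). rewrite pow_O in Hp, Hq.
  rewrite Rabs_minus_sym in Hp, Hq. change (pk O s) with (exp (2 * s)) in Hp.
  change (qk O s) with (a * b * exp (2 * s)) in Hq.
  pose proof (weight_pos weight_exponent s).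
  assert (0 <= C * weight weight_exponent s) by (apply Rmult_le_pos; lra).
  assert (0 <= q_scale * C * weight weight_exponent s) by (apply Rmult_le_pos; [apply Rmult_le_pos|]; lra).
  repeat split; trivial; lra.
Qed.

End Picard.

(** * Trapping in the box *)

Definition slaving_error (lam mu a p q w : R) : R := mu * a / lam - q - (mu / lam + lam * p) * / w.

(** Solving the definition of the slaving error [e] for [r] gives
    [(mu + lam^2 p) r = lam (K - q - e)]; the factor on the left clears this denominator. For
    [e = 0] the right-hand side vanishes on the line [(1 + mu) q + (2 - n) lam p = 2 mu]. *)
Lemma growth_p_identity (lam mu n a p q w : R) :
  0 < lam -> 0 < mu -> 0 < w -> a = (2 - n + 2 * lam) / (1 + mu) ->
  (mu + lam * lam * p) * growth_p lam a p q w =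
  2 * mu - (1 + mu) * q - (2 - n) * lam * p - slaving_error lam mu a p q w * (1 - lam * lam * p).
Proof. intros Hlam Hmu Hw ->. unfold growth_p, slaving_error. field. lra. Qed.

(** For [e = 0] the right-hand side is negative as soon as [q > 1] and [lam (1 - n) q >= mu a b];
    hence the two lower bounds imposed on [Q]. *)
Lemma rate_q_identity (lam mu n a b p q w : R) :
  0 < lam -> 0 < mu -> 0 < w -> a = (2 - n + 2 * lam) / (1 + mu) ->
  b = (1 - mu - n + (1 - mu) * lam) / (1 + mu) ->
  (mu + lam * lam * p) * rate_q lam b p q w =
  mu * q * (1 - q) + p * (mu * a * b - lam * (1 - n) * q
    - lam * slaving_error lam mu a p q w * (b - lam * q)).
Proof. intros Hlam Hmu Hw -> ->. unfold rate_q, slaving_error. field. lra. Qed.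

(* The right-hand side is manifestly positive up to terms controlled by the slaving error and [p'/p]. *)
Lemma rate_q_nullcline_identity (lam mu n a b p q w : R) :
  0 < lam -> 0 < mu -> 0 < w -> a = (2 - n + 2 * lam) / (1 + mu) ->
  b = (1 - mu - n + (1 - mu) * lam) / (1 + mu) ->
  (2 - n) * ((mu + lam * lam * p) * rate_q lam b p q w) =
  (2 - n) * (p * (mu * a * b)) + q * ((1 - mu - n) * q + n * mu)
  + (slaving_error lam mu a p q w * (1 - lam * lam * p)
     + (mu + lam * lam * p) * growth_p lam a p q w) * ((1 - n) * q)
  - (2 - n) * (p * (lam * slaving_error lam mu a p q w * (b - lam * q))).
Proof. intros Hlam Hmu Hw -> ->. unfold rate_q, growth_p, slaving_error. field. lra. Qed.

Section Trapping.

Variables lam mu n a b A B P Q kap : R.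
Hypotheses (Hlam : 0 < lam) (Hmu : 0 < mu <= 1) (Ha : 0 < a <= A) (Hb : 0 < b <= B).
Hypotheses (Hn : 0 < n < 1) (HP : 3 < lam * P) (HQ : 1 < Q) (Hkap : 0 < kap).
Hypothesis HK : kap <= mu * a / lam - Q.
Hypothesis Ha_eq : a = (2 - n + 2 * lam) / (1 + mu).
Hypothesis Hb_eq : b = (1 - mu - n + (1 - mu) * lam) / (1 + mu).

Let wmax := w_max lam P kap.

Definition g_max : R := 2 + A / lam + Q + lam * P * A.
Definition q_speed : R := Q * (1 + Q + lam * P * A) + B * P * A.
Definition error_bound : R := 4 * (lam * (P * g_max) + w_max lam P kap * q_speed) / (kap * kap) * (A / lam * A).

Variable del : R.
Hypothesis Hdel : mu * a * b + del <= lam * (1 - n) * Q.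
Hypothesis Hsmall1 : n * error_bound * (1 + lam * lam * P) < 1.
Hypothesis Hsmall2 : n * error_bound * lam * (B + lam * Q) <= del.

Lemma P_pos : 0 < P.
Proof. destruct (Rle_lt_dec P 0); [nra|assumption]. Qed.

Lemma growth_p_bound (p q w : R) :
  0 <= p <= P -> 0 <= q <= Q -> / a <= w -> Rabs (growth_p lam a p q w) <= g_max.
Proof.
intros Hp Hq Hw. unfold growth_p, g_max.
pose proof (inv_le a w (proj1 Ha) Hw) as Hr.
replace (lam * p * / w) with (lam * p * (/ w)) by ring.
apply Rabs_minus_le; [apply Rabs_minus_le; [apply Rabs_plus_le|]|].
- rewrite Rabs_pos_eq; lra.
- apply Rabs_div_le; [assumption|]. apply Rabs_le; lra.
- rewrite Rabs_pos_eq; lra.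
- apply Rabs_mult_le; [apply Rabs_mult_le|]; rewrite Rabs_pos_eq; lra.
Qed.

Lemma rate_q_bound (p q w : R) :
  0 <= p <= P -> 0 <= q <= Q -> / a <= w -> Rabs (rate_q lam b p q w) <= q_speed.
Proof.
intros Hp Hq Hw. unfold rate_q, q_speed.
pose proof (inv_range a A Ha w Hw) as Hr.
apply Rabs_plus_le.
- apply Rabs_mult_le; [rewrite Rabs_pos_eq; lra|].
  apply Rabs_minus_le; [apply Rabs_minus_le|]; try (rewrite Rabs_pos_eq; lra).
  apply Rabs_mult_le; [apply Rabs_mult_le|]; rewrite Rabs_pos_eq; lra.
- apply Rabs_mult_le; [apply Rabs_mult_le|]; rewrite Rabs_pos_eq; lra.
Qed.

Variables p q w : R -> R.
Hypothesis Hs : slaved lam mu a n P Q kap p q w.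
Hypothesis Hd : driven lam a b P Q p q w p q.

Let ph s := clamp P (p s).
Let qh s := clamp Q (q s).

Lemma clamped_ranges (s : R) : 0 <= ph s <= P /\ 0 <= qh s <= Q.
Proof. pose proof P_pos. split; apply clamp_range; lra. Qed.

Lemma lipschitz_of_speed (f df : R -> R) (V s t : R) :
  (forall x, is_derive f x (df x)) -> (forall x, Rabs (df x) <= V) -> s <= t ->
  Rabs (f t - f s) <= V * (t - s).
Proof.
intros Hf HV Hst.
assert (H1 : V * s - f s <= V * t - f t).
{ apply (derive_nonneg_le (fun x => V * x - f x) (fun x => V - df x)); trivial.
  - intros x _. apply (is_derive_minus (fun x => V * x) f); [|apply Hf]. auto_derive; [trivial|ring].
  - intros x _. specialize (HV x). pose proof (Rle_abs (df x)). lra. }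
assert (H2 : V * s + f s <= V * t + f t).
{ apply (derive_nonneg_le (fun x => V * x + f x) (fun x => V + df x)); trivial.
  - intros x _. apply (is_derive_plus (fun x => V * x) f); [|apply Hf]. auto_derive; [trivial|ring].
  - intros x _. specialize (HV x). pose proof (Rle_abs (- df x)). rewrite Rabs_Ropp in *. lra. }
apply Rabs_le; lra.
Qed.

(** The slow manifold is frozen at [s0]: [h0] is its value there, and [(p, q)] drift from their
    values at [s0] at most linearly. The comparison function [2 * n / kap + (s - s0)] dominates the
    drift and grows at rate at most [kap / (2 * n)], the largest rate allowed; at [s0] only a
    multiple of [n] remains. *)
Lemma slaving_error_small (s0 : R) :
  Rabs (slaving_error lam mu a (ph s0) (qh s0) (w s0)) <= n * error_bound.
Proof.
pose proof P_pos as HP0.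
destruct Hs as [Hw Hwb]. destruct Hd as [Hdp Hdq].
set (K := mu * a / lam).
set (h0 := (mu / lam + lam * ph s0) / (K - qh s0)).
set (L := lam * (P * g_max) + wmax * q_speed).
assert (Hi : 0 < / lam) by now apply Rinv_0_lt_compat.
assert (Hia : 0 < / a) by (apply Rinv_0_lt_compat; lra).
assert (Hk0 : kap <= K - qh s0) by (destruct (clamped_ranges s0); unfold K; lra).
assert (Hmul : 0 < mu / lam <= / lam).
{ split; [apply Rdiv_lt_0_compat; lra|unfold Rdiv; nra]. }
assert (Hh0 : 0 <= h0 <= wmax).
{ destruct (clamped_ranges s0) as [Hps _].
  assert (0 <= lam * ph s0 <= lam * P) by (split; [apply Rmult_le_pos|apply Rmult_le_compat_l]; lra).
  unfold h0, wmax, w_max. split.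
  - apply Rdiv_le_0_compat; lra.
  - unfold Rdiv at 1. rewrite Rmult_comm. unfold Rdiv. rewrite (Rmult_comm _ (/ kap)).
    apply Rmult_le_compat; [left; apply Rinv_0_lt_compat; lra|lra| |lra].
    apply Rinv_le_contravar; lra. }
assert (HVp : forall s, Rabs (ph s * growth_p lam a (ph s) (qh s) (w s)) <= P * g_max).
{ intros s. destruct (clamped_ranges s). apply Rabs_mult_le; [rewrite Rabs_pos_eq; lra|].
  apply growth_p_bound; trivial. apply Hwb. }
assert (HVq : forall s, Rabs (rate_q lam b (ph s) (qh s) (w s)) <= q_speed).
{ intros s. destruct (clamped_ranges s). apply rate_q_bound; trivial. apply Hwb. }
assert (HL : 0 <= L).
{ pose proof (HVp 0). pose proof (HVq 0).
  pose proof (Rabs_pos (ph 0 * growth_p lam a (ph 0) (qh 0) (w 0))).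
  pose proof (Rabs_pos (rate_q lam b (ph 0) (qh 0) (w 0))).
  unfold L. apply Rplus_le_le_0_compat; apply Rmult_le_pos; lra. }
assert (Hy : Rabs (w s0 - h0) <= 2 * L / kap * (2 * n / kap + (s0 - s0))).
{ apply (bounded_solution_le (fun s => w s - h0) (fun s => K - qh s)
    (fun s => lam * (ph s - ph s0) + h0 * (qh s - qh s0))
    (fun s => 2 * n / kap + (s - s0)) (fun _ => 1) n kap (kap / (2 * n)) L wmax); try lra.
  - right; field; lra.
  - intros s _. evar_last.
    + apply (is_derive_minus w (fun _ => h0)); [apply Hw|apply @is_derive_const].
    + unfold minus, plus, opp, zero; simpl. fold K. fold (ph s) (qh s).
      apply Rmult_eq_reg_l with n; [|lra].
      replace (n * (((K - qh s) * (w s - h0) - (lam * (ph s - ph s0) + h0 * (qh s - qh s0))) / n))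
        with ((K - qh s) * w s - (mu / lam + lam * ph s) - ((K - qh s0) * h0 - (mu / lam + lam * ph s0)))
        by (field; lra).
      replace ((K - qh s0) * h0) with (mu / lam + lam * ph s0) by (unfold h0; field; lra).
      field. lra.
  - intros s _. auto_derive; [trivial|ring].
  - intros s H. assert (0 < 2 * n / kap) by (apply Rdiv_lt_0_compat; lra). split; [lra|].
    replace (kap / (2 * n) * (2 * n / kap + (s - s0))) with (1 + kap / (2 * n) * (s - s0)) by (field; lra).
    assert (0 < kap / (2 * n)) by (apply Rdiv_lt_0_compat; lra).
    assert (0 <= kap / (2 * n) * (s - s0)) by (apply Rmult_le_pos; lra). lra.
  - intros s _. destruct (clamped_ranges s). unfold K; lra.
  - intros s H.
    pose proof (lipschitz_of_speed p _ _ _ _ Hdp HVp H) as J1.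
    pose proof (lipschitz_of_speed q _ _ _ _ Hdq HVq H) as J2.
    pose proof (clamp_lipschitz P (p s) (p s0) ltac:(lra)) as J3.
    pose proof (clamp_lipschitz Q (q s) (q s0) ltac:(lra)) as J4.
    fold (ph s) (ph s0) in J3. fold (qh s) (qh s0) in J4.
    assert (0 < 2 * n / kap) by (apply Rdiv_lt_0_compat; lra).
    apply Rle_trans with (lam * (P * g_max * (s - s0)) + wmax * (q_speed * (s - s0))).
    + apply Rabs_plus_le; apply Rabs_mult_le; try lra; rewrite Rabs_pos_eq; lra.
    + unfold L in *. nra.
  - intros s _. specialize (Hwb s). fold wmax in Hwb. apply Rabs_le; lra. }
assert (E : slaving_error lam mu a (ph s0) (qh s0) (w s0) = (w s0 - h0) * ((K - qh s0) * / w s0)).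
{ specialize (Hwb s0). unfold slaving_error, h0. fold K. field. lra. }
rewrite E.
apply Rle_trans with (2 * L / kap * (2 * n / kap + (s0 - s0)) * (A / lam * A)).
- apply Rabs_mult_le; [assumption|].
  pose proof (inv_range a A Ha (w s0) (proj1 (Hwb s0))).
  destruct (clamped_ranges s0).
  apply Rabs_mult_le; rewrite Rabs_pos_eq; try lra.
  assert (K <= A / lam); [|lra].
  unfold K, Rdiv. apply Rmult_le_compat_r; [lra|]. nra.
- right. unfold error_bound. fold wmax. fold L. field. lra.
Qed.

(** At [p = P] the identity for [p'/p] is at most [2 - lam P] plus an error below [1]; hence the
    requirement [3 < lam * P]. *)
Lemma p_lt_P (s : R) : (forall t, p t <= exp (2 * t)) -> p s < P.
Proof.
intros Hpe. pose proof P_pos as HP0. destruct Hs as [Hw Hwb]. destruct Hd as [Hdp Hdq].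
set (s0 := Rmin s (ln P / 2 - 1)).
assert (s0 <= s) by apply Rmin_l. assert (s0 <= ln P / 2 - 1) by apply Rmin_r.
assert (0 < P - p s); [|lra].
apply (stay_pos (fun s => P - p s) (fun s => 0 - ph s * growth_p lam a (ph s) (qh s) (w s)) s0); trivial.
- intros t _. apply (is_derive_minus (fun _ => P) p); [apply @is_derive_const|apply Hdp].
- specialize (Hpe s0). assert (exp (2 * s0) < P); [|lra].
  rewrite <- (exp_ln P) at 1 by assumption. apply exp_increasing. lra.
- intros t _ Ht.
  assert (Eph : ph t = P) by (apply clamp_above; lra).
  destruct (clamped_ranges t) as [_ Hqt].
  pose proof (slaving_error_small t) as He.
  assert (Hw0 : 0 < w t) by (specialize (Hwb t); assert (0 < / a) by (apply Rinv_0_lt_compat; lra); lra).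
  pose proof (growth_p_identity lam mu n a (ph t) (qh t) (w t) Hlam (proj1 Hmu) Hw0 Ha_eq) as I.
  set (g := growth_p lam a (ph t) (qh t) (w t)) in *. set (e := slaving_error lam mu a (ph t) (qh t) (w t)) in *.
  rewrite Eph in *.
  assert (0 < lam * lam * P) by (repeat apply Rmult_lt_0_compat; assumption).
  assert (Hx : Rabs (e * (1 - lam * lam * P)) <= n * error_bound * (1 + lam * lam * P)).
  { apply Rabs_mult_le; [assumption|]. apply Rabs_le; lra. }
  apply Rabs_le_between in Hx.
  assert ((mu + lam * lam * P) * g < 0).
  { rewrite I. assert (0 <= (1 + mu) * qh t) by (apply Rmult_le_pos; lra).
    assert (1 * (lam * P) <= (2 - n) * (lam * P)) by (apply Rmult_le_compat_r; lra). lra. }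
  nra.
Qed.

(** [Hdel] leaves a margin [del] in the factor of [p], into which [Hsmall2] fits the slaving term;
    strictness comes from [mu * Q * (1 - Q) < 0]. *)
Lemma q_lt_Q (s : R) : (forall t, q t <= a * b * exp (2 * t)) -> q s < Q.
Proof.
intros Hqe. pose proof P_pos as HP0. destruct Hs as [Hw Hwb]. destruct Hd as [Hdp Hdq].
assert (Hab : 0 < a * b) by (apply Rmult_lt_0_compat; lra).
assert (Hab' : 0 < Q / (a * b)) by (apply Rdiv_lt_0_compat; lra).
set (s0 := Rmin s (ln (Q / (a * b)) / 2 - 1)).
assert (s0 <= s) by apply Rmin_l. assert (s0 <= ln (Q / (a * b)) / 2 - 1) by apply Rmin_r.
assert (0 < Q - q s); [|lra].
apply (stay_pos (fun s => Q - q s) (fun s => 0 - rate_q lam b (ph s) (qh s) (w s)) s0); trivial.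
- intros t _. apply (is_derive_minus (fun _ => Q) q); [apply @is_derive_const|apply Hdq].
- specialize (Hqe s0). assert (exp (2 * s0) < Q / (a * b)).
  { rewrite <- (exp_ln (Q / (a * b))) at 1 by assumption. apply exp_increasing. lra. }
  assert (a * b * exp (2 * s0) < Q); [|lra].
  apply Rmult_lt_reg_r with (/ (a * b)); [now apply Rinv_0_lt_compat|].
  replace (a * b * exp (2 * s0) * / (a * b)) with (exp (2 * s0)) by (field; lra). assumption.
- intros t _ Ht.
  assert (Eqh : qh t = Q) by (apply clamp_above; lra).
  destruct (clamped_ranges t) as [Hpt _].
  pose proof (slaving_error_small t) as He.
  assert (Hw0 : 0 < w t) by (specialize (Hwb t); assert (0 < / a) by (apply Rinv_0_lt_compat; lra); lra).
  pose proof (rate_q_identity lam mu n a b (ph t) (qh t) (w t) Hlam (proj1 Hmu) Hw0 Ha_eq Hb_eq) as I.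
  set (v := rate_q lam b (ph t) (qh t) (w t)) in *. set (e := slaving_error lam mu a (ph t) (qh t) (w t)) in *.
  rewrite Eqh in *.
  assert (Hx : Rabs (lam * e * (b - lam * Q)) <= lam * (n * error_bound) * (B + lam * Q)).
  { apply Rabs_mult_le; [apply Rabs_mult_le; [rewrite Rabs_pos_eq; lra|assumption]|].
    assert (0 < lam * Q) by (apply Rmult_lt_0_compat; lra). apply Rabs_le; lra. }
  apply Rabs_le_between in Hx.
  assert (0 < mu * Q * (Q - 1)) by (apply Rmult_lt_0_compat; [apply Rmult_lt_0_compat|]; lra).
  assert (0 <= lam * lam * ph t) by (apply Rmult_le_pos; [apply Rmult_le_pos|]; lra).
  assert (0 < mu + lam * lam * ph t) by lra.
  assert ((mu + lam * lam * ph t) * v < 0).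
  { rewrite I. assert (mu * a * b - lam * (1 - n) * Q - lam * e * (b - lam * Q) <= 0) by lra. nra. }
  nra.
Qed.

(** Since [p' = 0] at [p = 0], the level zero is not a strict barrier. An exponential decaying
    faster than [p] can decay is one. *)
Lemma p_stays_pos (s0 s : R) : s0 <= s -> 0 < p s0 -> 0 < p s.
Proof.
intros H0 Hp0. pose proof P_pos as HP0. destruct Hs as [Hw Hwb]. destruct Hd as [Hdp Hdq].
set (f := fun s => p s0 / 2 * exp (- (g_max + 1) * (s - s0))).
assert (Hf : forall s, 0 < f s) by (intros t; apply Rmult_lt_0_compat; [lra|apply exp_pos]).
assert (0 < p s - f s); [|specialize (Hf s); lra].
apply (stay_pos (fun s => p s - f s)
  (fun s => ph s * growth_p lam a (ph s) (qh s) (w s) - - (g_max + 1) * f s) s0); trivial.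
- intros t _. apply (is_derive_minus p f); [apply Hdp|]. unfold f. auto_derive; [trivial|unfold Rminus; ring].
- unfold f. rewrite Rminus_diag, Rmult_0_r, exp_0. lra.
- intros t _ Ht. specialize (Hf t). destruct (clamped_ranges t) as [Hpt Hqt].
  pose proof (growth_p_bound (ph t) (qh t) (w t) Hpt Hqt (proj1 (Hwb t))) as Hg.
  assert (Hle : ph t <= p t) by (apply clamp_le; lra).
  apply Rabs_le_between in Hg. nra.
Qed.

Lemma q_stays_pos (s0 s : R) : s0 <= s -> 0 < q s0 -> (forall t, 0 < p t) -> 0 < q s.
Proof.
intros H0 Hq0 Hp. pose proof P_pos as HP0. destruct Hs as [Hw Hwb]. destruct Hd as [Hdp Hdq].
apply (stay_pos q (fun s => rate_q lam b (ph s) (qh s) (w s)) s0); trivial.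
intros t _ Ht.
assert (Eqh : qh t = 0) by (apply clamp_below; lra). rewrite Eqh. unfold rate_q.
assert (Hpt : 0 < ph t).
{ unfold ph, clamp. apply Rlt_le_trans with (Rmin (p t) P); [apply Rmin_glb_lt; trivial|apply Rmax_r]. }
pose proof (inv_range a A Ha (w t) (proj1 (Hwb t))).
assert (0 < b * ph t * / w t); [|lra].
apply Rmult_lt_0_compat; [apply Rmult_lt_0_compat|]; lra.
Qed.

End Trapping.

(** * Slow manifold estimates and long-time behaviour *)

Lemma Rabs_le_of_sqr_le (y c v1 v2 : R) :
  0 <= c -> y * y <= c * c * (v1 * v1 + v2 * v2) -> Rabs y <= c * (Rabs v1 + Rabs v2).
Proof.
intros Hc H. pose proof (Rabs_pos v1). pose proof (Rabs_pos v2).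
rewrite <- (Rabs_pos_eq (c * (Rabs v1 + Rabs v2))) by (apply Rmult_le_pos; lra).
apply Rsqr_le_abs_0. unfold Rsqr.
assert (E1 : Rabs v1 * Rabs v1 = v1 * v1) by (rewrite <- Rabs_mult; apply Rabs_pos_eq; nra).
assert (E2 : Rabs v2 * Rabs v2 = v2 * v2) by (rewrite <- Rabs_mult; apply Rabs_pos_eq; nra).
apply Rle_trans with (c * c * (v1 * v1 + v2 * v2)); [assumption|].
replace (c * (Rabs v1 + Rabs v2) * (c * (Rabs v1 + Rabs v2)))
  with (c * c * (Rabs v1 * Rabs v1 + Rabs v2 * Rabs v2 + 2 * (Rabs v1 * Rabs v2))) by ring.
rewrite E1, E2. apply Rmult_le_compat_l; [nra|].
assert (0 <= Rabs v1 * Rabs v2) by (apply Rmult_le_pos; assumption). lra.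
Qed.

(* The cone [|y| > c |v|] is forward invariant and expanding, so a bounded orbit stays outside it. *)
Lemma expanding_cone (y k F v1 v2 dv1 dv2 : R -> R) (n kap C1 L L2 c M s0 : R) :
  0 < n -> 0 < kap -> 0 < c -> 0 <= C1 -> 0 <= L -> 0 <= L2 ->
  (forall s, is_derive y s ((k s * y s - F s) / n)) ->
  (forall s, is_derive v1 s (dv1 s)) -> (forall s, is_derive v2 s (dv2 s)) ->
  (forall s, kap <= k s) ->
  (forall s, Rabs (F s) <= C1 * (Rabs (v1 s) + Rabs (v2 s))) ->
  (forall s, Rabs (dv1 s) <= L * (Rabs (v1 s) + Rabs (v2 s)) + L2 * Rabs (y s)) ->
  (forall s, Rabs (dv2 s) <= L * (Rabs (v1 s) + Rabs (v2 s)) + L2 * Rabs (y s)) ->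
  (forall s, Rabs (y s) <= M) ->
  4 * C1 <= kap * c -> n * (2 * (2 * L + c * L2)) <= kap / 4 ->
  Rabs (y s0) <= c * (Rabs (v1 s0) + Rabs (v2 s0)).
Proof.
intros Hn Hkap Hc HC1 HL HL2 Hy Hv1 Hv2 Hk HF Hd1 Hd2 HM Hcone Hsm.
apply Rabs_le_of_sqr_le; [lra|].
assert (Hmain : y s0 * y s0 - c * c * (v1 s0 * v1 s0 + v2 s0 * v2 s0) <= 0); [|lra].
apply (bounded_repelled_nonpos (fun s => y s * y s - c * c * (v1 s * v1 s + v2 s * v2 s))
  (fun s => 2 * (y s * ((k s * y s - F s) / n)) - 2 * (c * c * (v1 s * dv1 s + v2 s * dv2 s)))
  (kap / (2 * n)) (M * M)).
- apply Rdiv_lt_0_compat; lra.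
- intros s _. evar_last.
  + apply (is_derive_minus (fun s => y s * y s) (fun s => c * c * (v1 s * v1 s + v2 s * v2 s))).
    * apply (is_derive_mult y y); [apply Hy|apply Hy|intros; apply Rmult_comm].
    * apply (is_derive_scal (fun s => v1 s * v1 s + v2 s * v2 s)).
      apply (is_derive_plus (fun s => v1 s * v1 s) (fun s => v2 s * v2 s)).
      -- apply (is_derive_mult v1 v1); [apply Hv1|apply Hv1|intros; apply Rmult_comm].
      -- apply (is_derive_mult v2 v2); [apply Hv2|apply Hv2|intros; apply Rmult_comm].
  + unfold minus, plus, opp, mult; simpl; unfold mult; simpl. field. lra.
- intros s _ Hpos.
  specialize (Hk s). specialize (HF s). specialize (Hd1 s). specialize (Hd2 s).
  (* Inside the cone both [c * |v1|] and [c * |v2|] are at most [Y], so all terms are measured by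
     [Y * Y]. Of the [2 * kap] supplied by the repulsion, [F] uses at most [kap] and the motion of
     [v1], [v2] at most [kap / 2]. *)
  set (Y := Rabs (y s)) in *. set (X1 := Rabs (v1 s)) in *. set (X2 := Rabs (v2 s)) in *.
  assert (EY : Y * Y = y s * y s) by (unfold Y; rewrite <- Rabs_mult; apply Rabs_pos_eq; nra).
  assert (E1 : X1 * X1 = v1 s * v1 s) by (unfold X1; rewrite <- Rabs_mult; apply Rabs_pos_eq; nra).
  assert (E2 : X2 * X2 = v2 s * v2 s) by (unfold X2; rewrite <- Rabs_mult; apply Rabs_pos_eq; nra).
  assert (PY : 0 <= Y) by apply Rabs_pos. assert (P1 : 0 <= X1) by apply Rabs_pos.
  assert (P2 : 0 <= X2) by apply Rabs_pos.
  rewrite <- EY, <- E1, <- E2 in Hpos.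
  assert (B1 : c * X1 <= Y).
  { apply Rsqr_incr_0; [unfold Rsqr; assert (0 <= c * c * (X2 * X2)) by nra; lra|nra|assumption]. }
  assert (B2 : c * X2 <= Y).
  { apply Rsqr_incr_0; [unfold Rsqr; assert (0 <= c * c * (X1 * X1)) by nra; lra|nra|assumption]. }
  assert (HyF : y s * F s <= kap / 2 * (Y * Y)).
  { apply Rle_trans with (Y * (C1 * (X1 + X2))).
    - eapply Rle_trans; [apply Rle_abs|]. apply Rabs_mult_le; [apply Rle_refl|assumption].
    - assert (C1 * (X1 + X2) <= kap / 2 * Y); [|nra].
      apply Rmult_le_reg_l with c; [assumption|].
      replace (c * (C1 * (X1 + X2))) with (C1 * (c * X1 + c * X2)) by ring.
      apply Rle_trans with (C1 * (2 * Y)); [apply Rmult_le_compat_l; lra|]. nra. }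
  assert (Hvd : forall v d X, Rabs v = X -> c * X <= Y -> Rabs d <= L * (X1 + X2) + L2 * Y ->
    c * c * (v * d) <= (2 * L + c * L2) * (Y * Y)).
  { intros v d X EX BX Hd.
    assert (BD : c * Rabs d <= (2 * L + c * L2) * Y).
    { apply Rle_trans with (c * (L * (X1 + X2) + L2 * Y)); [apply Rmult_le_compat_l; lra|].
      replace (c * (L * (X1 + X2) + L2 * Y)) with (L * (c * X1 + c * X2) + c * L2 * Y) by ring.
      assert (L * (c * X1 + c * X2) <= L * (2 * Y)) by (apply Rmult_le_compat_l; lra). lra. }
    replace (c * c * (v * d)) with ((c * v) * (c * d)) by ring.
    replace ((2 * L + c * L2) * (Y * Y)) with (Y * ((2 * L + c * L2) * Y)) by ring.
    eapply Rle_trans; [apply Rle_abs|].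
    apply Rabs_mult_le; rewrite Rabs_mult, (Rabs_pos_eq c) by lra; [rewrite EX|]; assumption. }
  pose proof (Hvd (v1 s) (dv1 s) X1 eq_refl B1 Hd1) as D1.
  pose proof (Hvd (v2 s) (dv2 s) X2 eq_refl B2 Hd2) as D2.
  apply Rmult_le_reg_l with n; [assumption|].
  replace (n * (2 * (y s * ((k s * y s - F s) / n)) - 2 * (c * c * (v1 s * dv1 s + v2 s * dv2 s))))
    with (2 * (k s * (y s * y s) - y s * F s) - 2 * (n * (c * c * (v1 s * dv1 s) + c * c * (v2 s * dv2 s))))
    by (field; lra).
  replace (n * (kap / (2 * n) * (y s * y s - c * c * (v1 s * v1 s + v2 s * v2 s))))
    with (kap / 2 * (y s * y s - c * c * (v1 s * v1 s + v2 s * v2 s))) by (field; lra).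
  rewrite <- EY, <- E1, <- E2.
  assert (PYY : 0 <= Y * Y) by nra.
  assert (n * (c * c * (v1 s * dv1 s) + c * c * (v2 s * dv2 s)) <= kap / 4 * (Y * Y)).
  { apply Rle_trans with (n * (2 * (2 * L + c * L2)) * (Y * Y)).
    - replace (n * (2 * (2 * L + c * L2)) * (Y * Y)) with (n * (2 * ((2 * L + c * L2) * (Y * Y)))) by ring.
      apply Rmult_le_compat_l; lra.
    - apply Rmult_le_compat_r; assumption. }
  assert (kap * (Y * Y) <= k s * (Y * Y)) by (apply Rmult_le_compat_r; assumption).
  assert (0 <= c * c * (X1 * X1 + X2 * X2)) by (apply Rmult_le_pos; nra).
  assert (0 <= kap / 2 * (c * c * (X1 * X1 + X2 * X2))) by (apply Rmult_le_pos; lra).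
  lra.
- intros s _. specialize (HM s). pose proof (Rabs_pos (y s)).
  assert (y s * y s = Rabs (y s) * Rabs (y s)) by (rewrite <- Rabs_mult; symmetry; apply Rabs_pos_eq; nra).
  assert (0 <= c * c * (v1 s * v1 s + v2 s * v2 s)) by (apply Rmult_le_pos; nra).
  nra.
Qed.

Ltac real_eq := match goal with |- ?x = ?y => change (@eq R x y) end.

Section Orbit.

Variables lam mu n a b A B P Q kap : R.
Hypotheses (Hlam : 0 < lam) (Hmu : 0 < mu <= 1) (Ha : 0 < a <= A) (Hb : 0 < b <= B).
Hypotheses (Hn : 0 < n < 1) (HP : 3 < lam * P) (HQ : 1 < Q) (Hkap : 0 < kap).
Hypothesis HK : kap <= mu * a / lam - Q.
Hypothesis Ha_eq : a = (2 - n + 2 * lam) / (1 + mu).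
Hypothesis Hb_eq : b = (1 - mu - n + (1 - mu) * lam) / (1 + mu).
Hypothesis Hm : mu + n <= 1.

Let wmax := w_max lam P kap.
Let gmax := g_max lam A P Q.
Let qspeed := q_speed lam A B P Q.

Definition speed_rate : R :=
  (gmax + P + P * (lam * A)) + (1 + 2 * Q + lam * P * A + (Q * lam + B) * A).
Definition speed_rate_w : R := P * (A * A / lam + lam * (P * (A * A))) + (Q * lam + B) * (P * (A * A)).
(** The smallest [c] with [4 * C1 <= kap * c] in [expanding_cone], for the forcing constant
    [C1 = wmax + lam]. *)
Definition w_speed_ratio : R := 4 * (wmax + lam) / kap.
Definition speed_rate' : R := speed_rate + speed_rate_w * w_speed_ratio.
Definition slope_rate : R :=
  (w_speed_ratio * qspeed + wmax * speed_rate' + lam * speed_rate') / kap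
  + (wmax + lam) * qspeed / (kap * kap).
Definition slope_ratio : R := 4 * (slope_rate + 1) / kap.
(** Bound for the total coefficient of the slaving error in [rate_q_nullcline_identity]. *)
Definition error_weight : R := (1 + lam * lam * P) * Q + 2 * (P * (lam * (B + lam * Q))).

(** [Hs1] and [Hs2] are the smallness conditions of [expanding_cone] for [w'] and for the slope
    error. [Hs3] lets [q'] absorb the slaving error. [Hs4] lets the main term of the derivative of
    [p'/p] at a zero outweigh both errors; its right-hand side is a lower bound of [r / lam]. *)
Hypothesis Hs1 : n * (2 * (2 * speed_rate + w_speed_ratio * speed_rate_w)) <= kap / 4.
Hypothesis Hs2 : n * (4 * speed_rate') <= kap / 4.
Hypothesis Hs3 : n * (A * w_speed_ratio * error_weight) <= mu.
Hypothesis Hs4 : n * (A * w_speed_ratio * qspeed + A / lam * (A * A * (/ lam + lam * P) * slope_ratio))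
  < / (wmax * lam).

Variables p q w : R -> R.
Let g s := growth_p lam a (p s) (q s) (w s).
Let v2 s := rate_q lam b (p s) (q s) (w s).
Let v1 s := p s * g s.
Let k s := mu * a / lam - q s.
Let wp s := (k s * w s - (mu / lam + lam * p s)) / n.
Hypothesis Hp : forall s, is_derive p s (v1 s).
Hypothesis Hq : forall s, is_derive q s (v2 s).
Hypothesis Hw : forall s, is_derive w s (wp s).
Hypothesis Hpr : forall s, 0 < p s < P.
Hypothesis Hqr : forall s, 0 < q s < Q.
Hypothesis Hwr : forall s, / a <= w s <= wmax.

Let u s := v1 s * / w s - p s * (wp s * (/ w s * / w s)).
Let dg s := - (wp s * (/ w s * / w s)) / lam - v2 s - lam * u s.
Let dv1 s := v1 s * g s + p s * dg s.
Let dv2 s := v2 s * (1 - q s - lam * p s * / w s) + q s * (- v2 s - lam * u s) + b * u s.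

Lemma orbit_w_pos (s : R) : 0 < w s.
Proof. assert (0 < / a) by (apply Rinv_0_lt_compat; lra). pose proof (Hwr s). lra. Qed.

Lemma orbit_r_range (s : R) : 0 < / w s <= A.
Proof. apply (inv_range a A Ha). apply Hwr. Qed.

Lemma orbit_k_range (s : R) : kap <= k s <= A / lam.
Proof.
pose proof (Hqr s). unfold k. split; [lra|].
assert (mu * a / lam <= A / lam); [|lra].
unfold Rdiv. apply Rmult_le_compat_r; [left; now apply Rinv_0_lt_compat|]. nra.
Qed.

Lemma orbit_P_pos : 0 < P.
Proof. pose proof (Hpr 0). lra. Qed.

Lemma wmax_pos : 0 < wmax.
Proof. pose proof (orbit_w_pos 0). pose proof (Hwr 0). lra. Qed.

Lemma is_derive_inv_w (s : R) : is_derive (fun s => / w s) s (- (wp s * (/ w s * / w s))).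
Proof.
pose proof (orbit_w_pos s).
replace (- (wp s * (/ w s * / w s))) with (- wp s / w s ^ 2) by (field; lra).
apply is_derive_inv; [apply Hw|lra].
Qed.

Lemma is_derive_pr (s : R) : is_derive (fun s => p s * / w s) s (u s).
Proof.
evar_last.
- apply (is_derive_mult p (fun s => / w s)); [apply Hp|apply is_derive_inv_w|intros; apply Rmult_comm].
- unfold plus, mult; simpl. unfold u. unfold mult; simpl. ring.
Qed.

Lemma is_derive_g (s : R) : is_derive g s (dg s).
Proof.
apply (is_derive_ext (fun s => 2 + (/ lam * (/ w s - a) - q s - lam * (p s * / w s)))).
- intros t. real_eq. unfold g, growth_p. field. pose proof (orbit_w_pos t). lra.
- evar_last.
  + apply (is_derive_plus (fun _ => 2) (fun s => / lam * (/ w s - a) - q s - lam * (p s * / w s)));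
      [apply @is_derive_const|].
    apply (is_derive_minus (fun s => / lam * (/ w s - a) - q s) (fun s => lam * (p s * / w s))).
    * apply (is_derive_minus (fun s => / lam * (/ w s - a)) q); [|apply Hq].
      apply (is_derive_scal (fun s => / w s - a)).
      apply (is_derive_minus (fun s => / w s) (fun _ => a)); [apply is_derive_inv_w|apply @is_derive_const].
    * apply (is_derive_scal (fun s => p s * / w s)), is_derive_pr.
  + unfold minus, plus, opp, zero; simpl. unfold dg. field. pose proof (orbit_w_pos s). lra.
Qed.

Lemma is_derive_v1 (s : R) : is_derive v1 s (dv1 s).
Proof.
apply (is_derive_mult p g); [apply Hp|apply is_derive_g|intros; apply Rmult_comm].
Qed.

Lemma is_derive_v2 (s : R) : is_derive v2 s (dv2 s).
Proof.
apply (is_derive_ext (fun s => q s * (1 - q s - lam * (p s * / w s)) + b * (p s * / w s))).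
- intros t. real_eq. unfold v2, rate_q. ring.
- evar_last.
  + apply (is_derive_plus (fun s => q s * (1 - q s - lam * (p s * / w s))) (fun s => b * (p s * / w s))).
    * apply (is_derive_mult q (fun s => 1 - q s - lam * (p s * / w s)));
        [apply Hq| |intros; apply Rmult_comm].
      apply (is_derive_minus (fun s => 1 - q s) (fun s => lam * (p s * / w s))).
      -- apply (is_derive_minus (fun _ => 1) q); [apply @is_derive_const|apply Hq].
      -- apply (is_derive_scal (fun s => p s * / w s)), is_derive_pr.
    * apply (is_derive_scal (fun s => p s * / w s)), is_derive_pr.
  + unfold minus, plus, opp, zero, mult; simpl; unfold mult; simpl. unfold dv2. ring.
Qed.

Lemma g_bound (s : R) : Rabs (g s) <= gmax.
Proof.
apply (growth_p_bound lam a A P Q Hlam Ha); try apply Hwr.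
- pose proof (Hpr s); lra.
- pose proof (Hqr s); lra.
Qed.

Lemma v1_bound (s : R) : Rabs (v1 s) <= P * gmax.
Proof. apply Rabs_mult_le; [|apply g_bound]. pose proof (Hpr s). rewrite Rabs_pos_eq; lra. Qed.

Lemma v2_bound (s : R) : Rabs (v2 s) <= qspeed.
Proof.
apply (rate_q_bound lam a b A B P Q Hlam Ha Hb); try apply Hwr; try lra.
- pose proof (Hpr s); lra.
- pose proof (Hqr s); lra.
Qed.

Lemma u_bound (s : R) : Rabs (u s) <= A * Rabs (v1 s) + P * (A * A) * Rabs (wp s).
Proof.
unfold u. pose proof (orbit_r_range s). pose proof (Hpr s).
replace (v1 s * / w s) with (/ w s * v1 s) by ring.
replace (p s * (wp s * (/ w s * / w s))) with (p s * (/ w s * / w s) * wp s) by ring.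
apply Rabs_minus_le; apply Rabs_mult_le; try apply Rle_refl.
- rewrite Rabs_pos_eq; lra.
- apply Rabs_mult_le; [rewrite Rabs_pos_eq; lra|]. apply Rabs_mult_le; rewrite Rabs_pos_eq; lra.
Qed.

Lemma dg_bound (s : R) :
  Rabs (dg s) <= A * A / lam * Rabs (wp s) + Rabs (v2 s)
    + lam * (A * Rabs (v1 s) + P * (A * A) * Rabs (wp s)).
Proof.
unfold dg. pose proof (orbit_r_range s).
apply Rabs_minus_le; [apply Rabs_minus_le|].
- replace (- (wp s * (/ w s * / w s)) / lam) with (- (/ w s * / w s / lam * wp s))
    by (field; pose proof (orbit_w_pos s); lra).
  rewrite Rabs_Ropp. apply Rabs_mult_le; [|apply Rle_refl].
  apply Rabs_div_le; [assumption|]. apply Rabs_mult_le; rewrite Rabs_pos_eq; lra.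
- apply Rle_refl.
- apply Rabs_mult_le; [rewrite Rabs_pos_eq; lra|apply u_bound].
Qed.

Lemma speed_constants :
  0 <= gmax /\ 0 <= qspeed /\ 0 <= speed_rate /\ 0 <= speed_rate_w /\ 0 < w_speed_ratio /\
  0 <= speed_rate' /\ 0 <= slope_rate /\ 0 < slope_ratio /\ 0 <= error_weight.
Proof.
pose proof orbit_P_pos as HP0. pose proof wmax_pos.
assert (G1 : 0 <= gmax) by (pose proof (g_bound 0); pose proof (Rabs_pos (g 0)); lra).
assert (G2 : 0 <= qspeed) by (pose proof (v2_bound 0); pose proof (Rabs_pos (v2 0)); lra).
assert (HA : 0 < A) by lra. assert (HB : 0 < B) by lra.
assert (0 < lam * A) by (apply Rmult_lt_0_compat; lra).
assert (0 < A * A) by (apply Rmult_lt_0_compat; lra).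
assert (0 < lam * P) by lra.
assert (0 < lam * P * A) by (apply Rmult_lt_0_compat; lra).
assert (0 < P * (lam * A)) by (apply Rmult_lt_0_compat; lra).
assert (0 < P * (A * A)) by (apply Rmult_lt_0_compat; lra).
assert (0 < Q * lam) by (apply Rmult_lt_0_compat; lra).
assert (0 < (Q * lam + B) * A) by (apply Rmult_lt_0_compat; lra).
assert (0 < (Q * lam + B) * (P * (A * A))) by (apply Rmult_lt_0_compat; lra).
assert (0 < lam * (P * (A * A))) by (apply Rmult_lt_0_compat; lra).
assert (0 < A * A / lam) by (apply Rdiv_lt_0_compat; lra).
assert (0 < P * (A * A / lam + lam * (P * (A * A)))) by (apply Rmult_lt_0_compat; lra).
assert (G3 : 0 <= speed_rate) by (unfold speed_rate; lra).
assert (G4 : 0 <= speed_rate_w) by (unfold speed_rate_w; lra).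
assert (G5 : 0 < w_speed_ratio) by (apply Rdiv_lt_0_compat; lra).
assert (G6 : 0 <= speed_rate').
{ unfold speed_rate'. assert (0 <= speed_rate_w * w_speed_ratio) by (apply Rmult_le_pos; lra). lra. }
assert (G7 : 0 <= slope_rate).
{ unfold slope_rate. assert (0 <= w_speed_ratio * qspeed) by (apply Rmult_le_pos; lra).
  assert (0 <= wmax * speed_rate') by (apply Rmult_le_pos; lra).
  assert (0 <= lam * speed_rate') by (apply Rmult_le_pos; lra).
  apply Rplus_le_le_0_compat; apply Rdiv_le_0_compat; try lra.
  - apply Rmult_le_pos; lra.
  - apply Rmult_lt_0_compat; lra. }
repeat split; trivial.
- unfold slope_ratio. apply Rdiv_lt_0_compat; lra.
- unfold error_weight.
  assert (0 < lam * Q) by (apply Rmult_lt_0_compat; lra).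
  assert (0 < lam * (B + lam * Q)) by (apply Rmult_lt_0_compat; lra).
  assert (0 < P * (lam * (B + lam * Q))) by (apply Rmult_lt_0_compat; lra).
  assert (0 < lam * lam * P) by (repeat apply Rmult_lt_0_compat; lra).
  assert (0 < (1 + lam * lam * P) * Q) by (apply Rmult_lt_0_compat; lra). lra.
Qed.

Lemma dv_bounds (s : R) :
  Rabs (dv1 s) <= speed_rate * (Rabs (v1 s) + Rabs (v2 s)) + speed_rate_w * Rabs (wp s) /\
  Rabs (dv2 s) <= speed_rate * (Rabs (v1 s) + Rabs (v2 s)) + speed_rate_w * Rabs (wp s).
Proof.
destruct speed_constants as [G1 [G2 [G3 [G4 _]]]].
pose proof orbit_P_pos as HP0.
pose proof (Rabs_pos (v1 s)) as N1. pose proof (Rabs_pos (v2 s)) as N2. pose proof (Rabs_pos (wp s)) as N3.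
pose proof (orbit_r_range s) as Hr. pose proof (Hpr s) as Hps. pose proof (Hqr s) as Hqs.
assert (HA : 0 < A) by lra. assert (HB : 0 < B) by lra.
assert (K1 : 0 < lam * A) by (apply Rmult_lt_0_compat; lra).
assert (K2 : 0 < A * A) by (apply Rmult_lt_0_compat; lra).
assert (K3 : 0 < lam * P * A) by (apply Rmult_lt_0_compat; lra).
assert (K4 : 0 < P * (lam * A)) by (apply Rmult_lt_0_compat; lra).
assert (K5 : 0 < P * (A * A)) by (apply Rmult_lt_0_compat; lra).
assert (K6 : 0 < Q * lam) by (apply Rmult_lt_0_compat; lra).
assert (K7 : 0 < (Q * lam + B) * A) by (apply Rmult_lt_0_compat; lra).
assert (K8 : 0 < (Q * lam + B) * (P * (A * A))) by (apply Rmult_lt_0_compat; lra).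
assert (K9 : 0 < lam * (P * (A * A))) by (apply Rmult_lt_0_compat; lra).
assert (K10 : 0 < A * A / lam) by (apply Rdiv_lt_0_compat; lra).
assert (K11 : 0 < P * (A * A / lam + lam * (P * (A * A)))) by (apply Rmult_lt_0_compat; lra).
split.
- apply Rle_trans with (gmax * Rabs (v1 s) + P * (A * A / lam * Rabs (wp s) + Rabs (v2 s)
    + lam * (A * Rabs (v1 s) + P * (A * A) * Rabs (wp s)))).
  + unfold dv1. rewrite (Rmult_comm (v1 s)). apply Rabs_plus_le; apply Rabs_mult_le.
    * apply g_bound.
    * apply Rle_refl.
    * rewrite Rabs_pos_eq; lra.
    * apply dg_bound.
  + replace (gmax * Rabs (v1 s) + P * (A * A / lam * Rabs (wp s) + Rabs (v2 s)
      + lam * (A * Rabs (v1 s) + P * (A * A) * Rabs (wp s))))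
    with ((gmax + P * (lam * A)) * Rabs (v1 s) + P * Rabs (v2 s)
       + P * (A * A / lam + lam * (P * (A * A))) * Rabs (wp s)) by ring.
    rewrite (Rmult_plus_distr_l speed_rate). apply Rplus_le_compat; [apply Rplus_le_compat|];
    apply Rmult_le_compat_r; trivial; unfold speed_rate, speed_rate_w; lra.
- apply Rle_trans with (Rabs (v2 s) * (1 + Q + lam * P * A)
    + Q * (Rabs (v2 s) + lam * (A * Rabs (v1 s) + P * (A * A) * Rabs (wp s)))
    + B * (A * Rabs (v1 s) + P * (A * A) * Rabs (wp s))).
  + unfold dv2. apply Rabs_plus_le; [apply Rabs_plus_le|]; apply Rabs_mult_le; try apply Rle_refl.
    * apply Rabs_minus_le; [apply Rabs_minus_le|]; try (rewrite Rabs_pos_eq; lra).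
      apply Rabs_mult_le; [apply Rabs_mult_le|]; rewrite Rabs_pos_eq; lra.
    * rewrite Rabs_pos_eq; lra.
    * apply Rabs_minus_le; [rewrite Rabs_Ropp; apply Rle_refl|].
      apply Rabs_mult_le; [rewrite Rabs_pos_eq; lra|apply u_bound].
    * rewrite Rabs_pos_eq; lra.
    * apply u_bound.
  + replace (Rabs (v2 s) * (1 + Q + lam * P * A)
    + Q * (Rabs (v2 s) + lam * (A * Rabs (v1 s) + P * (A * A) * Rabs (wp s)))
    + B * (A * Rabs (v1 s) + P * (A * A) * Rabs (wp s)))
    with ((Q * lam + B) * A * Rabs (v1 s) + (1 + 2 * Q + lam * P * A) * Rabs (v2 s)
       + (Q * lam + B) * (P * (A * A)) * Rabs (wp s)) by ring.
    rewrite (Rmult_plus_distr_l speed_rate). apply Rplus_le_compat; [apply Rplus_le_compat|];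
    apply Rmult_le_compat_r; trivial; unfold speed_rate, speed_rate_w; lra.
Qed.

Lemma is_derive_wp (s : R) :
  is_derive wp s ((k s * wp s - (w s * v2 s + lam * v1 s)) / n).
Proof.
apply (is_derive_ext (fun s => / n * ((mu * a / lam - q s) * w s - (mu / lam + lam * p s)))).
- intros t. real_eq. unfold wp, k. field. lra.
- evar_last.
  + apply (is_derive_scal (fun s => (mu * a / lam - q s) * w s - (mu / lam + lam * p s))).
    apply (is_derive_minus (fun s => (mu * a / lam - q s) * w s) (fun s => mu / lam + lam * p s)).
    * apply (is_derive_mult (fun s => mu * a / lam - q s) w); [|apply Hw|intros; apply Rmult_comm].
      apply (is_derive_minus (fun _ => mu * a / lam) q); [apply @is_derive_const|apply Hq].
    * apply (is_derive_plus (fun _ => mu / lam) (fun s => lam * p s)); [apply @is_derive_const|].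
      apply (is_derive_scal p), Hp.
  + unfold minus, plus, opp, zero, mult; simpl; unfold mult; simpl. unfold k. field. lra.
Qed.

(** Differentiating the equation of [w], one finds that [w'] is repelled at the same rate with
    forcing [w q' + lam p'], linear in the speed. The a priori bound on [w'] is of order [1 / n],
    which is harmless as only boundedness matters. *)
Lemma wp_le_speed (s : R) : Rabs (wp s) <= w_speed_ratio * (Rabs (v1 s) + Rabs (v2 s)).
Proof.
destruct speed_constants as [G1 [G2 [G3 [G4 [G5 _]]]]]. pose proof wmax_pos. pose proof orbit_P_pos.
apply (expanding_cone wp k (fun s => w s * v2 s + lam * v1 s) v1 v2 dv1 dv2 n kap (wmax + lam)
  speed_rate speed_rate_w w_speed_ratio ((A / lam * wmax + (/ lam + lam * P)) / n)); trivial; try lra.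
- apply is_derive_wp.
- apply is_derive_v1.
- apply is_derive_v2.
- intros t. apply orbit_k_range.
- intros t. pose proof (orbit_w_pos t). pose proof (Hwr t).
  pose proof (Rabs_pos (v1 t)). pose proof (Rabs_pos (v2 t)).
  apply Rle_trans with (wmax * Rabs (v2 t) + lam * Rabs (v1 t)).
  + apply Rabs_plus_le; apply Rabs_mult_le; try apply Rle_refl; rewrite Rabs_pos_eq; lra.
  + nra.
- intros t. apply dv_bounds.
- intros t. apply dv_bounds.
- intros t. pose proof (orbit_k_range t). pose proof (orbit_w_pos t). pose proof (Hwr t). pose proof (Hpr t).
  apply Rabs_div_le; [lra|]. apply Rabs_minus_le; [apply Rabs_mult_le; rewrite Rabs_pos_eq; lra|].
  assert (0 < / lam) by now apply Rinv_0_lt_compat.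
  apply Rabs_plus_le.
  + unfold Rdiv. rewrite Rabs_pos_eq; nra.
  + apply Rabs_mult_le; rewrite Rabs_pos_eq; lra.
- unfold w_speed_ratio. right. field. lra.
Qed.

(** [zeta] is the derivative of [(w * v2 + lam * v1) / k], and [z] satisfies [n z' = k z - n zeta].
    The factor [n] in this forcing makes the cone constant for [z] of order [n]. *)
Let z s := wp s - (w s * v2 s + lam * v1 s) / k s.
Let zeta s := (wp s * v2 s + w s * dv2 s + lam * dv1 s) / k s
              + (w s * v2 s + lam * v1 s) * v2 s / (k s * k s).

Lemma dv_bounds' (s : R) :
  Rabs (dv1 s) <= speed_rate' * (Rabs (v1 s) + Rabs (v2 s)) /\
  Rabs (dv2 s) <= speed_rate' * (Rabs (v1 s) + Rabs (v2 s)).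
Proof.
destruct speed_constants as [G1 [G2 [G3 [G4 _]]]].
pose proof (wp_le_speed s). destruct (dv_bounds s).
assert (speed_rate_w * Rabs (wp s) <= speed_rate_w * (w_speed_ratio * (Rabs (v1 s) + Rabs (v2 s))))
  by (apply Rmult_le_compat_l; assumption).
unfold speed_rate'. lra.
Qed.

Lemma zeta_bound (s : R) : Rabs (zeta s) <= slope_rate * (Rabs (v1 s) + Rabs (v2 s)).
Proof.
destruct speed_constants as [G1 [G2 [G3 [G4 [G5 [G6 _]]]]]]. pose proof wmax_pos.
pose proof (wp_le_speed s) as W. destruct (dv_bounds' s) as [D1 D2].
pose proof (Rabs_pos (v1 s)) as N1. pose proof (Rabs_pos (v2 s)) as N2.
pose proof (orbit_k_range s) as Hk. pose proof (orbit_w_pos s). pose proof (Hwr s).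
pose proof (v2_bound s) as V2.
set (V := Rabs (v1 s) + Rabs (v2 s)) in *.
assert (HV : 0 <= V) by (unfold V; lra).
assert (Hik : 0 < / k s <= / kap) by (split; [apply Rinv_0_lt_compat; lra|apply Rinv_le_contravar; lra]).
unfold zeta.
replace ((wp s * v2 s + w s * dv2 s + lam * dv1 s) / k s + (w s * v2 s + lam * v1 s) * v2 s / (k s * k s))
  with ((wp s * v2 s + w s * dv2 s + lam * dv1 s) * / k s
        + (w s * v2 s + lam * v1 s) * v2 s * (/ k s * / k s)) by (field; lra).
apply Rle_trans with ((w_speed_ratio * V * qspeed + wmax * (speed_rate' * V) + lam * (speed_rate' * V)) * / kap
  + ((wmax + lam) * V) * qspeed * (/ kap * / kap)).
- apply Rabs_plus_le; apply Rabs_mult_le.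
  + apply Rabs_plus_le; [apply Rabs_plus_le|]; apply Rabs_mult_le; trivial; rewrite Rabs_pos_eq; lra.
  + rewrite Rabs_pos_eq; lra.
  + apply Rabs_mult_le; trivial.
    apply Rle_trans with (wmax * Rabs (v2 s) + lam * Rabs (v1 s)).
    * apply Rabs_plus_le; apply Rabs_mult_le; try apply Rle_refl; rewrite Rabs_pos_eq; lra.
    * unfold V. nra.
  + apply Rabs_mult_le; rewrite Rabs_pos_eq; lra.
- right. unfold slope_rate. field. lra.
Qed.

(* Slope of the slow manifold: [w'] agrees with the derivative of [(mu/lam + lam p)/(K - q)] up to [O(n)]. *)
Lemma w_slope_error (s : R) : Rabs (z s) <= n * slope_ratio * (Rabs (v1 s) + Rabs (v2 s)).
Proof.
destruct speed_constants as [G1 [G2 [G3 [G4 [G5 [G6 [G7 [G8 _]]]]]]]]. pose proof wmax_pos.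
pose proof orbit_P_pos as HP0.
assert (N0 : 0 < n * slope_ratio) by (apply Rmult_lt_0_compat; lra).
apply (expanding_cone z k (fun s => n * zeta s) v1 v2 dv1 dv2 n kap (n * slope_rate) speed_rate' 0
  (n * slope_ratio) (w_speed_ratio * (P * gmax + qspeed) + (wmax * qspeed + lam * (P * gmax)) * / kap));
  trivial; try lra.
- apply Rmult_le_pos; lra.
- intros t. pose proof (orbit_k_range t). evar_last.
  + apply (is_derive_minus wp (fun s => (w s * v2 s + lam * v1 s) / k s)); [apply is_derive_wp|].
    apply (is_derive_div (fun s => w s * v2 s + lam * v1 s) k t (wp t * v2 t + w t * dv2 t + lam * dv1 t) (- v2 t)).
    * apply (is_derive_plus (fun s => w s * v2 s) (fun s => lam * v1 s)).
      -- apply (is_derive_mult w v2); [apply Hw|apply is_derive_v2|intros; apply Rmult_comm].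
      -- apply (is_derive_scal v1), is_derive_v1.
    * evar_last.
      -- apply (is_derive_minus (fun _ => mu * a / lam) q); [apply @is_derive_const|apply Hq].
      -- unfold minus, plus, opp, zero; simpl. ring.
    * lra.
  + unfold minus, plus, opp, zero; simpl. unfold z, zeta. field. lra.
- apply is_derive_v1.
- apply is_derive_v2.
- intros t. apply orbit_k_range.
- intros t. rewrite Rabs_mult, (Rabs_pos_eq n), Rmult_assoc by lra.
  apply Rmult_le_compat_l; [lra|apply zeta_bound].
- intros t. rewrite Rmult_0_l, Rplus_0_r. apply dv_bounds'.
- intros t. rewrite Rmult_0_l, Rplus_0_r. apply dv_bounds'.
- intros t. pose proof (orbit_k_range t). pose proof (orbit_w_pos t). pose proof (Hwr t).
  pose proof (wp_le_speed t). pose proof (v1_bound t). pose proof (v2_bound t).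
  unfold z. apply Rabs_minus_le.
  + eapply Rle_trans; [eassumption|]. apply Rmult_le_compat_l; lra.
  + unfold Rdiv. apply Rabs_mult_le.
    * apply Rabs_plus_le; apply Rabs_mult_le; trivial; rewrite Rabs_pos_eq; lra.
    * rewrite Rabs_pos_eq; [apply Rinv_le_contravar; lra|left; apply Rinv_0_lt_compat; lra].
- unfold slope_ratio. replace (kap * (n * (4 * (slope_rate + 1) / kap))) with (4 * (n * slope_rate) + 4 * n) by (field; lra).
  lra.
Qed.

(** * Lower bound for [q'] and the sign of [p'] *)

Lemma error_eq (s : R) : slaving_error lam mu a (p s) (q s) (w s) = n * (wp s * / w s).
Proof. unfold slaving_error, wp, k. field. pose proof (orbit_w_pos s). lra. Qed.

Lemma error_le_speed (s : R) :
  Rabs (slaving_error lam mu a (p s) (q s) (w s)) <= n * (A * w_speed_ratio * (Rabs (v1 s) + Rabs (v2 s))).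
Proof.
rewrite error_eq. rewrite Rabs_mult, (Rabs_pos_eq n) by lra. apply Rmult_le_compat_l; [lra|].
rewrite (Rmult_comm (wp s)), Rmult_assoc. pose proof (orbit_r_range s).
apply Rabs_mult_le; [rewrite Rabs_pos_eq; lra|apply wp_le_speed].
Qed.

Definition growth_weight : R := (1 + lam * lam * P) * Q + P.
Definition rate_divisor : R := 2 * (1 + lam * lam * P) + 1.

(** In the nullcline identity the [q] term is nonnegative because [mu + n <= 1]. By [Hs3] the
    slaving error contributes at most [mu |v2|] plus a multiple of [|g|]; as [v2] itself carries a
    coefficient at least [mu], the former can be absorbed. *)
Lemma v2_lower (s : R) :
  0 < p s * (mu * a * b) - growth_weight * Rabs (g s) ->
  p s * (mu * a * b) - growth_weight * Rabs (g s) <= rate_divisor * v2 s.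
Proof.
intros Hpos.
destruct speed_constants as [G1 [G2 [G3 [G4 [G5 [G6 [G7 [G8 G9]]]]]]]]. pose proof orbit_P_pos as HP0.
pose proof (error_le_speed s) as He. pose proof (orbit_w_pos s) as Hw0.
pose proof (rate_q_nullcline_identity lam mu n a b (p s) (q s) (w s) Hlam (proj1 Hmu) Hw0 Ha_eq Hb_eq) as I.
fold (v2 s) in I. fold (g s) in I.
set (e := slaving_error lam mu a (p s) (q s) (w s)) in *.
pose proof (Hpr s) as Hps. pose proof (Hqr s) as Hqs.
pose proof (Rabs_pos (g s)) as N1. pose proof (Rabs_pos (v2 s)) as N2. pose proof (Rabs_pos e) as N3.
assert (Ell : 0 < lam * lam) by (apply Rmult_lt_0_compat; lra).
assert (Elp : 0 < lam * lam * p s <= lam * lam * P) by (split; [apply Rmult_lt_0_compat|apply Rmult_le_compat_l]; lra).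
assert (0 < lam * Q) by (apply Rmult_lt_0_compat; lra).
assert (0 < lam * q s <= lam * Q) by (split; [apply Rmult_lt_0_compat|apply Rmult_le_compat_l]; lra).
assert (Hv1 : Rabs (v1 s) <= P * Rabs (g s)).
{ apply Rabs_mult_le; [rewrite Rabs_pos_eq; lra|apply Rle_refl]. }
assert (He' : Rabs e * error_weight <= mu * (P * Rabs (g s) + Rabs (v2 s))).
{ apply Rle_trans with (n * (A * w_speed_ratio * (Rabs (v1 s) + Rabs (v2 s))) * error_weight).
  - apply Rmult_le_compat_r; assumption.
  - replace (n * (A * w_speed_ratio * (Rabs (v1 s) + Rabs (v2 s))) * error_weight)
      with (n * (A * w_speed_ratio * error_weight) * (Rabs (v1 s) + Rabs (v2 s))) by ring.
    pose proof (Rabs_pos (v1 s)). apply Rmult_le_compat; try lra.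
    apply Rmult_le_pos; [lra|]. apply Rmult_le_pos; [apply Rmult_le_pos|]; lra. }
assert (T1 : Rabs ((e * (1 - lam * lam * p s) + (mu + lam * lam * p s) * g s) * ((1 - n) * q s))
   <= (Rabs e * (1 + lam * lam * P) + (1 + lam * lam * P) * Rabs (g s)) * (1 * Q)).
{ apply Rabs_mult_le; [apply Rabs_plus_le; apply Rabs_mult_le; try apply Rle_refl|apply Rabs_mult_le].
  - apply Rabs_le; lra.
  - rewrite Rabs_pos_eq; lra.
  - rewrite Rabs_pos_eq; lra.
  - rewrite Rabs_pos_eq; lra. }
assert (T2 : Rabs ((2 - n) * (p s * (lam * e * (b - lam * q s)))) <= 2 * (P * (lam * Rabs e * (B + lam * Q)))).
{ apply Rabs_mult_le; [rewrite Rabs_pos_eq; lra|]. apply Rabs_mult_le; [rewrite Rabs_pos_eq; lra|].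
  apply Rabs_mult_le; [apply Rabs_mult_le; [rewrite Rabs_pos_eq; lra|apply Rle_refl]|].
  apply Rabs_le; lra. }
assert (T3 : 0 <= q s * ((1 - mu - n) * q s + n * mu)).
{ apply Rmult_le_pos; [lra|]. apply Rplus_le_le_0_compat; apply Rmult_le_pos; lra. }
assert (T4 : p s * (mu * a * b) <= (2 - n) * (p s * (mu * a * b))).
{ assert (0 <= p s * (mu * a * b)) by (repeat apply Rmult_le_pos; lra). nra. }
assert (Main : p s * (mu * a * b) - growth_weight * Rabs (g s)
   <= (2 - n) * ((mu + lam * lam * p s) * v2 s) + mu * Rabs (v2 s)).
{ rewrite I. apply Rabs_le_between in T1. apply Rabs_le_between in T2.
  unfold error_weight in He'. unfold growth_weight.
  assert (mu * (P * Rabs (g s)) <= 1 * (P * Rabs (g s))) by (apply Rmult_le_compat_r; [apply Rmult_le_pos|]; lra).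
  lra. }
(* The sign comes first: if [v2] were nonpositive, its coefficient would outweigh the error
   [mu * Rabs (v2 s)] and the right-hand side of [Main] could not be positive. *)
assert (Hv2 : 0 < v2 s).
{ destruct (Rlt_le_dec 0 (v2 s)) as [|Hneg]; [assumption|exfalso].
  rewrite (Rabs_left1 (v2 s)) in Main by assumption.
  assert ((2 - n) * ((mu + lam * lam * p s) * v2 s) <= mu * v2 s); [|lra].
  assert (1 * mu <= (2 - n) * (mu + lam * lam * p s)) by (apply Rmult_le_compat; lra). nra. }
rewrite (Rabs_pos_eq (v2 s)) in Main by lra.
eapply Rle_trans; [exact Main|]. unfold rate_divisor.
assert ((2 - n) * (mu + lam * lam * p s) <= 2 * (1 + lam * lam * P)) by (apply Rmult_le_compat; lra).
nra.
Qed.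

(** Where [p' = 0], substitute [w' = z + w q'/k] and [k = (mu/lam + lam p) r + e]. The terms in
    [lam p] cancel and leave [k g' = - q' (r (1 + mu) / lam + e)] up to a multiple of [z], which is
    itself [O(n q')]. So [q'] factors out of main term and errors alike. *)
Lemma growth_crosses_down (s : R) : g s = 0 -> dg s < 0.
Proof.
intros Hg.
destruct speed_constants as [G1 [G2 [G3 [G4 [G5 [G6 [G7 [G8 G9]]]]]]]]. pose proof orbit_P_pos as HP0.
pose proof wmax_pos as Hwm.
assert (Hv1 : v1 s = 0) by (unfold v1; rewrite Hg; ring).
assert (Hpab : 0 < p s * (mu * a * b)).
{ pose proof (Hpr s). repeat apply Rmult_lt_0_compat; lra. }
pose proof (v2_lower s) as L. rewrite Hg, Rabs_R0, Rmult_0_r, Rminus_0_r in L. specialize (L Hpab).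
assert (Hrd : 0 < rate_divisor).
{ assert (0 < lam * lam * P) by (repeat apply Rmult_lt_0_compat; lra). unfold rate_divisor; lra. }
assert (Hv2 : 0 < v2 s) by nra.
pose proof (w_slope_error s) as Hz. pose proof (error_le_speed s) as He.
rewrite Hv1, Rabs_R0, Rplus_0_l, (Rabs_pos_eq (v2 s)) in Hz, He by lra.
pose proof (v2_bound s) as V2. rewrite Rabs_pos_eq in V2 by lra.
pose proof (orbit_k_range s) as Hk. pose proof (orbit_r_range s) as Hr. pose proof (orbit_w_pos s) as Hw0.
set (e := slaving_error lam mu a (p s) (q s) (w s)) in *.
assert (E : k s * dg s = - (v2 s * (/ w s * (1 + mu) / lam + e))
   - k s * (/ w s * / w s * (/ lam - lam * p s)) * z s).
{ assert (Hwp : wp s = z s + w s * v2 s / k s) by (unfold z; rewrite Hv1; field; lra).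
  unfold dg, u, e, slaving_error. rewrite Hv1, Hwp. fold (k s).
  clear - Hw0 Hlam Hk Hkap. assert (k s <> 0) by lra.
  generalize dependent (k s). generalize (z s) (v2 s). intros. field. lra. }
assert (Hil : 0 < / lam) by now apply Rinv_0_lt_compat.
assert (Hilp : Rabs (/ lam - lam * p s) <= / lam + lam * P).
{ pose proof (Hpr s). apply Rabs_minus_le; [rewrite Rabs_pos_eq; lra|].
  apply Rabs_mult_le; rewrite Rabs_pos_eq; lra. }
assert (HT : Rabs (k s * (/ w s * / w s * (/ lam - lam * p s)) * z s)
   <= A / lam * (A * A * (/ lam + lam * P)) * (n * slope_ratio * v2 s)).
{ apply Rabs_mult_le; [|assumption]. apply Rabs_mult_le; [rewrite Rabs_pos_eq; lra|].
  apply Rabs_mult_le; [|assumption]. apply Rabs_mult_le; rewrite Rabs_pos_eq; lra. }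
assert (He2 : Rabs e <= n * (A * w_speed_ratio * qspeed)).
{ eapply Rle_trans; [exact He|]. apply Rmult_le_compat_l; [lra|]. apply Rmult_le_compat_l; [|assumption].
  apply Rmult_le_pos; lra. }
assert (Hr1 : / (wmax * lam) <= / w s * (1 + mu) / lam).
{ rewrite Rinv_mult. unfold Rdiv.
  apply Rmult_le_compat; [left; now apply Rinv_0_lt_compat|lra| |lra].
  assert (/ wmax <= / w s) by (apply Rinv_le_contravar; [assumption|apply Hwr]).
  assert (/ w s * 1 <= / w s * (1 + mu)) by (apply Rmult_le_compat_l; lra). lra. }
assert (k s * dg s < 0).
{ rewrite E. apply Rabs_le_between in HT. apply Rabs_le_between in He2.
  assert (HH : 0 < v2 s * (/ w s * (1 + mu) / lam + e
    - n * (A / lam * (A * A * (/ lam + lam * P) * slope_ratio)))).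
  { apply Rmult_lt_0_compat; lra. }
  lra. }
nra.
Qed.

Lemma is_derive_ln_p (s : R) : is_derive (fun s => ln (p s)) s (g s).
Proof.
pose proof (Hpr s). replace (g s) with (v1 s * / p s) by (unfold v1; field; lra).
evar_last.
- apply (is_derive_comp ln p); [apply is_derive_ln; lra|apply Hp].
- reflexivity.
Qed.

(* [p'/p] is integrable when it keeps a sign and [p] is bounded away from 0, yet [q'] is bounded below
   wherever [p'/p] is small. *)
Lemma no_plateau (s1 d sg : R) :
  0 < d -> (forall s, s1 <= s -> d <= p s) -> sg = 1 \/ sg = -1 ->
  (forall s, s1 <= s -> 0 <= sg * g s) -> False.
Proof.
intros Hd0 Hdp Hsg Hg.
destruct speed_constants as [G1 [G2 _]]. pose proof orbit_P_pos as HP0.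
assert (Hllp : 0 < lam * lam * P) by (repeat apply Rmult_lt_0_compat; lra).
assert (Hgw : 0 < growth_weight).
{ unfold growth_weight. assert (0 < (1 + lam * lam * P) * Q) by (apply Rmult_lt_0_compat; lra). lra. }
assert (Hrd : 0 < rate_divisor) by (unfold rate_divisor; lra).
assert (Hmab : 0 < mu * a * b) by (repeat apply Rmult_lt_0_compat; lra).
set (c0 := d * (mu * a * b)). assert (Hc0 : 0 < c0) by (apply Rmult_lt_0_compat; lra).
(* Where [|g| <= eta], [v2_lower] gives [v2 >= c]; elsewhere [C * |g|] makes up for
   [v2 >= - qspeed]. So [q + C * sg * ln p] grows at rate at least [c] although it is bounded, and
   the time [T] is too long for that. *)
set (c := c0 / (2 * rate_divisor)). assert (Hc : 0 < c) by (apply Rdiv_lt_0_compat; lra).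
set (eta := c0 / (2 * growth_weight)). assert (Heta : 0 < eta) by (apply Rdiv_lt_0_compat; lra).
set (C := (c + qspeed) / eta). assert (HC : 0 < C) by (apply Rdiv_lt_0_compat; lra).
assert (Habs : forall s, s1 <= s -> Rabs (g s) = sg * g s).
{ intros s Hs. specialize (Hg s Hs). destruct Hsg as [-> | ->].
  - rewrite Rabs_pos_eq; lra.
  - rewrite Rabs_left1; lra. }
assert (Hv : forall s, s1 <= s -> 0 <= v2 s + C * (sg * g s) - c).
{ intros s Hs. rewrite <- (Habs s Hs). pose proof (Rabs_pos (g s)).
  destruct (Rle_lt_dec (Rabs (g s)) eta) as [H1|H1].
  - assert (growth_weight * Rabs (g s) <= c0 / 2).
    { replace (c0 / 2) with (growth_weight * eta) by (unfold eta; field; lra).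
      apply Rmult_le_compat_l; lra. }
    assert (c0 <= p s * (mu * a * b)) by (apply Rmult_le_compat_r; [lra|apply Hdp, Hs]).
    pose proof (v2_lower s ltac:(lra)).
    assert (rate_divisor * c = c0 / 2) by (unfold c; field; lra).
    assert (c <= v2 s) by (apply Rmult_le_reg_l with rate_divisor; lra).
    assert (0 <= C * Rabs (g s)) by (apply Rmult_le_pos; lra). lra.
  - pose proof (v2_bound s) as V. apply Rabs_le_between in V.
    assert (C * eta = c + qspeed) by (unfold C; field; lra).
    assert (C * eta <= C * Rabs (g s)) by (apply Rmult_le_compat_l; lra). lra. }
set (T := (Q + C * (ln P - ln d) + 1) / c).
assert (Hln : forall s, s1 <= s -> ln d <= ln (p s) <= ln P).
{ intros s Hs. specialize (Hdp s Hs). pose proof (Hpr s). split; apply ln_le; lra. }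
assert (Hlnd : ln d <= ln P) by (specialize (Hln s1 ltac:(lra)); lra).
assert (HCl : 0 <= C * (ln P - ln d)) by (apply Rmult_le_pos; lra).
assert (HT : 0 < T) by (apply Rdiv_lt_0_compat; lra).
assert (Hmono : q s1 + C * sg * ln (p s1) - c * s1 <= q (s1 + T) + C * sg * ln (p (s1 + T)) - c * (s1 + T)).
{ apply (derive_nonneg_le (fun s => q s + C * sg * ln (p s) - c * s) (fun s => v2 s + C * sg * g s - c)).
  - lra.
  - intros s _. apply (is_derive_minus (fun s => q s + C * sg * ln (p s)) (fun s => c * s)).
    + apply (is_derive_plus q (fun s => C * sg * ln (p s))); [apply Hq|].
      apply (is_derive_scal (fun s => ln (p s))), is_derive_ln_p.
    + auto_derive; [trivial|ring].
  - intros s Hs. specialize (Hv s ltac:(lra)). rewrite Rmult_assoc. exact Hv. }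
assert (HcT : c * T = Q + C * (ln P - ln d) + 1) by (unfold T; field; lra).
pose proof (Hln s1 ltac:(lra)). pose proof (Hln (s1 + T) ltac:(lra)).
assert (sg * (ln (p (s1 + T)) - ln (p s1)) <= ln P - ln d) by (destruct Hsg as [-> | ->]; lra).
assert (C * (sg * (ln (p (s1 + T)) - ln (p s1))) <= C * (ln P - ln d)) by (apply Rmult_le_compat_l; lra).
pose proof (Hqr s1). pose proof (Hqr (s1 + T)). lra.
Qed.

(** Once negative, [g] stays negative since it can only cross zero downwards. If it were never
    negative, [p] would be at least [p 0] on the right half-line, against [no_plateau]. *)
Lemma growth_eventually_negative : exists s1, forall s, s1 <= s -> g s < 0.
Proof.
destruct (classic (exists s1, g s1 < 0)) as [[s1 H1]|H1].
- exists s1. intros s Hs.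
  assert (0 < - g s); [|lra].
  apply (stay_pos (fun s => - g s) (fun s => - dg s) s1); trivial.
  + intros t _. apply (is_derive_opp g), is_derive_g.
  + lra.
  + intros t _ Ht. pose proof (growth_crosses_down t). lra.
- exfalso.
  assert (Hg : forall s, 0 <= g s).
  { intros s. destruct (Rle_lt_dec 0 (g s)); [assumption|]. exfalso; apply H1; now exists s. }
  apply (no_plateau 0 (p 0) 1).
  + apply Hpr.
  + intros s Hs. apply (derive_nonneg_le p v1); trivial.
    intros t _. apply Rmult_le_pos; [left; apply Hpr|apply Hg].
  + now left.
  + intros s _. rewrite Rmult_1_l. apply Hg.
Qed.

Lemma p_vanishes (eps : R) : 0 < eps -> exists T, forall s, T <= s -> p s < eps.
Proof.
intros He. destruct growth_eventually_negative as [s1 H1].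
destruct (classic (exists T, s1 <= T /\ p T < eps)) as [[T [HT HpT]]|Hno].
- exists T. intros s Hs. apply Rle_lt_trans with (p T); [|assumption].
  assert (- p T <= - p s); [|lra].
  apply (derive_nonneg_le (fun s => - p s) (fun s => - v1 s)); trivial.
  + intros t _. apply (is_derive_opp p), Hp.
  + intros t Ht. specialize (H1 t ltac:(lra)). pose proof (Hpr t). unfold v1. nra.
- exfalso. apply (no_plateau s1 eps (-1)); trivial.
  + intros s Hs. destruct (Rle_lt_dec eps (p s)); [assumption|]. exfalso; apply Hno; now exists s.
  + now right.
  + intros s Hs. specialize (H1 s Hs). lra.
Qed.

(** * Limits at plus infinity *)

Lemma forcing_vanishes (c eps : R) : 0 <= c -> 0 < eps ->
  exists T, forall s, T <= s -> c * p s < eps.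
Proof.
intros Hc He. destruct (p_vanishes (eps / (c + 1))) as [T HT]; [apply Rdiv_lt_0_compat; lra|].
exists T. intros s Hs. specialize (HT s Hs). pose proof (Hpr s).
assert (eps / (c + 1) * (c + 1) = eps) by (field; lra). nra.
Qed.

(** Once [p] is small, the logistic term pushes [q] up from any level at most [1 / 4]. The lower
    bound serves as decay rate in the convergence of [q] to 1. *)
Lemma q_bounded_below : exists T q0, 0 < q0 /\ forall s, T <= s -> q0 < q s.
Proof.
destruct (forcing_vanishes (lam * A) (1 / 4)) as [T HT]; [apply Rmult_le_pos; lra|lra|].
set (q0 := Rmin (q T) (1 / 2) / 2).
assert (Hq0 : 0 < Rmin (q T) (1 / 2)) by (apply Rmin_glb_lt; [apply Hqr|lra]).
pose proof (Rmin_l (q T) (1 / 2)). pose proof (Rmin_r (q T) (1 / 2)).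
exists T, q0. split; [unfold q0; lra|].
intros s Hs. assert (0 < q s - q0); [|lra].
apply (stay_pos (fun s => q s - q0) (fun s => v2 s) T); trivial.
- intros t _. evar_last.
  + apply (is_derive_minus q (fun _ => q0)); [apply Hq|apply @is_derive_const].
  + unfold minus, plus, opp, zero; simpl; ring.
- unfold q0; lra.
- intros t Ht Hz. specialize (HT t Ht). assert (Eq : q t = q0) by lra.
  pose proof (orbit_r_range t). pose proof (Hpr t).
  unfold v2, rate_q. rewrite Eq.
  assert (lam * p t * / w t <= 1 / 4).
  { apply Rle_trans with (lam * p t * A); [|lra]. apply Rmult_le_compat_l; [apply Rmult_le_pos|]; lra. }
  assert (0 < b * p t * / w t) by (apply Rmult_lt_0_compat; [apply Rmult_lt_0_compat|]; lra).
  assert (0 < q0 * (1 - q0 - lam * p t * / w t)) by (apply Rmult_lt_0_compat; unfold q0 in *; lra).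
  lra.
Qed.

Lemma decaying_of_derive_le (f df : R -> R) (c eps T : R) :
  0 < c -> 0 < eps -> (forall s, T <= s -> is_derive f s (df s)) ->
  (forall s, T <= s -> df s <= - c * (f s - eps)) ->
  exists T', T <= T' /\ forall s, T' <= s -> f s < 2 * eps.
Proof.
intros Hc He Hf Hdf.
set (M := Rabs (f T) + 1). assert (HM : 0 < M) by (unfold M; pose proof (Rabs_pos (f T)); lra).
assert (HeM : 0 < eps / M) by (apply Rdiv_lt_0_compat; lra).
set (T' := T + (Rabs (ln (eps / M)) + 1) / c).
assert (0 < (Rabs (ln (eps / M)) + 1) / c).
{ apply Rdiv_lt_0_compat; [pose proof (Rabs_pos (ln (eps / M)))|]; lra. }
exists T'. split; [unfold T'; lra|].
intros s Hs.
assert (HTs : T <= s) by (unfold T' in Hs; lra).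
assert (Hdec : - ((f T - eps) * exp (c * (T - T))) <= - ((f s - eps) * exp (c * (s - T)))).
{ apply (derive_nonneg_le (fun s => - ((f s - eps) * exp (c * (s - T))))
    (fun s => - ((df s + c * (f s - eps)) * exp (c * (s - T))))); trivial.
  - intros t Ht. apply (is_derive_opp (fun s => (f s - eps) * exp (c * (s - T)))). evar_last.
    + apply (is_derive_mult (fun s => f s - eps) (fun s => exp (c * (s - T))) t (df t) (c * exp (c * (t - T)))).
      * evar_last.
        -- apply (is_derive_minus f (fun _ => eps)); [apply Hf; lra|apply @is_derive_const].
        -- unfold minus, plus, opp, zero; simpl; ring.
      * auto_derive; [trivial|unfold Rminus; ring].
      * intros; apply Rmult_comm.
    + unfold plus, mult; simpl; unfold mult; simpl. ring.
  - intros t Ht. specialize (Hdf t ltac:(lra)). pose proof (exp_pos (c * (t - T))). nra. }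
rewrite Rminus_diag, Rmult_0_r, exp_0, Rmult_1_r in Hdec.
assert (Hexp : M / eps < exp (c * (s - T))).
{ rewrite <- (exp_ln (M / eps)) by (apply Rdiv_lt_0_compat; lra). apply exp_increasing.
  replace (M / eps) with (/ (eps / M)) by (field; lra). rewrite ln_Rinv by assumption.
  pose proof (Rle_abs (- ln (eps / M))) as J. rewrite Rabs_Ropp in J.
  apply Rlt_le_trans with (c * ((Rabs (ln (eps / M)) + 1) / c)).
  - replace (c * ((Rabs (ln (eps / M)) + 1) / c)) with (Rabs (ln (eps / M)) + 1) by (field; lra). lra.
  - apply Rmult_le_compat_l; [lra|]. unfold T' in Hs; lra. }
destruct (Rlt_le_dec (f s) (2 * eps)) as [|Hge]; [assumption|exfalso].
assert (eps * (M / eps) = M) by (field; lra).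
assert (eps * exp (c * (s - T)) <= (f s - eps) * exp (c * (s - T)))
  by (apply Rmult_le_compat_r; [left; apply exp_pos|lra]).
assert (eps * (M / eps) < eps * exp (c * (s - T))) by (apply Rmult_lt_compat_l; lra).
pose proof (Rle_abs (f T)). unfold M in *. lra.
Qed.

Lemma q_tends_to_one (eps : R) : 0 < eps -> exists T, forall s, T <= s -> Rabs (q s - 1) < eps.
Proof.
intros He. destruct q_bounded_below as [T0 [q0 [Hq0 HT0]]].
set (C := (1 + Q) * (A * (B + lam * Q))).
assert (HlQ : 0 < lam * Q) by (apply Rmult_lt_0_compat; lra).
assert (HC : 0 <= C) by (unfold C; repeat apply Rmult_le_pos; lra).
(* [(q - 1)^2] decays at rate [2 * q0] up to a forcing proportional to [p]; [decaying_of_derive_le]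
   then ends below [2 * e2 = eps * eps]. *)
set (e2 := eps * eps / 2). assert (He2 : 0 < e2) by (unfold e2; nra).
destruct (forcing_vanishes C (q0 * e2)) as [T1 HT1]; [assumption|nra|].
set (T := Rmax T0 T1). pose proof (Rmax_l T0 T1). pose proof (Rmax_r T0 T1).
destruct (decaying_of_derive_le (fun s => (q s - 1) * (q s - 1)) (fun s => 2 * ((q s - 1) * v2 s)) (2 * q0) e2 T)
  as [T' [HTT HT']]; trivial.
- lra.
- intros s _. evar_last.
  + apply (is_derive_mult (fun s => q s - 1) (fun s => q s - 1) s (v2 s) (v2 s)).
    * evar_last.
      -- apply (is_derive_minus q (fun _ => 1)); [apply Hq|apply @is_derive_const].
      -- unfold minus, plus, opp, zero; simpl; ring.
    * evar_last.
      -- apply (is_derive_minus q (fun _ => 1)); [apply Hq|apply @is_derive_const].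
      -- unfold minus, plus, opp, zero; simpl; ring.
    * intros; apply Rmult_comm.
  + unfold plus, mult; simpl; unfold mult; simpl. ring.
- intros s Hs. fold T in H, H0. specialize (HT0 s ltac:(lra)). specialize (HT1 s ltac:(lra)).
  pose proof (orbit_r_range s). pose proof (Hpr s). pose proof (Hqr s).
  assert (E : (q s - 1) * v2 s = - (q s * ((q s - 1) * (q s - 1))) + (q s - 1) * (p s * (/ w s * (b - lam * q s))))
    by (unfold v2, rate_q; ring).
  assert (Hf : Rabs ((q s - 1) * (p s * (/ w s * (b - lam * q s)))) <= (1 + Q) * (p s * (A * (B + lam * Q)))).
  { assert (0 <= lam * q s <= lam * Q) by (split; [apply Rmult_le_pos|apply Rmult_le_compat_l]; lra).
    apply Rabs_mult_le; [apply Rabs_le; lra|]. apply Rabs_mult_le; [rewrite Rabs_pos_eq; lra|].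
    apply Rabs_mult_le; [rewrite Rabs_pos_eq; lra|]. apply Rabs_le; lra. }
  apply Rabs_le_between in Hf.
  assert (q0 * ((q s - 1) * (q s - 1)) <= q s * ((q s - 1) * (q s - 1)))
    by (apply Rmult_le_compat_r; [apply Rle_0_sqr|lra]).
  unfold C in HT1. lra.
- exists T'. intros s Hs. specialize (HT' s Hs).
  assert (Hsq : (q s - 1) * (q s - 1) < eps * eps) by (unfold e2 in HT'; lra).
  rewrite <- (Rabs_pos_eq eps) by lra. apply Rsqr_lt_abs_0. exact Hsq.
Qed.

(** The comparison function is the constant [1], with growth rate [0]: once [p] and [q - 1] remain
    small, so does the forcing of [w - w1], and a bounded repelled function is as small as its
    future forcing. *)
Lemma w_tends (eps : R) : 0 < eps ->
  exists T, forall s, T <= s -> Rabs (w s - mu / lam / (mu * a / lam - 1)) < eps.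
Proof.
intros He.
set (w1 := mu / lam / (mu * a / lam - 1)).
assert (Hw1 : 0 < w1) by (unfold w1; repeat apply Rdiv_lt_0_compat; lra).
set (e := eps * kap / 4). assert (He' : 0 < e) by (unfold e; apply Rdiv_lt_0_compat; [nra|lra]).
destruct (forcing_vanishes lam (e / 2)) as [T1 HT1]; [lra|lra|].
destruct (q_tends_to_one (e / 2 / w1)) as [T2 HT2]; [apply Rdiv_lt_0_compat; lra|].
exists (Rmax T1 T2). intros s0 Hs0.
pose proof (Rmax_l T1 T2). pose proof (Rmax_r T1 T2).
apply Rle_lt_trans with (2 * e / kap * 1); [|unfold e; replace (2 * (eps * kap / 4) / kap * 1) with (eps / 2) by (field; lra); lra].
apply (bounded_solution_le (fun s => w s - w1) k (fun s => lam * p s + w1 * (q s - 1)) (fun _ => 1)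
  (fun _ => 0) n kap 0 e (wmax + w1)); try lra.
- intros s _. evar_last.
  + apply (is_derive_minus w (fun _ => w1)); [apply Hw|apply @is_derive_const].
  + unfold minus, plus, opp, zero; simpl. unfold wp, k, w1. field. repeat split; try lra.
    intros H3. assert (mu * a / lam = 1); [|lra]. apply Rmult_eq_reg_r with lam; [|lra].
    unfold Rdiv; rewrite Rmult_assoc, Rinv_l; lra.
- intros s _. apply @is_derive_const.
- intros s _. lra.
- intros s _. apply orbit_k_range.
- intros s Hs. specialize (HT1 s ltac:(lra)). specialize (HT2 s ltac:(lra)). pose proof (Hpr s).
  apply Rle_trans with (lam * p s + w1 * (e / 2 / w1)).
  + apply Rabs_plus_le; [rewrite Rabs_pos_eq; [lra|apply Rmult_le_pos; lra]|].
    apply Rabs_mult_le; [rewrite Rabs_pos_eq; lra|lra].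
  + replace (w1 * (e / 2 / w1)) with (e / 2) by (field; lra). lra.
- intros s _. pose proof (Hwr s). pose proof (orbit_w_pos s). apply Rabs_le; lra.
Qed.

End Orbit.

(** * Departure from the first equilibrium *)

Lemma theta_defect (s : R) : Rabs (theta s - exp (2 * s)) <= exp (3 * s).
Proof.
pose proof (exp_pos (2 * s)) as Ht.
assert (E : theta s - exp (2 * s) = - (exp (2 * s) * theta s)) by (unfold theta; field; lra).
rewrite E, Rabs_Ropp. pose proof (theta_range s).
rewrite Rabs_pos_eq by (apply Rmult_le_pos; lra).
destruct (Rle_dec 0 s).
- apply Rle_trans with (exp (2 * s) * 1); [apply Rmult_le_compat_l; lra|].
  rewrite Rmult_1_r. apply exp_monotone; lra.
- apply Rle_trans with (exp (2 * s) * exp (2 * s)).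
  + apply Rmult_le_compat_l; [lra|]. unfold theta.
    apply Rmult_le_reg_r with (1 + exp (2 * s)); [lra|].
    unfold Rdiv; rewrite Rmult_assoc, Rinv_l; nra.
  + rewrite <- exp_plus. apply exp_monotone; lra.
Qed.

(* [theta] replaces [exp (2 s)] so that the deviation stays bounded on the whole line. *)
Lemma w_asymptotics (lam mu a b n P Q kap G C : R) (p q w : R -> R) :
  0 < lam -> 0 < a -> 0 <= b -> 0 < n -> 0 < P -> 0 < Q -> 0 < kap -> 0 <= G ->
  kap <= mu * a / lam - Q -> 2 * n < kap -> n * (3 + 2 * G) <= kap / 2 ->
  slaved lam mu a n P Q kap p q w ->
  (forall s, 0 < p s < P) -> (forall s, 0 < q s < Q) ->
  (forall s, q s <= a * b * exp (2 * s)) ->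
  (forall s, Rabs (p s - exp (2 * s)) <= C * weight G s) ->
  (forall s, Rabs (q s - a * b * exp (2 * s)) <= C * weight G s) ->
  exists C', forall s, Rabs (w s - / a - (b + lam) / (mu * a / lam - 2 * n) * exp (2 * s)) <= C' * weight G s.
Proof.
intros Hlam Ha Hb Hn HP HQ Hkap HG HK Hn2 HnG [Hw Hwb] Hp Hq Hqe Hdp Hdq.
(* [W] is the balance at order [exp (2 s)]: inserting [w = / a + W exp (2 s)], [p = exp (2 s)],
   [q = a b exp (2 s)] into the equation of [w] gives [(K - 2 n) W = b + lam]. *)
set (K := mu * a / lam) in *. set (W := (b + lam) / (K - 2 * n)).
assert (HW : 0 < W) by (apply Rdiv_lt_0_compat; lra).
assert (Hab : 0 <= a * b) by (apply Rmult_le_pos; lra).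
assert (Hia : 0 < / a) by now apply Rinv_0_lt_compat.
set (C1 := W * (Q + a * b) + 2 * n * W + (C + a * b) * / a + lam * (C + 1)).
assert (Hom : forall s, exp (3 * s) <= weight G s) by (intros s; now apply weight_ge).
assert (Hth : forall s, Rabs (theta s - exp (2 * s)) <= weight G s).
{ intros s. eapply Rle_trans; [apply theta_defect|apply Hom]. }
exists (2 * C1 / kap + W * 1). intros s0.
rewrite Rmult_plus_distr_r.
replace (w s0 - / a - W * exp (2 * s0)) with ((w s0 - / a - W * theta s0) + W * (theta s0 - exp (2 * s0))) by ring.
apply Rabs_plus_le; [|rewrite Rmult_assoc, Rmult_1_l; apply Rabs_mult_le; [rewrite Rabs_pos_eq; lra|apply Hth]].
apply (bounded_solution_le (fun s => w s - / a - W * theta s) (fun s => K - q s)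
  (fun s => W * (q s * theta s) - 2 * n * W * (theta s * theta s) + (q s - a * b * theta s) * / a
            + lam * (p s - theta s))
  (weight G) (fun s => (3 + 2 * G * theta s) * weight G s) n kap (3 + 2 * G) _ (w_max lam P kap + / a + W)); trivial.
- intros s _. evar_last.
  + apply (is_derive_minus (fun s => w s - / a) (fun s => W * theta s)).
    * apply (is_derive_minus w (fun _ => / a)); [apply Hw|apply @is_derive_const].
    * apply (is_derive_scal theta), theta_derive.
  + unfold minus, plus, opp, zero; simpl.
    rewrite !clamp_id by (split; left; [apply Hp|apply Hp] || (split; left; [apply Hq|apply Hq])).
    fold K.
    assert (E1 : (K - 2 * n) * W = b + lam) by (unfold W; field; lra).
    assert (E2 : K * / a = mu / lam) by (unfold K; field; lra).
    apply Rmult_eq_reg_l with n; [|lra].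
    replace (n * (((K - q s) * (w s - / a - W * theta s) - (W * (q s * theta s) - 2 * n * W * (theta s * theta s)
      + (q s - a * b * theta s) * / a + lam * (p s - theta s))) / n))
    with ((K - q s) * w s - K * / a - ((K - 2 * n) * W - b - lam) * theta s - lam * p s
       - n * (W * (2 * theta s * (1 - theta s)))) by (field; lra).
    rewrite E1, E2. field. lra.
- intros; apply weight_derive.
- intros s _. pose proof (weight_pos G s). pose proof (theta_range s).
  split; [assumption|]. apply Rmult_le_compat_r; [lra|]. nra.
- intros s _. specialize (Hq s). lra.
- intros s _. pose proof (theta_range s) as Ht. pose proof (theta_sqr_le s) as Ht2. specialize (Hom s).
  specialize (Hth s). specialize (Hdp s). specialize (Hdq s). specialize (Hq s).
  assert (Hqt : q s <= (Q + a * b) * theta s).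
  { pose proof (clamp_exp_theta Q (a * b) (q s) s ltac:(lra) Hab (Hqe s)) as J.
    rewrite clamp_id in J by lra. apply J. }
  assert (T0 : theta s * theta s <= weight G s) by lra.
  apply Rle_trans with (W * ((Q + a * b) * weight G s) + 2 * n * W * weight G s
     + (C * weight G s + a * b * weight G s) * / a + lam * (C * weight G s + weight G s)).
  + apply Rabs_plus_le; [apply Rabs_plus_le; [apply Rabs_minus_le|]|].
    * apply Rabs_mult_le; [rewrite Rabs_pos_eq; lra|].
      rewrite Rabs_pos_eq by (apply Rmult_le_pos; lra).
      apply Rle_trans with ((Q + a * b) * theta s * theta s); [apply Rmult_le_compat_r; lra|].
      rewrite Rmult_assoc. apply Rmult_le_compat_l; lra.
    * assert (0 <= 2 * n * W) by (apply Rmult_le_pos; lra).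
      apply Rabs_mult_le; rewrite Rabs_pos_eq; nra.
    * apply Rabs_mult_le; [|rewrite Rabs_pos_eq; lra].
      replace (q s - a * b * theta s)
        with ((q s - a * b * exp (2 * s)) - a * b * (theta s - exp (2 * s))) by ring.
      apply Rabs_minus_le; [assumption|]. apply Rabs_mult_le; [rewrite Rabs_pos_eq; lra|assumption].
    * apply Rabs_mult_le; [rewrite Rabs_pos_eq; lra|].
      replace (p s - theta s) with ((p s - exp (2 * s)) - (theta s - exp (2 * s))) by ring.
      apply Rabs_minus_le; assumption.
  + right. unfold C1. ring.
- intros s _. pose proof (theta_range s). specialize (Hwb s).
  apply Rabs_le. assert (0 < W * theta s < W) by (split; nra). lra.
Qed.

Section Assembly.

Variables lam mu n a b A B P Q kap del : R.
Hypotheses (Hlam : 0 < lam) (Hmu : 0 < mu <= 1) (Ha : 0 < a <= A) (Hb : 0 < b <= B).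
Hypotheses (Hn : 0 < n < 1) (HP : 3 < lam * P) (HQ : 1 < Q) (Hkap : 0 < kap).
Hypothesis HK : kap <= mu * a / lam - Q.
Hypothesis Ha_eq : a = (2 - n + 2 * lam) / (1 + mu).
Hypothesis Hb_eq : b = (1 - mu - n + (1 - mu) * lam) / (1 + mu).
Hypothesis Hm : mu + n <= 1.
Hypothesis Hdel : mu * a * b + del <= lam * (1 - n) * Q.
Hypothesis Hn2 : 2 * n < kap.
Hypothesis Hpicard : n * (3 + 2 * weight_exponent lam A B P Q kap) <= kap / 2.
Hypothesis Hsmall1 : n * error_bound lam A B P Q kap * (1 + lam * lam * P) < 1.
Hypothesis Hsmall2 : n * error_bound lam A B P Q kap * lam * (B + lam * Q) <= del.
Hypothesis Hs1 : n * (2 * (2 * speed_rate lam A B P Q + w_speed_ratio lam P kap * speed_rate_w lam A B P Q))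
  <= kap / 4.
Hypothesis Hs2 : n * (4 * speed_rate' lam A B P Q kap) <= kap / 4.
Hypothesis Hs3 : n * (A * w_speed_ratio lam P kap * error_weight lam B P Q) <= mu.
Hypothesis Hs4 : n * (A * w_speed_ratio lam P kap * q_speed lam A B P Q +
        A / lam * (A * A * (/ lam + lam * P) * slope_ratio lam A B P Q kap)) < / (w_max lam P kap * lam).

Lemma orbit_exists : exists (p q w : R -> R) C,
  (forall s, is_derive p s (p s * growth_p lam a (p s) (q s) (w s))) /\
  (forall s, is_derive q s (rate_q lam b (p s) (q s) (w s))) /\
  (forall s, is_derive w s (((mu * a / lam - q s) * w s - (mu / lam + lam * p s)) / n)) /\
  (forall s, 0 < w s) /\
  (forall eps, 0 < eps -> exists T, forall s, T <= s -> Rabs (p s) < eps) /\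
  (forall eps, 0 < eps -> exists T, forall s, T <= s -> Rabs (q s - 1) < eps) /\
  (forall eps, 0 < eps -> exists T, forall s, T <= s ->
     Rabs (w s - mu / lam / (mu * a / lam - 1)) < eps) /\
  forall s, s <= 0 ->
    Rabs (p s - exp (2 * s)) <= C * exp (3 * s) /\
    Rabs (q s - a * b * exp (2 * s)) <= C * exp (3 * s) /\
    Rabs (w s - / a - (b + lam) / (mu * a / lam - 2 * n) * exp (2 * s)) <= C * exp (3 * s).
Proof.
assert (HP0 : 0 < P) by (destruct (Rle_lt_dec P 0); [nra|assumption]).
destruct (clamped_solution lam mu a b n A B P Q kap) as [p [q [w [C [Hs [Hd HC]]]]]]; trivial; try lra.
set (G := weight_exponent lam A B P Q kap) in *.
assert (HG : 0 < G) by (apply (constants_pos lam a b A B P Q kap); trivial; lra).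
assert (Hp1 : forall s, p s < P).
{ intros s. apply (p_lt_P lam mu n a b A B P Q kap) with (q := q) (w := w); trivial. intros t; apply HC. }
assert (Hq1 : forall s, q s < Q).
{ intros s. apply (q_lt_Q lam mu n a b A B P Q kap) with (del := del) (p := p) (w := w); trivial. intros t; apply HC. }
assert (Hab : 0 < a * b) by (apply Rmult_lt_0_compat; lra).
assert (HC0 : 0 <= C).
{ destruct (HC 0) as [_ [_ [H _]]]. pose proof (weight_pos G 0). pose proof (Rabs_pos (p 0 - exp (2 * 0))).
  destruct (Rle_lt_dec 0 C); [assumption|]. nra. }
set (c2 := exp (G * ln 2)). assert (Hc2 : 0 < c2) by apply exp_pos.
(* The weight is [O(exp (3 s))] at minus infinity, so the leading exponentials dominate the error
   and [p], [q] are positive at points arbitrarily far to the left; positivity propagates forward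
   from there. *)
assert (Hstart : forall s, exists s0, s0 <= s /\ 0 < p s0 /\ 0 < q s0).
{ intros s.
  assert (Hr : 0 < Rmin 1 (a * b)) by (apply Rmin_glb_lt; lra).
  destruct (exp_vanishes (C * c2) 1 ltac:(lra) ltac:(apply Rmult_le_pos; lra) _ Hr) as [T HT].
  set (s0 := Rmin s (Rmin 0 (T - 1))).
  assert (s0 <= s) by apply Rmin_l.
  assert (s0 <= Rmin 0 (T - 1)) by apply Rmin_r.
  pose proof (Rmin_l 0 (T - 1)). pose proof (Rmin_r 0 (T - 1)).
  exists s0. split; [assumption|].
  specialize (HT s0 ltac:(lra)). destruct (HC s0) as [_ [_ [H5 H6]]].
  assert (Hwt : weight G s0 <= c2 * exp (3 * s0)) by (apply weight_le_negative; lra).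
  assert (E3 : exp (3 * s0) = exp (1 * s0) * exp (2 * s0)) by (rewrite <- exp_plus; f_equal; ring).
  pose proof (exp_pos (2 * s0)) as Ht. pose proof (exp_pos (1 * s0)).
  assert (Hw : C * weight G s0 < Rmin 1 (a * b) * exp (2 * s0)).
  { apply Rle_lt_trans with (C * c2 * exp (1 * s0) * exp (2 * s0)).
    - replace (C * c2 * exp (1 * s0) * exp (2 * s0)) with (C * (c2 * exp (3 * s0))) by (rewrite E3; ring).
      apply Rmult_le_compat_l; lra.
    - apply Rmult_lt_compat_r; [assumption|]. pose proof (Rle_abs (C * c2 * exp (1 * s0))). lra. }
  assert (Rmin 1 (a * b) * exp (2 * s0) <= 1 * exp (2 * s0)) by (apply Rmult_le_compat_r; [lra|apply Rmin_l]).
  assert (Rmin 1 (a * b) * exp (2 * s0) <= a * b * exp (2 * s0)) by (apply Rmult_le_compat_r; [lra|apply Rmin_r]).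
  apply Rabs_le_between in H5. apply Rabs_le_between in H6. lra. }
assert (Hp0 : forall s, 0 < p s).
{ intros s. destruct (Hstart s) as [s0 [H1 [H2 _]]].
  apply (p_stays_pos lam mu n a b A P Q kap) with (q := q) (w := w) (s0 := s0); trivial. }
assert (Hq0 : forall s, 0 < q s).
{ intros s. destruct (Hstart s) as [s0 [H1 [_ H2]]].
  apply (q_stays_pos lam mu n a b A B P Q kap) with (p := p) (w := w) (s0 := s0); trivial. }
assert (Hpr : forall s, 0 < p s < P) by (intros s; split; trivial).
assert (Hqr : forall s, 0 < q s < Q) by (intros s; split; trivial).
destruct (w_asymptotics lam mu a b n P Q kap G C p q w) as [C' HC']; trivial; try lra.
{ intros s; apply HC. }
{ intros s; apply HC. }
{ intros s; apply HC. }
destruct Hs as [Hw Hwb]. destruct Hd as [Hdp Hdq].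
assert (Ep : forall s, clamp P (p s) = p s) by (intros s; apply clamp_id; specialize (Hpr s); lra).
assert (Eq : forall s, clamp Q (q s) = q s) by (intros s; apply clamp_id; specialize (Hqr s); lra).
assert (Hdp' : forall s, is_derive p s (p s * growth_p lam a (p s) (q s) (w s))).
{ intros s. specialize (Hdp s). rewrite Ep, Eq in Hdp. exact Hdp. }
assert (Hdq' : forall s, is_derive q s (rate_q lam b (p s) (q s) (w s))).
{ intros s. specialize (Hdq s). rewrite Ep, Eq in Hdq. exact Hdq. }
assert (Hw' : forall s, is_derive w s (((mu * a / lam - q s) * w s - (mu / lam + lam * p s)) / n)).
{ intros s. specialize (Hw s). rewrite Ep, Eq in Hw. exact Hw. }
exists p, q, w, (Rmax C C' * c2).
split; [exact Hdp'|]. split; [exact Hdq'|]. split; [exact Hw'|].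
split; [intros s; specialize (Hwb s); assert (0 < / a) by (apply Rinv_0_lt_compat; lra); lra|].
split; [|split; [|split]].
- intros eps He.
  destruct (p_vanishes lam mu n a b A B P Q kap) with (p := p) (q := q) (w := w) (eps := eps) as [T HT]; trivial.
  exists T. intros s Hs. rewrite Rabs_pos_eq by (left; apply Hp0). now apply HT.
- apply (q_tends_to_one lam mu n a b A B P Q kap) with (p := p) (q := q) (w := w); trivial.
- apply (w_tends lam mu n a b A B P Q kap) with (p := p) (q := q) (w := w); trivial.
- intros s Hs. pose proof (weight_le_negative G s ltac:(lra) Hs) as Hwt. fold c2 in Hwt.
  pose proof (weight_pos G s).
  assert (H1 : forall x X, X <= Rmax C C' -> x <= X * weight G s -> x <= Rmax C C' * c2 * exp (3 * s)).
  { intros x X HX Hx. eapply Rle_trans; [exact Hx|].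
    apply Rle_trans with (Rmax C C' * weight G s); [apply Rmult_le_compat_r; lra|].
    rewrite Rmult_assoc. apply Rmult_le_compat_l; [|exact Hwt].
    apply Rle_trans with C; [assumption|apply Rmax_l]. }
  destruct (HC s) as [_ [_ [H2 H3]]].
  split; [|split].
  + eapply H1; [apply Rmax_l|exact H2].
  + eapply H1; [apply Rmax_l|exact H3].
  + eapply H1; [apply Rmax_r|apply HC'].
Qed.

End Assembly.

(** * Conclusion *)

Definition for_small (S : R -> Prop) : Prop := exists d, 0 < d /\ forall n, 0 < n < d -> S n.

Lemma for_small_and (S T : R -> Prop) :
  for_small S -> for_small T -> for_small (fun n => S n /\ T n).
Proof.
intros [d1 [H1 S1]] [d2 [H2 S2]]. exists (Rmin d1 d2). split; [now apply Rmin_glb_lt|].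
intros n Hn. pose proof (Rmin_l d1 d2). pose proof (Rmin_r d1 d2). split; [apply S1|apply S2]; lra.
Qed.

Lemma for_small_mult (X c : R) : 0 < c -> for_small (fun n => n * X < c).
Proof.
intros Hc. pose proof (Rabs_pos X). exists (c / (Rabs X + 1)). split; [apply Rdiv_lt_0_compat; lra|].
intros n Hn. assert (c / (Rabs X + 1) * (Rabs X + 1) = c) by (field; lra).
pose proof (Rle_abs X). nra.
Qed.

Lemma for_small_continuous (f : R -> R) :
  continuous f 0 -> 0 < f 0 -> for_small (fun n => 0 < f n).
Proof.
intros Hf H0. destruct (continuous_locally_pos f 0 Hf H0) as [d [Hd Hpos]].
exists d. split; [assumption|]. intros n Hn. apply Hpos. rewrite Rminus_0_r, Rabs_pos_eq; lra.
Qed.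

Lemma is_lim_p_infty_eps (f : R -> R) (l : R) :
  (forall eps, 0 < eps -> exists T, forall s, T <= s -> Rabs (f s - l) < eps) -> is_lim f p_infty l.
Proof.
intros H. apply is_lim_spec. intros eps. destruct (H eps (cond_pos eps)) as [T HT].
exists T. intros s Hs. apply HT. lra.
Qed.

Lemma is_lim_m_infty_exp (f : R -> R) (l C : R) :
  (forall s, s <= 0 -> Rabs (f s - l) <= C * exp s) -> is_lim f m_infty l.
Proof.
intros H. apply is_lim_spec. intros eps.
assert (HC : 0 <= C).
{ specialize (H 0 ltac:(lra)). rewrite exp_0 in H. pose proof (Rabs_pos (f 0 - l)). lra. }
destruct (exp_vanishes C 1 ltac:(lra) HC eps (cond_pos eps)) as [T HT].
exists (Rmin T 0). intros s Hs. pose proof (Rmin_l T 0). pose proof (Rmin_r T 0).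
specialize (HT s ltac:(lra)). specialize (H s ltac:(lra)).
rewrite Rmult_1_l in HT. pose proof (Rle_abs (C * exp s)). lra.
Qed.

Lemma filterlim_triple (F : (R -> Prop) -> Prop) {FF : Filter F} (f g h : R -> R) (x y z : R) :
  filterlim f F (locally x) -> filterlim g F (locally y) -> filterlim h F (locally z) ->
  filterlim (fun s => (f s, g s, h s)) F (locally ((x, y), z)).
Proof.
intros Hf Hg Hh. apply filterlim_locally. intros eps.
generalize (filter_and _ _ (filter_and _ _ (proj1 (filterlim_locally f x) Hf eps)
  (proj1 (filterlim_locally g y) Hg eps)) (proj1 (filterlim_locally h z) Hh eps)).
apply filter_imp. intros s [[H1 H2] H3]. repeat split; assumption.
Qed.

Lemma rescaled_defect (f : R -> R) (c C s : R) :
  Rabs (f s - c * exp (2 * s)) <= C * exp (3 * s) ->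
  Rabs (exp (- 2 * s) * f s - c) <= C * exp s.
Proof.
intros H. pose proof (exp_pos (- 2 * s)).
assert (E : exp (- 2 * s) * exp (2 * s) = 1) by (rewrite <- exp_plus; replace (- 2 * s + 2 * s) with 0 by ring; apply exp_0).
replace (exp (- 2 * s) * f s - c) with (exp (- 2 * s) * (f s - c * exp (2 * s)))
  by (rewrite Rmult_minus_distr_l; replace (exp (- 2 * s) * (c * exp (2 * s))) with (c * (exp (- 2 * s) * exp (2 * s))) by ring; rewrite E; ring).
rewrite Rabs_mult, (Rabs_pos_eq (exp (- 2 * s))) by lra.
apply Rle_trans with (exp (- 2 * s) * (C * exp (3 * s))); [apply Rmult_le_compat_l; lra|].
right. replace (exp s) with (exp (- 2 * s) * exp (3 * s)) by (rewrite <- exp_plus; f_equal; ring). ring.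
Qed.

Section Conclusion.

Variables lam m n C : R.
Hypotheses (Hlam : 0 < lam) (Hm : 0 < m <= 1) (Hn : 0 < n < m).

Let mu := m - n.
Let a := coef_a lam m n.
Let b := coef_b lam m n.
Let K := mu * a / lam.

Hypothesis HK : 1 < K.
Hypothesis Hn2 : 2 * n < K.

Lemma coef_a_eq : a = (2 - n + 2 * lam) / (1 + mu).
Proof. unfold a, mu, coef_a. field. lra. Qed.

Lemma coef_b_eq : b = (1 - mu - n + (1 - mu) * lam) / (1 + mu).
Proof. unfold b, mu, coef_b. field. lra. Qed.

Lemma coef_a_pos : 0 < a.
Proof. rewrite coef_a_eq. apply Rdiv_lt_0_compat; unfold mu; lra. Qed.

Lemma coef_c_eq : coef_c lam m n = / (mu / lam / (K - 1)).
Proof.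
assert (E : coef_c lam m n = lam * (K - 1) / mu).
{ unfold K. rewrite coef_a_eq. unfold coef_c, mu. field. lra. }
rewrite E. field. unfold mu; lra.
Qed.

Lemma coef_A_eq : coef_A lam m n = K / n.
Proof. unfold coef_A, K, a, mu. field. lra. Qed.

(** The upper bound on lambda in [Lambda] is [1 < K] with the denominators cleared. *)
Lemma parameters_admissible : Lambda lam m n.
Proof.
unfold Lambda. split; [assumption|]. split; [lra|]. split; [lra|]. split; [assumption|].
apply Rmult_lt_reg_r with (1 - m + n); [lra|].
replace ((2 - n) * (m - n) / (1 - m + n) * (1 - m + n)) with ((2 - n) * (m - n)) by (field; lra).
assert (E : K * (lam * (1 + m - n)) = (m - n) * (2 - n + 2 * lam)).
{ unfold K. rewrite coef_a_eq. unfold mu. field. lra. }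
assert (1 * (lam * (1 + m - n)) < K * (lam * (1 + m - n))).
{ apply Rmult_lt_compat_r; [apply Rmult_lt_0_compat|]; lra. }
lra.
Qed.

Lemma coef_A_large : 0 < 1 - / coef_A lam m n /\ 0 < 1 - 2 * / coef_A lam m n.
Proof.
rewrite coef_A_eq. replace (/ (K / n)) with (n / K) by (field; lra).
assert (H : n / K < 1 / 2).
{ apply Rmult_lt_reg_r with K; [lra|]. unfold Rdiv at 1. rewrite Rmult_assoc, Rinv_l; lra. }
assert (0 < n / K) by (apply Rdiv_lt_0_compat; lra). lra.
Qed.

(** By [coef_A = K / n], [d = b + lam] and [lam K / mu = a], the third component is [- a^2] times
    the coefficient of [exp (2 s)] in [w]; [- a^2] is the derivative of inversion at [/ a]. *)
Lemma X02_third :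
  - (lam * a * coef_d lam m n / (m - n)) * (1 / (1 - 2 * / coef_A lam m n)) =
  - (a * a * ((b + lam) / (K - 2 * n))).
Proof.
rewrite coef_A_eq.
assert (Ed : coef_d lam m n = b + lam) by (unfold coef_d, b, coef_b; field; lra).
assert (EK : a = K * lam / (m - n)) by (unfold K, mu; field; lra).
rewrite Ed. rewrite EK. field. repeat split; lra.
Qed.

Variables p q w : R -> R.
Hypothesis Hp : forall s, is_derive p s (p s * growth_p lam a (p s) (q s) (w s)).
Hypothesis Hq : forall s, is_derive q s (rate_q lam b (p s) (q s) (w s)).
Hypothesis Hw : forall s, is_derive w s (((K - q s) * w s - (mu / lam + lam * p s)) / n).
Hypothesis Hw0 : forall s, 0 < w s.
Hypothesis Lp : forall eps, 0 < eps -> exists T, forall s, T <= s -> Rabs (p s) < eps.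
Hypothesis Lq : forall eps, 0 < eps -> exists T, forall s, T <= s -> Rabs (q s - 1) < eps.
Hypothesis Lw : forall eps, 0 < eps -> exists T, forall s, T <= s ->
     Rabs (w s - mu / lam / (K - 1)) < eps.
Hypothesis Has : forall s, s <= 0 ->
    Rabs (p s - exp (2 * s)) <= C * exp (3 * s) /\
    Rabs (q s - a * b * exp (2 * s)) <= C * exp (3 * s) /\
    Rabs (w s - / a - (b + lam) / (K - 2 * n) * exp (2 * s)) <= C * exp (3 * s).

Lemma inv_solves : is_solution lam m n p q (fun s => / w s).
Proof.
intros s. specialize (Hp s). specialize (Hq s). specialize (Hw s). specialize (Hw0 s).
assert (Hr : is_derive (fun s => / w s) s (- (((K - q s) * w s - (mu / lam + lam * p s)) / n) / w s ^ 2))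
  by (apply is_derive_inv; [exact Hw|lra]).
split; [split; [|split]|split; [|split]].
- eexists; exact Hp.
- eexists; exact Hq.
- eexists; exact Hr.
- match goal with |- ?x = _ => replace x with (p s * growth_p lam a (p s) (q s) (w s)) by (symmetry; apply is_derive_unique, Hp) end. unfold growth_p. rewrite coef_a_eq. unfold mu. field. lra.
- match goal with |- ?x = _ => replace x with (rate_q lam b (p s) (q s) (w s)) by (symmetry; apply is_derive_unique, Hq) end. unfold rate_q. fold b. ring.
- match goal with |- _ * ?x = _ =>
    replace x with (- (((K - q s) * w s - (mu / lam + lam * p s)) / n) / w s ^ 2)
      by (symmetry; apply is_derive_unique, Hr) end.
  unfold K. rewrite coef_a_eq. unfold mu. field. lra.
Qed.

Lemma rescaled_limits :
  is_lim (fun s => exp (- 2 * s) * p s) m_infty 1 /\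
  is_lim (fun s => exp (- 2 * s) * q s) m_infty (a * b) /\
  is_lim (fun s => exp (- 2 * s) * (w s - / a)) m_infty ((b + lam) / (K - 2 * n)).
Proof.
split; [|split]; apply (is_lim_m_infty_exp _ _ C); intros s Hs; destruct (Has s Hs) as [H1 [H2 H3]].
- apply rescaled_defect. now rewrite Rmult_1_l.
- now apply rescaled_defect.
- now apply (rescaled_defect (fun s => w s - / a)).
Qed.

Lemma exp2_lim : is_lim (fun s => exp (2 * s)) m_infty 0.
Proof.
apply (is_lim_m_infty_exp _ _ 1). intros s Hs. rewrite Rminus_0_r, Rmult_1_l.
rewrite Rabs_pos_eq by (left; apply exp_pos). apply exp_monotone. lra.
Qed.

Lemma unscaled_limit (f : R -> R) (l : R) :
  is_lim (fun s => exp (- 2 * s) * f s) m_infty l -> is_lim f m_infty 0.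
Proof.
intros H. apply (is_lim_ext (fun s => exp (2 * s) * (exp (- 2 * s) * f s))).
- intros s. rewrite <- Rmult_assoc, <- exp_plus. replace (2 * s + - 2 * s) with 0 by ring.
  rewrite exp_0. ring.
- replace (Finite 0) with (Finite (0 * l)) by (f_equal; ring).
  apply (is_lim_mult _ _ _ 0 l); [apply exp2_lim|exact H|exact I].
Qed.

Lemma w_lim_minf : is_lim w m_infty (/ a).
Proof.
destruct rescaled_limits as [_ [_ H]]. apply unscaled_limit in H.
apply (is_lim_ext (fun s => (w s - / a) + / a)); [intros s; ring|].
replace (Finite (/ a)) with (Finite (0 + / a)) by (f_equal; ring).
apply (is_lim_plus _ _ _ 0 (/ a)); [exact H|apply is_lim_const|reflexivity].
Qed.

Lemma r_lim_minf : is_lim (fun s => / w s) m_infty a.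
Proof.
pose proof coef_a_pos.
replace (Finite a) with (Rbar_inv (Finite (/ a))) by (simpl; f_equal; apply Rinv_inv).
apply is_lim_inv; [apply w_lim_minf|].
intros E. inversion E. assert (0 < / a) by now apply Rinv_0_lt_compat. lra.
Qed.

Lemma r_rescaled_limit :
  is_lim (fun s => exp (- 2 * s) * (/ w s - a)) m_infty (- (a * a * ((b + lam) / (K - 2 * n)))).
Proof.
pose proof coef_a_pos. destruct rescaled_limits as [_ [_ H1]].
apply (is_lim_ext (fun s => (- a * / w s) * (exp (- 2 * s) * (w s - / a)))).
- intros s. specialize (Hw0 s). field. lra.
- replace (Finite (- (a * a * ((b + lam) / (K - 2 * n)))))
    with (Finite ((- a * a) * ((b + lam) / (K - 2 * n)))) by (f_equal; ring).
  apply (is_lim_mult _ _ _ (- a * a) ((b + lam) / (K - 2 * n))); [|exact H1|exact I].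
  apply (is_lim_mult _ _ _ (- a) a); [apply is_lim_const|apply r_lim_minf|exact I].
Qed.

Lemma inv_heteroclinic : heteroclinic_orbit lam m n p q (fun s => / w s).
Proof.
destruct rescaled_limits as [H1 [H2 _]].
split; [exact inv_solves|]. split.
- apply filterlim_triple; [typeclasses eauto| | |].
  + exact (unscaled_limit _ _ H1).
  + exact (unscaled_limit _ _ H2).
  + exact r_lim_minf.
- apply filterlim_triple; [typeclasses eauto| | |].
  + apply (is_lim_p_infty_eps p 0). intros eps He. destruct (Lp eps He) as [T HT].
    exists T. intros s Hs. rewrite Rminus_0_r. now apply HT.
  + apply (is_lim_p_infty_eps q 1), Lq.
  + rewrite coef_c_eq. apply (is_lim_inv w p_infty (mu / lam / (K - 1))).
    * apply is_lim_p_infty_eps, Lw.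
    * intros E. inversion E as [E0].
      assert (0 < mu / lam / (K - 1)) by (apply Rdiv_lt_0_compat; [apply Rdiv_lt_0_compat|]; unfold mu in *; lra).
      lra.
Qed.

Lemma inv_departs_along_X02 :
  filterlim (fun s => scal (exp (- 2 * s)) (minus (p s, q s, / w s) (M0 lam m n)))
    (Rbar_locally m_infty) (locally (scal 1 (X02 lam m n))).
Proof.
destruct rescaled_limits as [H1 [H2 _]].
assert (E : scal 1 (X02 lam m n) = ((1, a * b), - (a * a * ((b + lam) / (K - 2 * n))))).
{ transitivity (X02 lam m n); [exact (scal_one (X02 lam m n))|].
  unfold X02. rewrite <- X02_third. reflexivity. }
rewrite E.
apply (filterlim_ext (fun s => (exp (- 2 * s) * p s, exp (- 2 * s) * q s, exp (- 2 * s) * (/ w s - a)))).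
- intros s.
  match goal with |- ?x = _ => change (x = (exp (- 2 * s) * (p s + - 0), exp (- 2 * s) * (q s + - 0),
    exp (- 2 * s) * (/ w s + - a))) end.
  now rewrite Ropp_0, !Rplus_0_r.
- apply filterlim_triple; [typeclasses eauto|exact H1|exact H2|exact r_rescaled_limit].
Qed.

End Conclusion.

Theorem theorem1 :
  forall lambda m : R,
    0 < m <= 1 ->
    0 < lambda ->
    (m < 1 -> lambda < 2 * m / (1 - m)) ->
    exists n0 : R, 0 < n0 /\
      forall n : R, 0 < n < n0 ->
        Lambda lambda m n /\
        0 < 1 - / coef_A lambda m n /\
        0 < 1 - 2 * / coef_A lambda m n /\
        exists p q r : R -> R,
          heteroclinic_orbit lambda m n p q r /\
          exists kappa : R, 0 < kappa /\
            filterlim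
              (fun eta : R =>
                 scal (exp (- 2 * eta))
                   (minus (p eta, q eta, r eta) (M0 lambda m n)))
              (Rbar_locally m_infty)
              (locally (scal kappa (X02 lambda m n))).
Proof.
intros lam m Hm Hlam Hlm.
(* Clearing the denominator covers [m = 1], where no upper bound on lambda is imposed. *)
assert (Hlm' : lam * (1 - m) < 2 * m).
{ destruct (Rlt_le_dec m 1) as [H|H].
  - specialize (Hlm H). apply Rmult_lt_compat_r with (r := 1 - m) in Hlm; [|lra].
    replace (2 * m / (1 - m) * (1 - m)) with (2 * m) in Hlm by (field; lra). exact Hlm.
  - replace m with 1 by lra. lra. }
(* With [m] and [lam] fixed, the coefficients become functions of [n], continuous at [0]; strict
   inequalities at [n = 0] then persist for small [n]. *)
set (fa := fun n => (2 - n + 2 * lam) / (1 + (m - n))).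
set (fb := fun n => (1 - (m - n) - n + (1 - (m - n)) * lam) / (1 + (m - n))).
set (fK := fun n => (m - n) * fa n / lam).
set (fJ := fun n => (m - n) * fa n * fb n).
(* This and [fb 0 < 1] are both the hypothesis [lam * (1 - m) < 2 * m] after clearing
   denominators. *)
assert (HK0 : 1 < fK 0).
{ unfold fK, fa. apply Rmult_lt_reg_r with (lam * (1 + m)); [apply Rmult_lt_0_compat; lra|].
  replace ((m - 0) * ((2 - 0 + 2 * lam) / (1 + (m - 0))) / lam * (lam * (1 + m)))
    with (m * (2 + 2 * lam)) by (field; lra). lra. }
assert (Hb0 : fb 0 < 1).
{ unfold fb. apply Rmult_lt_reg_r with (1 + m); [lra|].
  replace ((1 - (m - 0) - 0 + (1 - (m - 0)) * lam) / (1 + (m - 0)) * (1 + m))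
    with (1 - m + (1 - m) * lam) by (field; lra). lra. }
assert (HJ0 : fJ 0 = lam * (fK 0 * fb 0)) by (unfold fJ, fK; field; lra).
set (Mx := Rmax 1 (fK 0 * fb 0)).
assert (HMx : Mx < fK 0) by (apply Rmax_lub_lt; [assumption|nra]).
pose proof (Rmax_l 1 (fK 0 * fb 0)) as HM1. pose proof (Rmax_r 1 (fK 0 * fb 0)) as HM2. fold Mx in HM1, HM2.
(* [Q] is halfway in the gap between [Mx] and [fK 0]. [kap] and [del] use half of the strict margins
   at [n = 0], leaving the other half for the variation with [n]. *)
set (Q := (Mx + fK 0) / 2). set (kap := (fK 0 - Q) / 2). set (del := lam * (Q - fK 0 * fb 0) / 2).
assert (HQ1 : 1 < Q) by (unfold Q; lra). assert (HQK : Q < fK 0) by (unfold Q; lra).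
assert (Hkap : 0 < kap) by (unfold kap; lra).
assert (HQJ : 0 < lam * (Q - fK 0 * fb 0)) by (apply Rmult_lt_0_compat; [assumption|unfold Q; lra]).
assert (Hdel : 0 < del) by (unfold del; lra).
(* [A] and [B] bound [a] and [b] for every [n < m], and [lam * P] exceeds [3]. As these constants
   are fixed before [n], the remaining smallness conditions are linear in [n]. *)
set (A := 2 + 2 * lam). set (B := 1 + lam). set (P := 3 / lam + 1).
assert (HlP : lam * P = 3 + lam) by (unfold P; field; lra).
assert (HP0 : 0 < P) by (unfold P; assert (0 < 3 / lam) by (apply Rdiv_lt_0_compat; lra); lra).
assert (Hwm : 0 < / (w_max lam P kap * lam)).
{ apply Rinv_0_lt_compat, Rmult_lt_0_compat; [|assumption]. unfold w_max. apply Rdiv_lt_0_compat; [|assumption].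
  pose proof (Rinv_0_lt_compat lam Hlam). lra. }
assert (C1 : for_small (fun n => 0 < fK n - Q - kap)).
{ apply (for_small_continuous (fun n => fK n - Q - kap)); [|unfold kap; lra].
  apply (ex_derive_continuous (fun n => fK n - Q - kap)). unfold fK, fa. auto_derive. lra. }
assert (C2 : for_small (fun n => 0 < lam * (1 - n) * Q - fJ n - del)).
{ apply (for_small_continuous (fun n => lam * (1 - n) * Q - fJ n - del)).
  - apply (ex_derive_continuous (fun n => lam * (1 - n) * Q - fJ n - del)). unfold fJ, fa, fb. auto_derive. lra.
  - rewrite HJ0. unfold del. lra. }
assert (C3 : for_small (fun n => n < m / 2)) by (exists (m / 2); split; [lra|intros; lra]).
pose proof (for_small_mult (2 / kap) 1 ltac:(lra)) as C4.
pose proof (for_small_mult (3 + 2 * weight_exponent lam A B P Q kap) (kap / 2) ltac:(lra)) as C5.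
pose proof (for_small_mult (error_bound lam A B P Q kap * (1 + lam * lam * P)) 1 ltac:(lra)) as C6.
pose proof (for_small_mult (error_bound lam A B P Q kap * lam * (B + lam * Q)) del Hdel) as C7.
pose proof (for_small_mult (2 * (2 * speed_rate lam A B P Q + w_speed_ratio lam P kap * speed_rate_w lam A B P Q))
  (kap / 4) ltac:(lra)) as C8.
pose proof (for_small_mult (4 * speed_rate' lam A B P Q kap) (kap / 4) ltac:(lra)) as C9.
(* [m / 2] replaces [mu = m - n], which exceeds it once [n < m / 2]. *)
pose proof (for_small_mult (A * w_speed_ratio lam P kap * error_weight lam B P Q) (m / 2) ltac:(lra)) as C10.
pose proof (for_small_mult (A * w_speed_ratio lam P kap * q_speed lam A B P Q +
        A / lam * (A * A * (/ lam + lam * P) * slope_ratio lam A B P Q kap)) _ Hwm) as C11.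
destruct (for_small_and _ _ C1 (for_small_and _ _ C2 (for_small_and _ _ C3 (for_small_and _ _ C4
  (for_small_and _ _ C5 (for_small_and _ _ C6 (for_small_and _ _ C7 (for_small_and _ _ C8
  (for_small_and _ _ C9 (for_small_and _ _ C10 C11)))))))))) as [n0 [Hn0 Hsmall]].
clear C1 C2 C3 C4 C5 C6 C7 C8 C9 C10 C11.
exists n0. split; [assumption|]. intros n Hn.
destruct (Hsmall n Hn) as [D1 [D2 [D3 [D4 [D5 [D6 [D7 [D8 [D9 [D10 D11]]]]]]]]]]. clear Hsmall.
assert (Hnm : 0 < n < m) by lra.
assert (Ea : coef_a lam m n = fa n) by (apply coef_a_eq; assumption).
assert (Eb : coef_b lam m n = fb n) by (apply coef_b_eq; assumption).
assert (Ha0 : 0 < coef_a lam m n) by (apply coef_a_pos; assumption).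
assert (HaA : coef_a lam m n <= A).
{ rewrite Ea. unfold fa, A. apply Rmult_le_reg_r with (1 + (m - n)); [lra|].
  unfold Rdiv. rewrite Rmult_assoc, Rinv_l by lra. nra. }
assert (Hb : 0 < coef_b lam m n <= B).
{ rewrite Eb. unfold fb, B. split.
  - assert (0 < (1 - (m - n)) * lam) by (apply Rmult_lt_0_compat; lra). apply Rdiv_lt_0_compat; lra.
  - apply Rmult_le_reg_r with (1 + (m - n)); [lra|].
    unfold Rdiv. rewrite Rmult_assoc, Rinv_l by lra. nra. }
assert (EK : (m - n) * coef_a lam m n / lam = fK n) by (rewrite Ea; reflexivity).
assert (EJ : (m - n) * coef_a lam m n * coef_b lam m n = fJ n) by (rewrite Ea, Eb; reflexivity).
assert (Hn2 : 2 * n < kap).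
{ apply Rmult_lt_compat_r with (r := kap) in D4; [|assumption].
  replace (n * (2 / kap) * kap) with (2 * n) in D4 by (field; lra). lra. }
assert (HK1 : 1 < (m - n) * coef_a lam m n / lam) by (rewrite EK; lra).
assert (HKn : 2 * n < (m - n) * coef_a lam m n / lam) by (rewrite EK; lra).
split; [now apply parameters_admissible|].
destruct (coef_A_large lam m n) as [HA1 HA2]; trivial.
split; [exact HA1|]. split; [exact HA2|].
destruct (orbit_exists lam (m - n) n (coef_a lam m n) (coef_b lam m n) A B P Q kap del)
  as [p [q [w [C [S1 [S2 [S3 [S4 [L1 [L2 [L3 As]]]]]]]]]]]; trivial; try lra.
all: try exact Ea; try exact Eb; try (rewrite EJ; lra).
- exists p, q, (fun s => / w s). split.
  + now apply (inv_heteroclinic lam m n C) with (w := w).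
  (* [kappa = 1], since the orbit is normalized by [p ~ exp (2 s)] and [X02] has first component
     [1]. *)
  + exists 1. split; [lra|]. now apply (inv_departs_along_X02 lam m n C) with (w := w).
Qed.
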